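(* Let $(M,g,\Upsilon)$ be a nearly integrable $\mathbf{SO}(3)$ geometry admitting a 5-dimensional transitive symmetry group $G$. Assume, in addition, that the torsion of its characteristic connection is nonzero and of pure type $\bigwedge^2_3$. Then: (i) Modulo a constant $\mathbf{SO}(3)$ gauge transformation, it is defined by means of an adapted coframe $(\theta^1,\dots,\theta^5)$ satisfying the differential system $$\begin{aligned} d\theta^1&=-\tfrac23\sqrt3\,\varrho\epsilon\big(\theta^2\wedge\theta^4+(2-3\delta)\theta^3\wedge\theta^5\big)\\ d\theta^2&=-2\varrho\cos\varphi\,\theta^2\wedge\theta^4\\ d\theta^3&=-\varrho\cos\varphi\,\theta^2\wedge\theta^5+\sqrt3\varrho\epsilon(1-\delta)\theta^1\wedge\theta^5+\varrho\epsilon\delta\,\theta^2\wedge\theta^3+\varrho(\delta\epsilon-\sin\varphi)\theta^4\wedge\theta^5\\ d\theta^4&=-2\varrho\sin\varphi\,\theta^2\wedge\theta^4\\ d\theta^5&=\varrho\cos\varphi\,\theta^2\wedge\theta^3+\sqrt3\varrho\epsilon(\delta-1)\theta^1\wedge\theta^3-\varrho\epsilon\delta\,\theta^2\wedge\theta^5-\varrho(\delta\epsilon+\sin\varphi)\theta^3\wedge\theta^4, \end{aligned}$$ with constant parameters $\varrho>0$, $\varphi\in[0,2\pi[$, $\epsilon=\pm1$, $\delta=0,1$. (ii) $G\cong G_\delta$. (iii) For all values of the parameters $\epsilon,\delta,\varrho,\varphi$ the curvature of the characteristic connection is of type $\bigodot^2_1\oplus\bigodot^2_5\oplus\bigwedge^1_5$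 with all the irreducible components non-zero.
   Context: An $\mathbf{SO}(3)$ structure on a 5-dimensional Riemannian manifold $(M,g)$ is given by a rank 3 tensor field $\Upsilon$ such that the map $v\mapsto\Upsilon_v\in\mathrm{End}(TM)$, $(\Upsilon_v)_{ij}=\Upsilon_{ijk}v_k$, is totally symmetric, trace free and satisfies $\Upsilon_v^2v=g(v,v)v$. Adapted coframes are $g$-orthonormal coframes with $\Upsilon=\tfrac12\theta_1(6\theta_2^2+6\theta_4^2-2\theta_1^2-3\theta_3^2-3\theta_5^2)+\tfrac{3\sqrt3}{2}\theta_4(\theta_5^2-\theta_3^2)+3\sqrt3\theta_2\theta_3\theta_5$; they are given up to the action of the irreducible $\mathbf{SO}(3)\subset\mathbf{SO}(5)$ stabilising $\Upsilon$. Symmetries are (local) diffeomorphisms preserving $g$ and $\Upsilon$. The structure is nearly integrable if $(\nabla^{LC}_v\Upsilon)(v,v,v)\equiv0$; then there is a unique characteristic connection, i.e. a connection given in adapted coframes by $\Gamma=\gamma^1E_1+\gamma^2E_2+\gamma^3E_3$ whose torsion $d\theta^i+\Gamma^i{}_j\wedge\theta^j=\tfrac12T_{ijk}\theta^j\wedge\theta^k$ is totally skew. Here $e_{ij}$ is the antisymmetric $5\times5$ matrix with $1$ at $(i,j)$, $-1$ at $(j,i)$, and $E_1=\sqrt3e_{15}+e_{23}+e_{45}$, $E_2=\sqrt3e_{13}+e_{25}+e_{34}$, $E_3=2e_{24}+e_{35}$. Under $\mathbf{SO}(3)$, $\bigwedge^2\mathbb{R}^5=\bigwedge^2_3\oplus\bigwedge^2_7$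 with $\bigwedge^2_3=\mathrm{Span}(E_1,E_2,E_3)$ and $\bigwedge^2_7$ its orthogonal complement; using the Hodge star identification $\bigwedge^3\mathbb{R}^5=\bigwedge^2\mathbb{R}^5$, the torsion 3-form $T=\tfrac16T_{ijk}\theta^i\wedge\theta^j\wedge\theta^k$ is of pure type $\bigwedge^2_3$ if $*T\in\bigwedge^2_3$. Also $\bigodot^2\mathbb{R}^5=\bigodot^2_1\oplus\bigodot^2_5\oplus\bigodot^2_9$ with $\bigodot^2_1=\mathbb{R}g$, $\bigodot^2_5=\{\Upsilon_v:v\in\mathbb{R}^5\}$, $\bigodot^2_9$ the orthogonal complement of these two. The curvature $K^i{}_j=\tfrac12K^i{}_{jkl}\theta^k\wedge\theta^l=d\Gamma^i{}_j+\Gamma^i{}_k\wedge\Gamma^k{}_j$ takes values in $\mathfrak{so}(3)\otimes\bigwedge^2\mathbb{R}^5\cong\bigodot^2_1\oplus\bigwedge^2_3\oplus\bigwedge^2_7\oplus\bigodot^2_5\oplus\bigodot^2_9\oplus\bigwedge^1_5$, the components being: $K_{[ijkl]}\in\bigwedge^4\mathbb{R}^5=\bigwedge^1_5$; and, with $k_{jl}=K_{ijil}$, the antisymmetric part $k_{[jl]}\in\bigwedge^2_3\oplus\bigwedge^2_7$, the trace-free symmetric part $k_{(jl)}-\tfrac15k_{ii}g_{jl}\in\bigodot^2_5\oplus\bigodot^2_9$, and the trace $k_{ii}\in\bigodot^2_1$. $G_0=\mathbf{SO}(3)\times \mathrm{Aff}(1)$, where $\mathrm{Aff}(1)$ is the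 affine group in dimension 1. $G_1$ is a 5-dimensional Lie group with a left invariant coframe satisfying $d\alpha^1=0$, $d\alpha^2=\alpha^1\wedge\alpha^2$, $d\alpha^3=-2\alpha^1\wedge\alpha^3$, $d\alpha^4=-\alpha^1\wedge\alpha^4+\alpha^2\wedge\alpha^3$, $d\alpha^5=\alpha^2\wedge\alpha^4$. The isomorphism $G\cong G_\delta$ is understood at the level of Lie algebras (local Lie groups). *)

(* Defs.v *)
From HB Require Import structures.
From mathcomp Require Import all_boot all_order all_algebra all_fingroup.
From mathcomp Require Import all_classical all_reals all_analysis.
Set Implicit Arguments.
Unset Strict Implicit.
Unset Printing Implicit Defensive.
Import Order.TTheory GRing.Theory Num.Theory.
Import numFieldNormedType.Exports.
Local Open Scope classical_set_scope.
Local Open Scope ring_scope.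

(* In a chart, points, tangent vectors and covectors are row vectors in       *)
(* 'rV_5, and a 2-form w is the matrix of the w(d_m, d_n).                    *)

Definition partial {R : realType} (m : 'I_5) (f : 'rV[R]_5 -> R)
  : 'rV[R]_5 -> R := fun x => 'D_(delta_mx 0 m) f x.

(* C^oo on the open set V: all iterated partial derivatives exist and are     *)
(* continuous at the points of V.                                             *)
Definition smooth_on {R : realType} (V : set 'rV[R]_5) (f : 'rV[R]_5 -> R)
  : Prop :=
  forall (s : seq 'I_5) (m : 'I_5) (x : 'rV[R]_5), V x ->
    {for x, continuous (foldr partial f s)} /\
    derivable (foldr partial f s) x (delta_mx 0 m).

Definition smooth_row {R : realType} (V : set 'rV[R]_5)
    (w : 'rV[R]_5 -> 'rV[R]_5) : Prop :=
  forall m : 'I_5, smooth_on V (fun x => w x 0 m).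

Definition ext_d {R : realType} (w : 'rV[R]_5 -> 'rV[R]_5) (x : 'rV[R]_5)
  : 'M[R]_5 :=
  \matrix_(m, n) (partial m (fun y => w y 0 n) x
                  - partial n (fun y => w y 0 m) x).

Definition wedge {R : realType} (a b : 'rV[R]_5) : 'M[R]_5 :=
  \matrix_(m, n) (a 0 m * b 0 n - a 0 n * b 0 m).

Definition field_bracket {R : realType} (X Z : 'rV[R]_5 -> 'rV[R]_5)
    (x : 'rV[R]_5) : 'rV[R]_5 :=
  \row_r \sum_s (X x 0 s * partial s (fun y => Z y 0 r) x
                 - Z x 0 s * partial s (fun y => X y 0 r) x).

Definition lie_form {R : realType} (X w : 'rV[R]_5 -> 'rV[R]_5)
    (x : 'rV[R]_5) : 'rV[R]_5 :=
  \row_m \sum_r (X x 0 r * partial r (fun y => w y 0 m) x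
                 + w x 0 r * partial m (fun y => X y 0 r) x).

Definition lie_metric {R : realType} (X : 'rV[R]_5 -> 'rV[R]_5)
    (g : 'rV[R]_5 -> 'M[R]_5) (x : 'rV[R]_5) : 'M[R]_5 :=
  \matrix_(m, n) \sum_r (X x 0 r * partial r (fun y => g y m n) x
                         + g x r n * partial m (fun y => X y 0 r) x
                         + g x m r * partial n (fun y => X y 0 r) x).

Definition lie_cubic {R : realType} (X : 'rV[R]_5 -> 'rV[R]_5)
    (Y : 'rV[R]_5 -> 'I_5 -> 'I_5 -> 'I_5 -> R) (x : 'rV[R]_5)
    (i j k : 'I_5) : R :=
  \sum_r (X x 0 r * partial r (fun y => Y y i j k) x
          + Y x r j k * partial i (fun y => X y 0 r) x
          + Y x i r k * partial j (fun y => X y 0 r) x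
          + Y x i j r * partial k (fun y => X y 0 r) x).

Record manifold (R : realType) := Manifold {
  pts :> topologicalType;
  chart : Type;
  cdom : chart -> set pts;
  chart_coord : chart -> pts -> 'rV[R]_5;
  chart_param : chart -> 'rV[R]_5 -> pts;
  mfd_hausdorff : hausdorff_space pts;
  mfd_second_countable : @second_countable pts;
  mfd_connected : connected [set: pts];
  cdom_open : forall a, open (cdom a);
  cdom_cover : forall p, exists a, cdom a p;
  cim_open : forall a, open (chart_coord a @` cdom a);
  coordK : forall a p, cdom a p -> chart_param a (chart_coord a p) = p;
  coord_continuous :
    forall a p, cdom a p -> {for p, continuous (chart_coord a)};
  param_continuous :
    forall a p, cdom a p -> {for chart_coord a p, continuous (chart_param a)};
  transition_smooth : forall a b,
    smooth_row (chart_coord a @` (cdom a `&` cdom b))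
               (fun x => chart_coord b (chart_param a x))
}.

Definition cim {R : realType} (M : manifold R) (a : chart M)
  : set 'rV[R]_5 := chart_coord a @` cdom a.

Definition overlap {R : realType} (M : manifold R) (a b : chart M)
  : set 'rV[R]_5 := chart_coord a @` (cdom a `&` cdom b).

Definition transition {R : realType} (M : manifold R) (a b : chart M)
    (x : 'rV[R]_5) : 'rV[R]_5 := chart_coord b (chart_param a x).

Definition jacobian {R : realType} (M : manifold R) (a b : chart M)
    (x : 'rV[R]_5) : 'M[R]_5 :=
  \matrix_(r, m) partial m (fun y => transition a b y 0 r) x.

Definition cubic_mx {R : realType} (Y : 'I_5 -> 'I_5 -> 'I_5 -> R)
    (v : 'rV[R]_5) : 'M[R]_5 :=
  \matrix_(i, j) \sum_k Y i j k * v 0 k.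

Definition cubic_form {R : realType} (Y : 'I_5 -> 'I_5 -> 'I_5 -> R)
    (v : 'rV[R]_5) : R :=
  \sum_i \sum_j \sum_k Y i j k * v 0 i * v 0 j * v 0 k.

(* The endomorphism Y_v: first index of Y_ijk v_k raised with the metric; it  *)
(* acts on column vectors.                                                    *)
Definition cubic_end {R : realType} (g : 'M[R]_5)
    (Y : 'I_5 -> 'I_5 -> 'I_5 -> R) (v : 'rV[R]_5) : 'M[R]_5 :=
  invmx g *m cubic_mx Y v.

Record so3_structure (R : realType) (M : manifold R) := SO3Structure {
  metric : chart M -> 'rV[R]_5 -> 'M[R]_5;
  ups : chart M -> 'rV[R]_5 -> 'I_5 -> 'I_5 -> 'I_5 -> R;
  metric_smooth : forall a i j, smooth_on (cim a) (fun x => metric a x i j);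
  metric_tensor : forall a b x, overlap a b x ->
    metric a x = (jacobian a b x)^T *m metric b (transition a b x)
                 *m jacobian a b x;
  metric_sym : forall a x, cim a x -> (metric a x)^T = metric a x;
  metric_pos : forall a x (v : 'rV[R]_5), cim a x -> v != 0 ->
    0 < (v *m metric a x *m v^T) 0 0;
  ups_smooth : forall a i j k, smooth_on (cim a) (fun x => ups a x i j k);
  ups_tensor : forall a b x i j k, overlap a b x ->
    ups a x i j k =
      \sum_p \sum_q \sum_r ups b (transition a b x) p q r
        * jacobian a b x p i * jacobian a b x q j * jacobian a b x r k;
  ups_sym : forall a x i j k, cim a x ->
    ups a x i j k = ups a x j i k /\ ups a x i j k = ups a x i k j;
  ups_tracefree : forall a x (v : 'rV[R]_5), cim a x ->
    \tr (cubic_end (metric a x) (ups a x) v) = 0;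
  ups_square : forall a x (v : 'rV[R]_5), cim a x ->
    cubic_end (metric a x) (ups a x) v *m
      (cubic_end (metric a x) (ups a x) v *m v^T)
    = (v *m metric a x *m v^T) 0 0 *: v^T
}.

Definition christoffel {R : realType} (g : 'rV[R]_5 -> 'M[R]_5)
    (x : 'rV[R]_5) (k i j : 'I_5) : R :=
  2^-1 * \sum_l invmx (g x) k l *
    (partial i (fun y => g y j l) x + partial j (fun y => g y i l) x
     - partial l (fun y => g y i j) x).

Definition levi_civita_cubic {R : realType} (g : 'rV[R]_5 -> 'M[R]_5)
    (Y : 'rV[R]_5 -> 'I_5 -> 'I_5 -> 'I_5 -> R)
    (x : 'rV[R]_5) (m i j k : 'I_5) : R :=
  partial m (fun y => Y y i j k) x
  - \sum_l (christoffel g x l m i * Y x l j k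
            + christoffel g x l m j * Y x i l k
            + christoffel g x l m k * Y x i j l).

Definition nearly_integrable {R : realType} (M : manifold R)
    (S : so3_structure M) : Prop :=
  forall (a : chart M) (x v : 'rV[R]_5), cim a x ->
    \sum_m v 0 m * cubic_form (levi_civita_cubic (metric S a) (ups S a) x m) v
    = 0.

(* A five-dimensional Lie algebra with structure constants c, realised by the *)
(* vector fields X_1, ..., X_5 as infinitesimal symmetries of (g, Upsilon)    *)
(* spanning every tangent space.                                              *)
Record transitive_symmetry_algebra (R : realType) (M : manifold R)
    (S : so3_structure M) (c : 'I_5 -> 'I_5 -> 'I_5 -> R)
    (X : 'I_5 -> chart M -> 'rV[R]_5 -> 'rV[R]_5) : Prop := {
  field_smooth : forall s a, smooth_row (cim a) (X s a);
  field_vector : forall s a b x, overlap a b x ->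
    X s b (transition a b x) = X s a x *m (jacobian a b x)^T;
  field_metric : forall s a x, cim a x ->
    lie_metric (X s a) (metric S a) x = 0;
  field_ups : forall s a x i j k, cim a x ->
    lie_cubic (X s a) (ups S a) x i j k = 0;
  field_closed : forall s t a x, cim a x ->
    field_bracket (X s a) (X t a) x = \sum_u c s t u *: X u a x;
  field_transitive : forall a x, cim a x ->
    (\matrix_s X s a x : 'M[R]_5) \in unitmx
}.

Definition o1 : 'I_5 := @Ordinal 5 0 isT.
Definition o2 : 'I_5 := @Ordinal 5 1 isT.
Definition o3 : 'I_5 := @Ordinal 5 2 isT.
Definition o4 : 'I_5 := @Ordinal 5 3 isT.
Definition o5 : 'I_5 := @Ordinal 5 4 isT.

Definition ups0_form {R : realType} (t : 'rV[R]_5) : R :=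
  let t1 := t 0 o1 in let t2 := t 0 o2 in let t3 := t 0 o3 in
  let t4 := t 0 o4 in let t5 := t 0 o5 in
  2^-1 * t1 * (6 * t2 ^+ 2 + 6 * t4 ^+ 2 - 2 * t1 ^+ 2
               - 3 * t3 ^+ 2 - 3 * t5 ^+ 2)
  + 3 * Num.sqrt 3 / 2 * t4 * (t5 ^+ 2 - t3 ^+ 2)
  + 3 * Num.sqrt 3 * t2 * t3 * t5.

(* The symmetric tensor with ups0_form v = Y_ijk v_i v_j v_k (polarization). *)
Definition ups0 {R : realType} (i j k : 'I_5) : R :=
  let e (l : 'I_5) : 'rV[R]_5 := delta_mx 0 l in
  6^-1 * (ups0_form (e i + e j + e k) - ups0_form (e i + e j)
          - ups0_form (e j + e k) - ups0_form (e i + e k)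
          + ups0_form (e i) + ups0_form (e j) + ups0_form (e k)).

Definition eskew {R : realType} (i j : 'I_5) : 'M[R]_5 :=
  delta_mx i j - delta_mx j i.

Definition Emx {R : realType} (s : 'I_3) : 'M[R]_5 :=
  nth 0 [:: Num.sqrt 3 *: eskew o1 o5 + eskew o2 o3 + eskew o4 o5;
            Num.sqrt 3 *: eskew o1 o3 + eskew o2 o5 + eskew o3 o4;
            2 *: eskew o2 o4 + eskew o3 o5] s.

(* The rows of coframe_mx th x are the 1-forms theta^i at x, and the columns  *)
(* of its inverse are the dual frame.                                         *)
Definition coframe_mx {R : realType} (th : 'I_5 -> 'rV[R]_5 -> 'rV[R]_5)
    (x : 'rV[R]_5) : 'M[R]_5 := \matrix_i th i x.

Definition coframe_on {R : realType} (V : set 'rV[R]_5)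
    (th : 'I_5 -> 'rV[R]_5 -> 'rV[R]_5) : Prop :=
  (forall i, smooth_row V (th i)) /\
  (forall x, V x -> coframe_mx th x \in unitmx).

Definition adapted_on {R : realType} (M : manifold R) (S : so3_structure M)
    (a : chart M) (V : set 'rV[R]_5)
    (th : 'I_5 -> 'rV[R]_5 -> 'rV[R]_5) : Prop :=
  [/\ open V, V `<=` cim a, coframe_on V th &
      forall x, V x ->
        metric S a x = (coframe_mx th x)^T *m coframe_mx th x /\
        forall v : 'rV[R]_5,
          cubic_form (ups S a x) v = ups0_form (v *m (coframe_mx th x)^T)].

(* Components w(e_k, e_l) of a 2-form w in the frame dual to th. *)
Definition frame_comp {R : realType} (th : 'I_5 -> 'rV[R]_5 -> 'rV[R]_5)
    (x : 'rV[R]_5) (w : 'M[R]_5) : 'M[R]_5 :=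
  (invmx (coframe_mx th x))^T *m w *m invmx (coframe_mx th x).

Definition conn_form {R : realType} (ga : 'I_3 -> 'rV[R]_5 -> 'rV[R]_5)
    (i j : 'I_5) (x : 'rV[R]_5) : 'rV[R]_5 :=
  \sum_s Emx s i j *: ga s x.

(* T_ijk with d theta^i + Gamma^i_j /\ theta^j = 1/2 T_ijk theta^j /\ theta^k *)
Definition torsion {R : realType} (th : 'I_5 -> 'rV[R]_5 -> 'rV[R]_5)
    (ga : 'I_3 -> 'rV[R]_5 -> 'rV[R]_5) (x : 'rV[R]_5) (i j k : 'I_5) : R :=
  frame_comp th x
    (ext_d (th i) x + \sum_l wedge (conn_form ga i l x) (th l x)) j k.

(* K_ijkl with K^i_j = 1/2 K_ijkl theta^k /\ theta^l *)
Definition curvature {R : realType} (th : 'I_5 -> 'rV[R]_5 -> 'rV[R]_5)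
    (ga : 'I_3 -> 'rV[R]_5 -> 'rV[R]_5) (x : 'rV[R]_5) (i j k l : 'I_5) : R :=
  frame_comp th x
    (ext_d (conn_form ga i j) x
     + \sum_m wedge (conn_form ga i m x) (conn_form ga m j x)) k l.

(* Skewness in the last two indices of T_ijk is automatic. *)
Definition characteristic_connection {R : realType} (V : set 'rV[R]_5)
    (th : 'I_5 -> 'rV[R]_5 -> 'rV[R]_5)
    (ga : 'I_3 -> 'rV[R]_5 -> 'rV[R]_5) : Prop :=
  (forall s, smooth_row V (ga s)) /\
  (forall x i j k, V x -> torsion th ga x i j k = - torsion th ga x j i k).

Definition levi_civita_symbol {R : realType} (t : 'I_5 -> 'I_5) : R :=
  \det (\matrix_(r, s) (t r == s)%:R : 'M[R]_5).

Definition hodge3 {R : realType} (T : 'I_5 -> 'I_5 -> 'I_5 -> R) : 'M[R]_5 :=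
  \matrix_(l, m) (6^-1 * \sum_i \sum_j \sum_k
    levi_civita_symbol (nth o1 [:: i; j; k; l; m]) * T i j k).

Definition in_Lambda2_3 {R : realType} (F : 'M[R]_5) : Prop :=
  exists u : 'I_3 -> R, F = \sum_s u s *: Emx s.

Definition torsion_pure_Lambda2_3 {R : realType} (M : manifold R)
    (S : so3_structure M) : Prop :=
  forall (a : chart M) V th ga x,
    adapted_on S a V th -> characteristic_connection V th ga -> V x ->
    in_Lambda2_3 (hodge3 (torsion th ga x)).

Definition torsion_nonzero {R : realType} (M : manifold R)
    (S : so3_structure M) : Prop :=
  exists (a : chart M) V th ga x,
    [/\ adapted_on S a V th, characteristic_connection V th ga, V x &
        exists i j k, torsion th ga x i j k != 0].

(* K_[ijkl] for (i,j,k,l) = (t 0, t 1, t 2, t 3) *)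
Definition curv_Lambda4 {R : realType} (K : 'I_5 -> 'I_5 -> 'I_5 -> 'I_5 -> R)
    (t : 'I_4 -> 'I_5) : R :=
  24^-1 * \sum_(s : 'S_4) (-1) ^+ s *
    K (t (s (inord 0))) (t (s (inord 1))) (t (s (inord 2))) (t (s (inord 3))).

Definition curv_ricci {R : realType} (K : 'I_5 -> 'I_5 -> 'I_5 -> 'I_5 -> R)
  : 'M[R]_5 := \matrix_(j, l) \sum_i K i j i l.

Definition curv_skew {R : realType} (K : 'I_5 -> 'I_5 -> 'I_5 -> 'I_5 -> R)
  : 'M[R]_5 := 2^-1 *: (curv_ricci K - (curv_ricci K)^T).

Definition curv_sym0 {R : realType} (K : 'I_5 -> 'I_5 -> 'I_5 -> 'I_5 -> R)
  : 'M[R]_5 :=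
  2^-1 *: (curv_ricci K + (curv_ricci K)^T) - (5^-1 * \tr (curv_ricci K))%:M.

Definition in_Sym2_5 {R : realType} (F : 'M[R]_5) : Prop :=
  exists v : 'rV[R]_5, F = cubic_mx ups0 v.

(* Type Sym2_1 + Sym2_5 + Lambda1_5, with all three components nonzero; the   *)
(* Lambda2_3, Lambda2_7 components are those of curv_skew K, and the Sym2_9   *)
(* component is the part of curv_sym0 K transversal to Sym2_5.                *)
Definition curvature_type_1_5_5 {R : realType}
    (K : 'I_5 -> 'I_5 -> 'I_5 -> 'I_5 -> R) : Prop :=
  [/\ curv_skew K = 0,
      in_Sym2_5 (curv_sym0 K),
      \tr (curv_ricci K) != 0,
      curv_sym0 K != 0 &
      exists t : 'I_4 -> 'I_5, curv_Lambda4 K t != 0].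

Definition parameters {R : realType} (rho phi eps del : R) : Prop :=
  [/\ 0 < rho, 0 <= phi < 2 * pi, eps = 1 \/ eps = -1 & del = 0 \/ del = 1].

Definition diff_system {R : realType} (rho phi eps del : R)
    (V : set 'rV[R]_5) (th : 'I_5 -> 'rV[R]_5 -> 'rV[R]_5) : Prop :=
  forall x, V x ->
  let W i j := wedge (th i x) (th j x) in
  [/\ ext_d (th o1) x =
        (- (2 / 3 * Num.sqrt 3 * rho * eps)) *:
          (W o2 o4 + (2 - 3 * del) *: W o3 o5),
      ext_d (th o2) x = (- (2 * rho * cos phi)) *: W o2 o4,
      ext_d (th o3) x =
        (- (rho * cos phi)) *: W o2 o5
        + (Num.sqrt 3 * rho * eps * (1 - del)) *: W o1 o5
        + (rho * eps * del) *: W o2 o3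
        + (rho * (del * eps - sin phi)) *: W o4 o5,
      ext_d (th o4) x = (- (2 * rho * sin phi)) *: W o2 o4 &
      ext_d (th o5) x =
        (rho * cos phi) *: W o2 o3
        + (Num.sqrt 3 * rho * eps * (del - 1)) *: W o1 o3
        - (rho * eps * del) *: W o2 o5
        - (rho * (del * eps + sin phi)) *: W o3 o4].

Definition lie_isomorphic {R : realType} (V W : lmodType R)
    (brV : V -> V -> V) (L : set W) (brW : W -> W -> W) : Prop :=
  exists f : {linear V -> W},
    [/\ injective f, range f = L &
        forall u v, f (brV u v) = brW (f u) (f v)].

Definition bracket_of {R : realType} (c : 'I_5 -> 'I_5 -> 'I_5 -> R)
    (u v : 'rV[R]_5) : 'rV[R]_5 :=
  \row_k \sum_i \sum_j u 0 i * v 0 j * c i j k.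

(* so(3) + aff(1): skew 3x3 matrices, and the matrices [[a, b], [0, 0]]. *)
Definition G0_algebra {R : realType} : set ('M[R]_3 * 'M[R]_2)%type :=
  [set P | P.1^T = - P.1 /\ row ord_max P.2 = 0].

Definition G0_bracket {R : realType} (P Q : ('M[R]_3 * 'M[R]_2)%type)
  : ('M[R]_3 * 'M[R]_2)%type :=
  (P.1 *m Q.1 - Q.1 *m P.1, P.2 *m Q.2 - Q.2 *m P.2).

(* alpha^i is the i-th coordinate, and (d alpha^i)(u, v) = - alpha^i [u, v]. *)
Definition G1_bracket {R : realType} (u v : 'rV[R]_5) : 'rV[R]_5 :=
  let w i j := u 0 i * v 0 j - u 0 j * v 0 i in
  - \row_(i < 5) nth 0 [:: 0;
                           w o1 o2;
                           - 2 * w o1 o3;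
                           - w o1 o4 + w o2 o3;
                           w o2 o4] i.

(* Main.v *)
Require Import Defs.
From HB Require Import structures.
From mathcomp Require Import all_boot all_order all_algebra all_fingroup.
From mathcomp Require Import all_classical all_reals all_analysis.
From mathcomp Require Import ring lra.
Import Order.TTheory GRing.Theory Num.Theory.
Import numFieldNormedType.Exports.
Set Implicit Arguments.
Unset Strict Implicit.
Unset Printing Implicit Defensive.
Local Open Scope classical_set_scope.
Local Open Scope ring_scope.

(** Fix a point and an adapted coframe theta there. A symmetry kills g and
    Upsilon, whose components in theta are constant, so it moves theta by an
    element of the stabiliser of Upsilon in so(5), which is the irreducible
    so(3) ([so3_stabiliser], [lie_adapted]). Cartan's formula then expresses
    the structure constants of the symmetry algebra, in the basis given by the
    matrix theta^i(X_s), as T - Gamma /\ theta, with T the characteristic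
    torsion and Gamma an unknown so(3)-valued covector: 15 unknowns
    ([symmetry_brackets]). As T corresponds to an element of so(3), a rotation
    brings it along E_3, and the Jacobi identity becomes a polynomial system,
    which is solved in [jacobi_solutions]: the brackets are the ones of the
    differential system, with delta = 0 or 1. A last rotation about E_3 gives
    phi = 0 ([standard_frame]).

    This is at one point, with no control on how theta varies. An invariant
    coframe is obtained algebraically. The covector s |-> tr (ad X_s) defines
    an invariant 1-form, equal to 2 rho theta^4 in a standard frame. The
    length of the dual vector field and the value of Upsilon on it are
    invariant functions, hence locally constant. Let a be the unit vector of
    its direction. The endomorphism Upsilon_a has the simple eigenvalues 0 and
    plus or minus sqrt 3 / 2 on the orthogonal of a and Upsilon_a a, and its
    eigenvectors complete these two vectors into an adapted frame
    ([cubic_frame_standard], [canonical_coframe]). The rotation by which a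
    symmetry acts on the coframe fixes theta^4, so it is zero
    ([lie_form_invariant]), and the brackets in this coframe are constant
    ([frame_brackets_constant]). Where the brackets are standard at one point,
    the coframe differs from the standard frame by signs ([SO3_fixing_o4]), so
    they are standard on a neighbourhood; connectedness of the manifold
    extends this everywhere ([std_point_everywhere]). This gives (i), and (ii)
    by writing linear isomorphisms from the standard brackets to the two
    model algebras ([lie_isomorphic_G0], [lie_isomorphic_G1]).

    For (iii), a characteristic connection is unique, because so(3) (x) R^5
    contains no nonzero totally skew tensor ([conn_coef_skew_eq0]); for the
    differential system it has constant coefficients in the coframe, so its
    curvature is a constant tensor \sum_s E_s F_s, whose components are
    computed ([so3_curvatureE], [curvature_components]). *)

(** * Smooth functions on an open set *)

Definition C1_on {R : realType} (V : set 'rV[R]_5) (f : 'rV[R]_5 -> R) : Prop :=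
  forall x, V x -> {for x, continuous f} /\
    forall m : 'I_5, derivable f x (delta_mx 0 m).

Section Smooth.
Variable R : realType.
Implicit Types (V : set 'rV[R]_5) (f g : 'rV[R]_5 -> R).

Lemma partial_ext V f g : open V -> (forall x, V x -> f x = g x) ->
  forall m x, V x -> partial m f x = partial m g x.
Proof.
move=> oV fg m x Vx; apply: near_eq_derive.
by near do apply: fg; exact: open_nbhs_nbhs.
Unshelve. all: by end_near. Qed.

Lemma C1_ext V f g : open V -> (forall x, V x -> f x = g x) ->
  C1_on V f -> C1_on V g.
Proof.
move=> oV fg c1 x Vx; have [cf df] := c1 x Vx.
have nfg : \forall y \near x, f y = g y.
  by near do apply: fg; exact: open_nbhs_nbhs.
split; last by move=> m; apply: near_eq_derivable (df m).
rewrite /prop_for /continuous_at -(fg _ Vx); apply: cvg_trans cf.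
apply: (@near_eq_cvg _ _ (nbhs x)); apply: filterS nfg => y ->.
by [].
Unshelve. all: by end_near. Qed.

Lemma smooth_onS V f : smooth_on V f <->
  C1_on V f /\ forall m, smooth_on V (partial m f).
Proof.
split=> [sf|[c1 sp]].
  split=> [x Vx|m s m' x Vx].
    by split=> [|m]; [case: (sf [::] o1 x Vx)|case: (sf [::] m x Vx)].
  by have := sf (rcons s m) m' x Vx; rewrite -cats1 foldr_cat.
move=> s m x Vx; case/lastP: s => [|s m'].
  by have [? ?] := c1 x Vx; split.
by rewrite -cats1 foldr_cat; exact: sp.
Qed.

(** Smoothness by coinduction: a class of C^1 functions that contains, up to
    equality on V, the partial derivatives of its members consists of smooth
    functions. No formula for an iterated derivative is ever needed. *)
Lemma smooth_coind V (Q : ('rV[R]_5 -> R) -> Prop) : open V ->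
  (forall f, Q f -> C1_on V f) ->
  (forall f m, Q f ->
     exists2 g, Q g & forall x, V x -> partial m f x = g x) ->
  forall f, Q f -> smooth_on V f.
Proof.
move=> oV Qc Qp f Qf s m.
suff [g Qg fg] : exists2 g, Q g & forall x, V x -> g x = foldr partial f s x.
  by move=> x Vx; have [? ?] := C1_ext oV fg (Qc g Qg) Vx; split.
elim: s {m} => [|m s [g Qg fg]] /=; first by exists f.
have [h Qh gh] := Qp g m Qg; exists h => // x Vx.
by rewrite -gh//; apply: (partial_ext oV).
Qed.

Lemma smooth_C1 V f : smooth_on V f -> C1_on V f.
Proof. by case/smooth_onS. Qed.

Lemma smooth_partial V f m : smooth_on V f -> smooth_on V (partial m f).
Proof. by case/smooth_onS. Qed.

Lemma smooth_sub V V' f : V' `<=` V -> smooth_on V f -> smooth_on V' f.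
Proof. by move=> sV sf s m x /sV; exact: sf. Qed.

(** The functions obtained from smooth ones by field operations and square
    roots: this class is visibly stable under partial derivatives, which is
    what makes the coinductive criterion applicable to all of them at once. *)
Inductive field_generated V : ('rV[R]_5 -> R) -> Prop :=
| fg_smooth f : smooth_on V f -> field_generated V f
| fg_cst a : field_generated V (fun=> a)
| fg_add f g : field_generated V f -> field_generated V g ->
    field_generated V (fun x => f x + g x)
| fg_mul f g : field_generated V f -> field_generated V g ->
    field_generated V (fun x => f x * g x)
| fg_inv f : field_generated V f -> (forall x, V x -> f x != 0) ->
    field_generated V (fun x => (f x)^-1)
| fg_sqrt f : field_generated V f -> (forall x, V x -> 0 < f x) ->
    field_generated V (fun x => Num.sqrt (f x)).

Lemma is_derive_sqrt_comp f x (v : 'rV[R]_5) : 0 < f x -> derivable f x v ->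
  is_derive x v (fun y => Num.sqrt (f y)) ((2 * Num.sqrt (f x))^-1 * 'D_v f x).
Proof.
move=> fx0 df.
have df1 := (derivable1P f x v).1 df.
have e0 : f (0 *: v + x) = f x by rewrite scale0r add0r.
have ds : is_derive (f (0 *: v + x)) (1 : R) Num.sqrt (2 * Num.sqrt (f x))^-1.
  by rewrite e0; apply: is_derive1_sqrt.
have dc : derivable (Num.sqrt \o (fun h : R => f (h *: v + x))) 0 1.
  apply/derivable1_diffP; apply: differentiable_comp.
    exact/derivable1_diffP.
  by apply/derivable1_diffP; case: ds.
have dd : derivable (fun y => Num.sqrt (f y)) x v by apply/derivable1P.
apply: DeriveDef => //.
have lem (h : 'rV[R]_5 -> R) : 'D_v h x = (fun t : R => h (t *: v + x))^`()%classic 0.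
  rewrite derive1E /derive; set F := (X in lim (X @ _)); set G := (X in _ = lim (X @ _)).
  suff -> : F = G by [].
  apply/funext => t; rewrite /F /G /= addr0 scale0r add0r.
  by rewrite /GRing.scale/= mulr1.
rewrite !lem.
have := derive1_comp df1 (@ex_derive _ _ _ _ _ _ _ ds).
by rewrite /comp => ->; rewrite derive1E (@derive_val _ _ _ _ _ _ _ ds).
Qed.

Lemma field_generated_C1 V f : field_generated V f -> C1_on V f.
Proof.
elim=> {f} [f|a|f g _ cf _ cg|f g _ cf _ cg|f _ cf fn0|f _ cf fp].
- exact: smooth_C1.
- by move=> x Vx; split=> [|m]; [exact: cst_continuous|exact: derivable_cst].
- move=> x Vx; have [cfx df] := cf x Vx; have [cgx dg] := cg x Vx.
  by split=> [|m]; [exact: continuousD|exact: derivableD].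
- move=> x Vx; have [cfx df] := cf x Vx; have [cgx dg] := cg x Vx.
  by split=> [|m]; [exact: continuousM|exact: derivableM].
- move=> x Vx; have [cfx df] := cf x Vx.
  by split=> [|m]; [apply: continuousV; [exact: fn0|]|apply: derivableV; [exact: fn0|]].
- move=> x Vx; have [cfx df] := cf x Vx; split=> [|m].
    by apply: continuous_comp; [|exact: sqrt_continuous].
  by have [] := is_derive_sqrt_comp (fp x Vx) (df m).
Qed.

Lemma field_generated_partial V f m : field_generated V f ->
  exists2 g, field_generated V g & forall x, V x -> partial m f x = g x.
Proof.
elim=> {f} [f sf|a|f g gf [f' gf' pf] gg [g' gg' pg]
  |f g gf [f' gf' pf] gg [g' gg' pg]|f gf [f' gf' pf] fn0|f gf [f' gf' pf] fp].
- by exists (partial m f) => //; apply: fg_smooth; exact: smooth_partial.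
- exists (fun=> 0) => [|x _]; first exact: fg_cst.
  exact: derive_cst.
- exists (fun x => f' x + g' x) => [|x Vx]; first exact: fg_add.
  have [_ df] := field_generated_C1 gf Vx.
  have [_ dg] := field_generated_C1 gg Vx.
  by rewrite -pf// -pg//; apply: deriveD.
- exists (fun x => f x * g' x + g x * f' x) => [|x Vx].
    by apply: fg_add; apply: fg_mul.
  have [_ df] := field_generated_C1 gf Vx.
  have [_ dg] := field_generated_C1 gg Vx.
  by rewrite -pf// -pg//; apply: deriveM.
- exists (fun x => (-1) * (((f x)^-1 * (f x)^-1) * f' x)) => [|x Vx].
    by do ![apply: fg_mul|apply: fg_cst|apply: fg_inv|done].
  have [_ df] := field_generated_C1 gf Vx.
  rewrite -pf// [LHS]deriveV//; last exact: fn0.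
  by rewrite -invfM -expr2 mulN1r scaleNr.
- exists (fun x => 2^-1 * ((Num.sqrt (f x))^-1 * f' x)) => [|x Vx].
    apply: fg_mul; first exact: fg_cst.
    apply: fg_mul => //; apply: fg_inv; first exact: fg_sqrt.
    by move=> x Vx; rewrite sqrtr_eq0 -ltNge fp.
  have [_ df] := field_generated_C1 gf Vx.
  have [_] := is_derive_sqrt_comp (fp x Vx) (df m).
  by rewrite -pf// mulrA -invfM.
Qed.

Lemma field_generated_smooth V f : open V -> field_generated V f ->
  smooth_on V f.
Proof.
move=> oV; apply: smooth_coind => // {}f; first exact: field_generated_C1.
by move=> m; exact: field_generated_partial.
Qed.

Lemma smooth_ext V f g : open V -> (forall x, V x -> f x = g x) ->
  smooth_on V f -> smooth_on V g.
Proof.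
move=> oV fg sf.
apply: (@smooth_coind V (fun h => exists2 h', smooth_on V h' &
   forall x, V x -> h' x = h x)) => //; last by exists f.
- by move=> h [h' sh hh]; apply: C1_ext hh _ => //; exact: smooth_C1.
- move=> h m [h' sh hh]; exists (partial m h') => [|x Vx].
    by exists (partial m h'); [exact: smooth_partial|].
  by apply: (partial_ext oV) => // y Vy; rewrite hh.
Qed.

Lemma smooth_cst V a : open V -> smooth_on V (fun=> a).
Proof. by move=> oV; apply: field_generated_smooth => //; exact: fg_cst. Qed.

Lemma smoothD V f g : open V -> smooth_on V f -> smooth_on V g ->
  smooth_on V (fun x => f x + g x).
Proof.
by move=> oV sf sg; apply: field_generated_smooth => //; apply: fg_add;
  apply: fg_smooth.
Qed.

Lemma smoothM V f g : open V -> smooth_on V f -> smooth_on V g ->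
  smooth_on V (fun x => f x * g x).
Proof.
by move=> oV sf sg; apply: field_generated_smooth => //; apply: fg_mul;
  apply: fg_smooth.
Qed.

Lemma smoothV V f : open V -> smooth_on V f -> (forall x, V x -> f x != 0) ->
  smooth_on V (fun x => (f x)^-1).
Proof.
by move=> oV sf sg; apply: field_generated_smooth => //; apply: fg_inv => //;
  apply: fg_smooth.
Qed.

Lemma smooth_sqrt V f : open V -> smooth_on V f -> (forall x, V x -> 0 < f x) ->
  smooth_on V (fun x => Num.sqrt (f x)).
Proof.
by move=> oV sf sg; apply: field_generated_smooth => //; apply: fg_sqrt => //;
  apply: fg_smooth.
Qed.

Lemma smooth_sum V (I : Type) (r : seq I) (F : I -> 'rV[R]_5 -> R) : open V ->
  (forall i, smooth_on V (F i)) -> smooth_on V (fun x => \sum_(i <- r) F i x).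
Proof.
move=> oV sF; elim: r => [|i r IH].
  by apply: (smooth_ext oV _ (smooth_cst 0 oV)) => x _; rewrite big_nil.
apply: (smooth_ext oV _ (smoothD oV (sF i) IH)) => x _.
by rewrite big_cons.
Qed.

Lemma smooth_prod V (I : Type) (r : seq I) (F : I -> 'rV[R]_5 -> R) : open V ->
  (forall i, smooth_on V (F i)) -> smooth_on V (fun x => \prod_(i <- r) F i x).
Proof.
move=> oV sF; elim: r => [|i r IH].
  by apply: (smooth_ext oV _ (smooth_cst 1 oV)) => x _; rewrite big_nil.
apply: (smooth_ext oV _ (smoothM oV (sF i) IH)) => x _.
by rewrite big_cons.
Qed.

Lemma smooth_det V n (F : 'rV[R]_5 -> 'M[R]_n) : open V ->
  (forall i j, smooth_on V (fun x => F x i j)) ->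
  smooth_on V (fun x => \det (F x)).
Proof.
move=> oV sF; apply: smooth_sum => // s; apply: smoothM => //.
  exact: smooth_cst.
by apply: smooth_prod => // i; exact: sF.
Qed.

Lemma smooth_invmx V (F : 'rV[R]_5 -> 'M[R]_5) : open V ->
  (forall i j, smooth_on V (fun x => F x i j)) ->
  (forall x, V x -> F x \in unitmx) ->
  forall i j, smooth_on V (fun x => invmx (F x) i j).
Proof.
move=> oV sF uF i j.
apply: (@smooth_ext V (fun x => (\det (F x))^-1 *
   ((-1) ^+ (j + i) * \det (row' j (col' i (F x)))))) => // [x Vx|].
  by rewrite /invmx (uF x Vx) !mxE.
apply: smoothM => //.
  apply: smoothV => // [|x Vx]; first exact: smooth_det.
  by have := uF x Vx; rewrite unitmxE unitfE.
apply: smoothM => //; first exact: smooth_cst.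
apply: smooth_det => // k l.
by apply: (smooth_ext oV _ (sF (lift j k) (lift i l))) => x _; rewrite !mxE.
Qed.

Lemma smooth_mulmx V n p q (F : 'rV[R]_5 -> 'M[R]_(n, p))
    (G : 'rV[R]_5 -> 'M[R]_(p, q)) : open V ->
  (forall i j, smooth_on V (fun x => F x i j)) ->
  (forall i j, smooth_on V (fun x => G x i j)) ->
  forall i j, smooth_on V (fun x => (F x *m G x) i j).
Proof.
move=> oV sF sG i j.
apply: (@smooth_ext V (fun x => \sum_k F x i k * G x k j)) => // [x Vx|].
  by rewrite !mxE.
by apply: smooth_sum => // k; apply: smoothM.
Qed.

End Smooth.

(** * Mean values and the symmetry of second derivatives *)

Section Calculus.
Variable R : realType.
Implicit Types (V : set 'rV[R]_5) (f g : 'rV[R]_5 -> R).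

Lemma derive_translate f (w y e : 'rV[R]_5) :
  'D_e (fun z => f (w + z)) y = 'D_e f (w + y).
Proof.
rewrite /derive; set F := (X in lim (X @ _)); set G := (X in _ = lim (X @ _)).
suff -> : F = G by [].
apply/funext => t; rewrite /F /G /=; congr (_ *: (f _ - _)).
by rewrite addrCA.
Qed.

Lemma derivable_translate f (w y e : 'rV[R]_5) :
  derivable f (w + y) e -> derivable (fun z => f (w + z)) y e.
Proof.
rewrite /derivable; set F := (X in cvg (X @ _)); set G := (X in _ -> cvg (X @ _)).
suff -> : F = G by [].
apply/funext => t; rewrite /F /G /=; congr (_ *: (f _ - _)).
by rewrite addrCA.
Qed.

Lemma is_derive_line f (z e : 'rV[R]_5) (t : R) : derivable f (t *: e + z) e ->
  is_derive t (1 : R) (fun s : R => f (s *: e + z)) ('D_e f (t *: e + z)).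
Proof.
move=> df; set phi := fun s : R => f (s *: e + z).
have E : (fun h : R => h^-1 *: ((phi \o shift t) (h *: (1 : R)) - phi t)) =
         (fun h : R => h^-1 *: ((f \o shift (t *: e + z)) (h *: e)
                                - f (t *: e + z))).
  apply/funext => h; rewrite /phi /=; congr (_ *: (f _ - _)).
  have -> : h *: (1 : R) = h by exact: mulr1.
  by rewrite scalerDl addrA.
have d1 : derivable phi t 1 by rewrite /derivable E.
by apply: DeriveDef => //; rewrite /derive E.
Qed.

(** Both signs of h are covered, whence the bound on the absolute value of c. *)
Lemma mean_value_line f (z e : 'rV[R]_5) (h : R) :
  (forall t : R, `|t| <= `|h| -> derivable f (t *: e + z) e) ->
  exists2 c : R, `|c| <= `|h| & f (h *: e + z) - f z = 'D_e f (c *: e + z) * h.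
Proof.
move=> df; set phi := fun s : R => f (s *: e + z).
have dphi t : `|t| <= `|h| -> is_derive t (1 : R) phi ('D_e f (t *: e + z)).
  by move=> th; apply: is_derive_line; apply: df.
have phi0 : phi 0 = f z by rewrite /phi scale0r add0r.
have cphi a b : (forall t, t \in `[a, b] -> `|t| <= `|h|) ->
    {within `[a, b], continuous phi}.
  move=> ab; apply: derivable_within_continuous => t /ab th.
  exact: (@ex_derive _ _ _ _ _ _ _ (dphi _ th)).
have [h0|h0] := leP 0 h.
  have ab (t : R) : t \in `[0, h] -> `|t| <= `|h|.
    by rewrite in_itv/= => /andP[t0 th]; rewrite !ger0_norm.
  have dd (t : R) : t \in `]0, h[ -> is_derive t (1 : R) phi ('D_e f (t *: e + z)).
    by move=> th; apply: dphi; apply: ab; apply: subset_itv_oo_cc th.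
  have [c ch] := MVT_segment h0 dd (cphi 0 h ab).
  by rewrite phi0 subr0 => E; exists c => //; exact: ab.
have ab (t : R) : t \in `[h, 0] -> `|t| <= `|h|.
  by rewrite in_itv/= => /andP[t0 th]; rewrite !ler0_norm ?lerN2// ltW.
have dd (t : R) : t \in `]h, 0[ -> is_derive t (1 : R) phi ('D_e f (t *: e + z)).
  by move=> th; apply: dphi; apply: ab; apply: subset_itv_oo_cc th.
have [c ch] := MVT_segment (ltW h0) dd (cphi h 0 ab).
rewrite phi0 sub0r => E; exists c; first exact: ab.
by rewrite -opprB E mulrN opprK.
Qed.

Lemma mx_ballP (x y : 'rV[R]_5) (r : R) :
  ball x r y <-> forall k, `|x 0 k - y 0 k| < r.
Proof.
split=> [[_ b] k|b]; first exact: b.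
split=> [|i k]; first exact: le_lt_trans (normr_ge0 _) (b o1).
by rewrite ord1; exact: b.
Qed.

Lemma open_ball_sub V x : open V -> V x ->
  exists2 r : R, 0 < r & ball x r `<=` V.
Proof.
move=> oV Vx; have /nbhs_ballP[r /= r0 rV] : nbhs x V by exact: open_nbhs_nbhs.
by exists r.
Qed.

(** For the sup norm a ball is a cube: moving from x to y one coordinate at a
    time stays in it, and each move is along a coordinate axis. *)
Lemma constant_on_ball V f x (r : R) : ball x r `<=` V ->
  C1_on V f -> (forall m y, V y -> partial m f y = 0) ->
  forall y, ball x r y -> f y = f x.
Proof.
move=> rV c1 f0 y xy.
pose z (k : nat) : 'rV[R]_5 := \row_j (if (j < k)%N then y 0 j else x 0 j).
have zk (k : nat) : (k <= 5)%N -> f (z k) = f x.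
  elim: k => [|k IH] k5; first by congr f; apply/rowP => j; rewrite mxE.
  rewrite -IH; last exact: ltnW.
  pose m : 'I_5 := Ordinal k5.
(* z k has the first k coordinates of y and the other ones of x. *)
  have zE : z k.+1 = (y 0 m - x 0 m) *: delta_mx 0 m + z k.
    apply/rowP => j; rewrite !mxE eqxx /= ltnS leq_eqVlt.
    case: (altP (j =P m)) => [->|jm] /=; first by rewrite eqxx ltnn mulr1 subrK.
    rewrite mulr0 add0r; case: eqP => //= jk.
    by case/eqP: jm; apply: val_inj.
  have zV (t : R) : `|t| <= `|y 0 m - x 0 m| -> V (t *: delta_mx 0 m + z k).
    move=> tm; apply: rV; apply/mx_ballP => j; rewrite !mxE eqxx /=.
    case: (altP (j =P m)) => [->|jm] /=.
      rewrite ltnn mulr1 opprD addrCA subrr addr0 normrN.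
      by apply: le_lt_trans tm _; rewrite distrC; move/mx_ballP: xy; apply.
    rewrite mulr0 add0r; case: ifP => _; first by move/mx_ballP: xy; apply.
    rewrite subrr normr0; apply: le_lt_trans (normr_ge0 (x 0 j - y 0 j)) _.
    by move/mx_ballP: xy; apply.
  have [|c cm] := @mean_value_line f (z k) (delta_mx 0 m) (y 0 m - x 0 m).
    by move=> t tm; have [_] := c1 _ (zV t tm).
  rewrite -zE -[X in X * _]/(partial m f _) f0; last exact: zV.
  by rewrite mul0r => /eqP; rewrite subr_eq0 => /eqP.
have <- := zk 5 (leqnn _); congr f.
by apply/rowP => j; rewrite mxE ltn_ord.
Qed.

(** The mean value theorem in direction m, then in direction n; the left-hand
    side is symmetric in m and n. *)
Lemma second_difference V f (x : 'rV[R]_5) (m n : 'I_5) (r h : R) :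
  open V -> ball x r `<=` V -> smooth_on V f -> m != n ->
  0 < h -> h < r ->
  exists2 y : 'rV[R]_5, (forall k, `|x 0 k - y 0 k| <= h) &
    f (h *: delta_mx 0 m + (h *: delta_mx 0 n + x)) - f (h *: delta_mx 0 m + x)
     - (f (h *: delta_mx 0 n + x) - f x) = partial n (partial m f) y * h * h.
Proof.
move=> oV rV sf mn h0 hr.
set em : 'rV[R]_5 := delta_mx 0 m; set en : 'rV[R]_5 := delta_mx 0 n.
have near_x (s t : R) : `|s| <= h -> `|t| <= h ->
    forall k, `|x 0 k - (s *: em + (t *: en + x)) 0 k| <= h.
  move=> sh th k; rewrite !mxE !eqxx /=.
  case: (altP (k =P m)) => [->|km] /=.
    by rewrite (negbTE mn) mulr1 mulr0 add0r opprD addrCA subrr addr0 normrN.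
  rewrite mulr0 add0r; case: (altP (k =P n)) => [->|kn] /=.
    by rewrite mulr1 opprD addrCA subrr addr0 normrN.
  by rewrite mulr0 add0r subrr normr0 ltW.
have inV (s t : R) : `|s| <= h -> `|t| <= h -> V (s *: em + (t *: en + x)).
  move=> sh th; apply: rV; apply/mx_ballP => k.
  exact: le_lt_trans (near_x s t sh th k) hr.
have nh : `|h| = h by rewrite gtr0_norm.
have c1 := smooth_C1 sf.
have c1m := smooth_C1 (smooth_partial m sf).
have h00 : `|0 : R| <= h by rewrite normr0 ltW.
pose F := fun y => f (h *: en + y) - f y.
have dF (t : R) : `|t| <= `|h| ->
    derivable (fun y => f (h *: en + y)) (t *: em + x) em
    /\ derivable f (t *: em + x) em.
  rewrite nh => th; split.
    apply: derivable_translate; rewrite addrCA.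
    have hh : `|h| <= h by rewrite nh.
    by have [_ d] := c1 _ (inV t h th hh); exact: d.
  have [_ d] := c1 _ (inV t 0 th h00).
  by move: (d m); rewrite scale0r add0r.
have [|c ch] := @mean_value_line F x em h.
  by move=> t th; apply: derivableB; case: (dF t th).
rewrite /F => E.
have ch' : `|c| <= h by rewrite -nh.
have [|d dh] := @mean_value_line (partial m f) (c *: em + x) en h.
  rewrite nh => t th; rewrite addrCA.
  by have [_ d] := c1m _ (inV c t ch' th); exact: d.
move=> E2.
exists (c *: em + (d *: en + x)); first by apply: near_x => //; rewrite -nh.
rewrite [h *: em + (h *: en + x)]addrCA E deriveB; [|by case: (dF c ch)..].
rewrite derive_translate [c *: em + (d *: en + x)]addrCA.
by rewrite -[X in _ = X * h]E2.
Qed.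

Lemma partial_comm V f (m n : 'I_5) (x : 'rV[R]_5) : open V ->
  smooth_on V f -> V x ->
  partial m (partial n f) x = partial n (partial m f) x.
Proof.
move=> oV sf Vx; have [->//|mn] := eqVneq m n.
have [r r0 rV] := open_ball_sub oV Vx.
have [c1 _] := smooth_C1 (smooth_partial m (smooth_partial n sf)) Vx.
have [c2 _] := smooth_C1 (smooth_partial n (smooth_partial m sf)) Vx.
apply/eqP; rewrite -subr_eq0 -normr_le0; apply/ler_addgt0Pl => e e0.
rewrite addr0.
have e20 : 0 < e / 2 by rewrite divr_gt0.
have /nbhs_ballP[r1 /= r10 B1] := c1 _ (nbhsx_ballx _ _ e20).
have /nbhs_ballP[r2 /= r20 B2] := c2 _ (nbhsx_ballx _ _ e20).
pose h := Num.min r (Num.min r1 r2) / 2.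
have m0 : 0 < Num.min r (Num.min r1 r2) by rewrite !lt_min r0 r10.
have h0 : 0 < h by rewrite divr_gt0.
have hm : h < Num.min r (Num.min r1 r2).
  by rewrite ltr_pdivrMr// mulr2n mulrDr mulr1 ltrDl.
have /andP[hr /andP[h1 h2]] : (h < r) && ((h < r1) && (h < r2)).
  by move: hm; rewrite !lt_min.
have nm : n != m by rewrite eq_sym.
have [y yx Ey] := second_difference oV rV sf mn h0 hr.
have [z zx Ez] := second_difference oV rV sf nm h0 hr.
have swap (a b c d : R) : a - b - (c - d) = a - c - (b - d) by ring.
have E : partial n (partial m f) y = partial m (partial n f) z.
  apply: (mulIf (lt0r_neq0 h0)); apply: (mulIf (lt0r_neq0 h0)).
  apply: etrans (esym Ey) (etrans _ Ez).
  by rewrite [X in f X - _ - _ = _]addrCA; exact: swap.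
have By : ball x r2 y.
  by apply/mx_ballP => k; exact: le_lt_trans (yx k) h2.
have Bz : ball x r1 z.
  by apply/mx_ballP => k; exact: le_lt_trans (zx k) h1.
have := B1 _ Bz; rewrite /= /ball_ -E => Cz.
have := B2 _ By; rewrite /= /ball_ => Cy.
move: (partial m (partial n f) x) (partial n (partial m f) x)
  (partial n (partial m f) y) Cz Cy => a b w Cz Cy.
have -> : a - b = (a - w) - (b - w) by ring.
apply: le_trans (ler_normB _ _) _.
rewrite [leRHS]splitr; exact: lerD (ltW Cz) (ltW Cy).
Qed.

End Calculus.

(** * The cubic form and the irreducible so(3) in coordinates *)

Lemma ord5_ind (P : 'I_5 -> Prop) :
  P o1 -> P o2 -> P o3 -> P o4 -> P o5 -> forall i, P i.
Proof.
move=> p1 p2 p3 p4 p5 [[|[|[|[|[|//]]]]] p].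
- by rewrite (_ : Ordinal p = o1)//; apply: val_inj.
- by rewrite (_ : Ordinal p = o2)//; apply: val_inj.
- by rewrite (_ : Ordinal p = o3)//; apply: val_inj.
- by rewrite (_ : Ordinal p = o4)//; apply: val_inj.
- by rewrite (_ : Ordinal p = o5)//; apply: val_inj.
Qed.

Lemma sum5 (V : nmodType) (F : 'I_5 -> V) :
  \sum_i F i = F o1 + F o2 + F o3 + F o4 + F o5.
Proof.
rewrite !big_ord_recr big_ord0 /= add0r.
by do ![congr (_ + _)]; congr F; apply: val_inj.
Qed.

Definition q1 : 'I_3 := @Ordinal 3 0 isT.
Definition q2 : 'I_3 := @Ordinal 3 1 isT.
Definition q3 : 'I_3 := @Ordinal 3 2 isT.

Lemma ord3_ind (P : 'I_3 -> Prop) : P q1 -> P q2 -> P q3 -> forall i, P i.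
Proof.
move=> p1 p2 p3 [[|[|[|//]]] p].
- by rewrite (_ : Ordinal p = q1)//; apply: val_inj.
- by rewrite (_ : Ordinal p = q2)//; apply: val_inj.
- by rewrite (_ : Ordinal p = q3)//; apply: val_inj.
Qed.

Lemma sum3 (V : nmodType) (F : 'I_3 -> V) : \sum_i F i = F q1 + F q2 + F q3.
Proof.
rewrite !big_ord_recr big_ord0 /= add0r.
by do ![congr (_ + _)]; congr F; apply: val_inj.
Qed.

Definition sq3 {R : realType} : R := Num.sqrt 3.

Section Trilinear.
Variable R : realType.
Implicit Types (Y : 'I_5 -> 'I_5 -> 'I_5 -> R) (u v w : 'rV[R]_5).

Definition trilinear Y u v w : R :=
  \sum_i \sum_j \sum_k Y i j k * u 0 i * v 0 j * w 0 k.

Definition symmetric3 Y :=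
  forall i j k, Y i j k = Y j i k /\ Y i j k = Y i k j.

Lemma trilinearDl Y u u' v w :
  trilinear Y (u + u') v w = trilinear Y u v w + trilinear Y u' v w.
Proof.
rewrite -big_split; apply: eq_bigr => i _; rewrite -big_split.
apply: eq_bigr => j _; rewrite -big_split; apply: eq_bigr => k _ /=.
by rewrite mxE mulrDr !mulrDl.
Qed.

Lemma trilinear_swap12 Y u v w : symmetric3 Y ->
  trilinear Y u v w = trilinear Y v u w.
Proof.
move=> sY; rewrite /trilinear exchange_big; apply: eq_bigr => i _.
apply: eq_bigr => j _; apply: eq_bigr => k _.
by have [-> _] := sY j i k; rewrite [in LHS](mulrAC _ (u 0 j)).
Qed.

Lemma trilinear_swap23 Y u v w : symmetric3 Y ->
  trilinear Y u v w = trilinear Y u w v.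
Proof.
move=> sY; apply: eq_bigr => i _; rewrite exchange_big; apply: eq_bigr => j _.
apply: eq_bigr => k _.
by have [_ ->] := sY i k j; rewrite mulrAC.
Qed.

(** A symmetric form is determined by its cubic form, which is how the
    hypotheses on cubic forms are turned into hypotheses on tensors. *)
Lemma trilinear_polar Y u v w : symmetric3 Y ->
  trilinear Y u v w = 6^-1 *
   (cubic_form Y (u + v + w) - cubic_form Y (u + v) - cubic_form Y (v + w)
    - cubic_form Y (u + w) + cubic_form Y u + cubic_form Y v + cubic_form Y w).
Proof.
move=> sY; have cE z : cubic_form Y z = trilinear Y z z z by [].
have D2 a b b' c : trilinear Y a (b + b') c = trilinear Y a b c + trilinear Y a b' c.
  by rewrite !(trilinear_swap12 a _ _ sY) trilinearDl.
have D3 a b c c' : trilinear Y a b (c + c') = trilinear Y a b c + trilinear Y a b c'.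
  by rewrite !(trilinear_swap23 a b _ sY) D2.
rewrite !cE !(trilinearDl, D2, D3).
rewrite !(trilinear_swap12 v u _ sY) !(trilinear_swap12 w u _ sY)
  !(trilinear_swap12 w v _ sY).
rewrite !(trilinear_swap23 _ w u sY) !(trilinear_swap23 _ w v sY)
  !(trilinear_swap23 _ v u sY) !(trilinear_swap12 v u _ sY)
  !(trilinear_swap12 w u _ sY) !(trilinear_swap12 w v _ sY).
move: (trilinear Y u v w) (trilinear Y u u u) (trilinear Y v v v)
  (trilinear Y w w w) (trilinear Y u u v) (trilinear Y u u w)
  (trilinear Y u v v) (trilinear Y u w w) (trilinear Y v v w)
  (trilinear Y v w w) => *.
by field.
Qed.

Lemma trilinear_delta Y i j k :
  trilinear Y (delta_mx 0 i) (delta_mx 0 j) (delta_mx 0 k) = Y i j k.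
Proof.
rewrite /trilinear (bigD1 i)//= [X in _ + X]big1 ?addr0 => [|i' ii]; last first.
  rewrite big1 // => j' _; rewrite big1 // => k' _.
  by rewrite mxE (negbTE ii) andbF mulr0 !mul0r.
rewrite (bigD1 j)//= [X in _ + X]big1 ?addr0 => [|j' jj]; last first.
  by rewrite big1 // => k' _; rewrite [_ 0 j']mxE (negbTE jj) andbF mulr0 mul0r.
rewrite (bigD1 k)//= [X in _ + X]big1 ?addr0 => [|k' kk]; last first.
  by rewrite [_ 0 k']mxE (negbTE kk) andbF mulr0.
by rewrite !mxE !eqxx !mulr1.
Qed.

End Trilinear.

(** The tables of coefficients are indexed by natural numbers, so that entries
    at given indices are obtained by computation. *)
Definition ups_coef {R : realType} (i j k : nat) : R :=
  match i, j, k with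
  | 0,0,0 => - 1
  | 0,1,1 | 1,0,1 | 1,1,0 => 1
  | 0,3,3 | 3,0,3 | 3,3,0 => 1
  | 0,2,2 | 2,0,2 | 2,2,0 => - 2^-1
  | 0,4,4 | 4,0,4 | 4,4,0 => - 2^-1
  | 3,4,4 | 4,3,4 | 4,4,3 => sq3 / 2
  | 2,2,3 | 2,3,2 | 3,2,2 => - (sq3 / 2)
  | 1,2,4 | 1,4,2 | 2,1,4 | 2,4,1 | 4,1,2 | 4,2,1 => sq3 / 2
  | _, _, _ => 0
  end.

(** The 3-form whose Hodge dual is u0 E_1 + u1 E_2 + u2 E_3. *)
Definition tau {R : realType} (u0 u1 u2 : R) (i j k : nat) : R :=
  match i, j, k with
  | 0,1,2 | 1,2,0 | 2,0,1 => u0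
  | 0,2,1 | 1,0,2 | 2,1,0 => - u0
  | 0,1,3 | 1,3,0 | 3,0,1 => - u2
  | 0,3,1 | 1,0,3 | 3,1,0 => u2
  | 0,1,4 | 1,4,0 | 4,0,1 => u1
  | 0,4,1 | 1,0,4 | 4,1,0 => - u1
  | 0,2,3 | 2,3,0 | 3,0,2 => u1
  | 0,3,2 | 2,0,3 | 3,2,0 => - u1
  | 0,2,4 | 2,4,0 | 4,0,2 => - (2 * u2)
  | 0,4,2 | 2,0,4 | 4,2,0 => 2 * u2
  | 0,3,4 | 3,4,0 | 4,0,3 => u0
  | 0,4,3 | 3,0,4 | 4,3,0 => - u0
  | 1,2,3 | 2,3,1 | 3,1,2 => - (sq3 * u0)
  | 1,3,2 | 2,1,3 | 3,2,1 => sq3 * u0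
  | 1,3,4 | 3,4,1 | 4,1,3 => - (sq3 * u1)
  | 1,4,3 | 3,1,4 | 4,3,1 => sq3 * u1
  | _, _, _ => 0
  end.

Definition E_coef {R : realType} (s i j : nat) : R :=
  match s, i, j with
  | 0, 0, 4 => sq3 | 0, 4, 0 => - sq3
  | 0, 1, 2 | 0, 3, 4 => 1 | 0, 2, 1 | 0, 4, 3 => - 1
  | 1, 0, 2 => sq3 | 1, 2, 0 => - sq3
  | 1, 1, 4 | 1, 2, 3 => 1 | 1, 4, 1 | 1, 3, 2 => - 1
  | 2, 1, 3 => 2 | 2, 3, 1 => - 2
  | 2, 2, 4 => 1 | 2, 4, 2 => - 1
  | _, _, _ => 0
  end.

Section Tables.
Variable R : realType.

Lemma sqrt3_sq : sq3 ^+ 2 = 3 :> R.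
Proof. by rewrite sqr_sqrtr. Qed.

Lemma sqrt3_gt0 : 0 < sq3 :> R.
Proof. by rewrite sqrtr_gt0. Qed.

Lemma ups_coef_sym : symmetric3 (fun i j k : 'I_5 => ups_coef i j k : R).
Proof.
by elim/ord5_ind; elim/ord5_ind; elim/ord5_ind; split.
Qed.

Lemma ups0_formE (v : 'rV[R]_5) :
  ups0_form v = cubic_form (fun i j k => ups_coef i j k) v.
Proof.
rewrite /ups0_form /cubic_form.
rewrite -[Num.sqrt 3]/(@sq3 R).
rewrite !sum5 /=.
move: (v 0 o1) (v 0 o2) (v 0 o3) (v 0 o4) (v 0 o5) => a b c d e.
by field.
Qed.

Lemma ups0E (i j k : 'I_5) : ups0 i j k = ups_coef i j k :> R.
Proof.
rewrite -(trilinear_delta (fun i j k => ups_coef i j k)).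
by rewrite (trilinear_polar _ _ _ ups_coef_sym) /ups0 !ups0_formE.
Qed.

Lemma EmxE (s : 'I_3) (i j : 'I_5) : Emx s i j = E_coef s i j :> R.
Proof.
rewrite /Emx /eskew -[Num.sqrt 3]/(@sq3 R).
elim/ord3_ind: s; elim/ord5_ind: i; elim/ord5_ind: j; rewrite !mxE /=; ring.
Qed.

Lemma E_combE (u : 'I_3 -> R) (i j : 'I_5) :
  (\sum_s u s *: Emx s : 'M[R]_5) i j =
  u q1 * E_coef 0 i j + u q2 * E_coef 1 i j + u q3 * E_coef 2 i j.
Proof.
have E s : (u s *: Emx s : 'M[R]_5) i j = u s * E_coef s i j by rewrite mxE EmxE.
by rewrite summxE sum3 !E.
Qed.

(** Evaluated on basis vectors, invariance gives linear equations on the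
    entries of A, which leave three free parameters. *)
Lemma so3_stabiliser (A : 'M[R]_5) : A^T = - A ->
  (forall i j k, \sum_l (A l i * ups0 l j k + A l j * ups0 i l k
                         + A l k * ups0 i j l) = 0) ->
  exists u : 'I_3 -> R, A = \sum_s u s *: Emx s.
Proof.
move=> skA stA.
have sk i j : A i j = - A j i by move/matrixP: skA => /(_ j i); rewrite !mxE.
have diag i : A i i = 0 by have := sk i i => ?; lra.
have st (i j k : 'I_5) : A o1 i * ups_coef 0 j k + A o1 j * ups_coef i 0 k
   + A o1 k * ups_coef i j 0 +
   (A o2 i * ups_coef 1 j k + A o2 j * ups_coef i 1 k
   + A o2 k * ups_coef i j 1) +
   (A o3 i * ups_coef 2 j k + A o3 j * ups_coef i 2 k
   + A o3 k * ups_coef i j 2) +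
   (A o4 i * ups_coef 3 j k + A o4 j * ups_coef i 3 k
   + A o4 k * ups_coef i j 3) +
   (A o5 i * ups_coef 4 j k + A o5 j * ups_coef i 4 k
   + A o5 k * ups_coef i j 4) = 0 :> R.
  by have := stA i j k; rewrite sum5 !ups0E.
have s2 := sqrt3_sq; have s0 := sqrt3_gt0.
have s_neq0 := lt0r_neq0 s0.
pose u (s : 'I_3) := nth 0 [:: A o4 o5; A o3 o4; A o3 o5] s.
have e12 : A o1 o2 = 0.
  by have := st o1 o1 o2; rewrite /= (sk o2 o1) => ?; lra.
have e14 : A o1 o4 = 0.
  by have := st o1 o1 o4; rewrite /= (sk o4 o1) => ?; lra.
have div_s (x y : R) : sq3 * x = 3 * y -> x = sq3 * y.
  move=> h; apply: (mulfI s_neq0); rewrite h mulrA -expr2 s2; ring.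
have e15 : A o1 o5 = sq3 * A o4 o5.
  apply: div_s; have := st o1 o4 o5; rewrite /= (sk o5 o1) (sk o5 o4) => ?; lra.
have e15' : A o1 o5 = sq3 * A o2 o3.
  apply: div_s; have := st o1 o2 o3; rewrite /= (sk o5 o1) (sk o3 o2) => ?; lra.
have e13 : A o1 o3 = sq3 * A o3 o4.
  apply: div_s; have := st o1 o4 o3; rewrite /= (sk o3 o1) (sk o4 o3) => ?; lra.
have e13' : A o1 o3 = sq3 * A o2 o5.
  apply: div_s; have := st o1 o2 o5; rewrite /= (sk o3 o1) (sk o5 o2) => ?; lra.
have e23 : A o2 o3 = A o4 o5 by apply: (mulfI s_neq0); rewrite -e15 -e15'.
have e25 : A o2 o5 = A o3 o4 by apply: (mulfI s_neq0); rewrite -e13 -e13'.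
have e24 : A o2 o4 = 2 * A o3 o5.
  apply: (mulfI s_neq0).
  have := st o3 o3 o2; rewrite /= (sk o5 o3) (sk o4 o2) e12 => ?; lra.
exists u; apply/matrixP => i j.
rewrite E_combE /u.
elim/ord5_ind: i; elim/ord5_ind: j; rewrite /= ?diag;
  rewrite ?(sk o2 o1) ?(sk o3 o1) ?(sk o4 o1) ?(sk o5 o1) ?(sk o3 o2)
    ?(sk o4 o2) ?(sk o5 o2) ?(sk o4 o3) ?(sk o5 o3) ?(sk o5 o4)
    ?e12 ?e13 ?e14 ?e15 ?e23 ?e24 ?e25; ring.
Qed.

End Tables.

(** * Brackets with torsion along E_3: the Jacobi identity *)

Definition jacobi {R : realType} (c : 'I_5 -> 'I_5 -> 'I_5 -> R) : Prop :=
  forall i j k v,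
    \sum_u (c i j u * c u k v + c j k u * c u i v + c k i u * c u j v) = 0.

(** The component along e_i of [e_j, e_k], for a frame whose torsion is tau in
    a connection with coefficients a, b, g along E_1, E_2, E_3. *)
Definition frame_bracket {R : realType} (a b g : 'I_5 -> R) (u0 u1 u2 : R)
    (j k i : 'I_5) : R :=
  tau u0 u1 u2 i j k
  - (a j * E_coef 0 i k + b j * E_coef 1 i k + g j * E_coef 2 i k)
  + (a k * E_coef 0 i j + b k * E_coef 1 i j + g k * E_coef 2 i j).

(** The brackets dual to the differential system, with x = rho cos phi,
    y = rho sin phi and w = rho epsilon. *)
Definition std_bracket {R : realType} (x y w del : R) (j k i : 'I_5) : R :=
  let skew (p q : nat) : R :=
    if (val j == p) && (val k == q) then 1
    else if (val j == q) && (val k == p) then -1 else 0 in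
  match val i with
  | 0 => - (2 / 3 * sq3 * w) * (skew 1%N 3%N + (2 - 3 * del) * skew 2%N 4%N)
  | 1 => - (2 * x) * skew 1%N 3%N
  | 2 => - x * skew 1%N 4%N + sq3 * w * (1 - del) * skew 0%N 4%N
         + w * del * skew 1%N 2%N + (del * w - y) * skew 3%N 4%N
  | 3 => - (2 * y) * skew 1%N 3%N
  | _ => x * skew 1%N 2%N + sq3 * w * (del - 1) * skew 0%N 2%N
         - w * del * skew 1%N 4%N - (del * w + y) * skew 2%N 3%N
  end.

Section Classification.
Variables (R : realType) (a b g : 'I_5 -> R) (u : R).
Hypothesis u_neq0 : u != 0.

Let C := frame_bracket a b g 0 0 u.
Hypothesis C_jacobi : jacobi C.

Let J (i j k v : 'I_5) : R :=
  \sum_l (C i j l * C l k v + C j k l * C l i v + C k i l * C l j v).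

Let J0 i j k v : J i j k v = 0. Proof. exact: C_jacobi. Qed.

Ltac jac_ring := rewrite /J !sum5 /C /frame_bracket /=; field: (@sqrt3_sq R).

(** The Jacobi identity contains linear equations on the connection, because
    products of two unknowns cancel in suitable combinations of its components.
    The combinations below were found by linear elimination over Q(sqrt 3). *)
Lemma jacobi_a1 : a o1 = 0.
Proof.
apply: (mulIf u_neq0); rewrite mul0r.
transitivity ((- (1 / 2)) * J o2 o3 o5 o3
  + (1 / 2 * sq3) * J o1 o3 o5 o5
  + (1 / 4) * J o2 o3 o4 o2
  + (- (1 / 2) * sq3) * J o1 o3 o4 o4
  + (1 / 4 * sq3) * J o1 o4 o5 o2
  + (1 / 4 * sq3) * J o2 o4 o5 o1
  + (- (1 / 4)) * J o1 o3 o4 o1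
  + 1 * J o3 o4 o5 o5
  + (- (1 / 2)) * J o2 o4 o5 o4);
  [by jac_ring|by rewrite !J0 !mulr0 !addr0].
Qed.

Lemma jacobi_a2 : a o2 = 0.
Proof.
apply: (mulIf u_neq0); rewrite mul0r.
transitivity ((5 / 12 * sq3) * J o2 o4 o5 o2
  + (1 / 4) * J o1 o3 o4 o2
  + (5 / 6 * sq3) * J o2 o3 o5 o5
  + (- (1 / 2)) * J o1 o3 o5 o3
  + (- (1 / 3) * sq3) * J o3 o4 o5 o3
  + (- (1 / 6) * sq3) * J o2 o3 o4 o4
  + (1 / 4) * J o2 o3 o4 o1
  + (1 / 4 * sq3) * J o1 o4 o5 o1
  + (- (1 / 2)) * J o1 o4 o5 o4);
  [by jac_ring|by rewrite !J0 !mulr0 !addr0].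
Qed.

Lemma jacobi_b5_a3 : b o5 = - a o3.
Proof.
apply/eqP; rewrite -addr_eq0; apply/eqP; apply: (mulIf u_neq0); rewrite mul0r mulrDl.
transitivity ((- (1 / 2)) * J o2 o3 o5 o1
  + (- (1 / 2)) * J o1 o3 o5 o2
  + (1 / 2 * sq3) * J o2 o4 o5 o3
  + (- (1 / 2)) * J o1 o4 o5 o5
  + (- (1 / 2) * sq3) * J o2 o3 o4 o5
  + (1 / 2) * J o1 o3 o4 o3);
  [by jac_ring|by rewrite !J0 !mulr0 !addr0].
Qed.

Lemma jacobi_a4 : a o4 = 0.
Proof.
apply: (mulIf u_neq0); rewrite mul0r.
transitivity ((- (1 / 2)) * J o1 o3 o4 o4
  + (- (1 / 4) * sq3) * J o1 o3 o4 o1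
  + (1 / 6 * sq3) * J o2 o3 o5 o3
  + (- (1 / 2)) * J o1 o3 o5 o5
  + (- (1 / 12) * sq3) * J o2 o3 o4 o2
  + (- (1 / 4)) * J o1 o4 o5 o2
  + (- (1 / 4)) * J o2 o4 o5 o1
  + (- (1 / 3) * sq3) * J o3 o4 o5 o5
  + (1 / 6 * sq3) * J o2 o4 o5 o4);
  [by jac_ring|by rewrite !J0 !mulr0 !addr0].
Qed.

Lemma jacobi_a5 : a o5 = 0.
Proof.
apply: (mulIf u_neq0); rewrite mul0r.
transitivity ((- (1 / 4)) * J o1 o3 o5 o4
  + (1 / 12 * sq3) * J o1 o3 o5 o1
  + (1 / 2) * J o1 o2 o5 o5
  + (1 / 2 * sq3) * J o2 o4 o5 o5
  + (1 / 4) * J o3 o4 o5 o1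
  + (- (1 / 4) * sq3) * J o3 o4 o5 o4);
  [by jac_ring|by rewrite !J0 !mulr0 !addr0].
Qed.

Lemma jacobi_b1 : b o1 = 0.
Proof.
apply: (mulIf u_neq0); rewrite mul0r.
transitivity ((1 / 4) * J o1 o4 o5 o1
  + (- (1 / 4) * sq3) * J o2 o3 o4 o1
  + (- (1 / 4)) * J o2 o4 o5 o2
  + (- (1 / 4) * sq3) * J o1 o3 o4 o2
  + (- (1 / 2)) * J o2 o3 o5 o5
  + (1 / 2 * sq3) * J o1 o3 o5 o3
  + (- 1) * J o3 o4 o5 o3
  + (- (1 / 2)) * J o2 o3 o4 o4
  + (- (1 / 2) * sq3) * J o1 o4 o5 o4);
  [by jac_ring|by rewrite !J0 !mulr0 !addr0].
Qed.

Lemma jacobi_b2 : b o2 = 0.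
Proof.
apply: (mulIf u_neq0); rewrite mul0r.
transitivity ((5 / 6 * sq3) * J o2 o3 o5 o3
  + (- (1 / 2)) * J o1 o3 o5 o5
  + (- (5 / 12) * sq3) * J o2 o3 o4 o2
  + (- (1 / 2)) * J o1 o3 o4 o4
  + (- (1 / 4)) * J o2 o4 o5 o1
  + (- (1 / 4) * sq3) * J o1 o3 o4 o1
  + (- (1 / 4)) * J o1 o4 o5 o2
  + (1 / 3 * sq3) * J o3 o4 o5 o5
  + (- (1 / 6) * sq3) * J o2 o4 o5 o4);
  [by jac_ring|by rewrite !J0 !mulr0 !addr0].
Qed.

Lemma jacobi_b3 : b o3 = 0.
Proof.
apply: (mulIf u_neq0); rewrite mul0r.
transitivity ((1 / 3 * sq3) * J o2 o3 o5 o2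
  + (- (1 / 2)) * J o1 o2 o5 o5
  + (- (1 / 3) * sq3) * J o2 o3 o4 o3
  + (1 / 4) * J o1 o3 o5 o4
  + (- (1 / 4)) * J o3 o4 o5 o1
  + (- (1 / 12) * sq3) * J o1 o3 o5 o1
  + (- (1 / 6) * sq3) * J o2 o4 o5 o5
  + (- (1 / 12) * sq3) * J o3 o4 o5 o4);
  [by jac_ring|by rewrite !J0 !mulr0 !addr0].
Qed.

Lemma jacobi_b4 : b o4 = 0.
Proof.
apply: (mulIf u_neq0); rewrite mul0r.
transitivity ((- (1 / 4)) * J o2 o3 o4 o1
  + (- (1 / 4)) * J o1 o3 o4 o2
  + (- (1 / 4) * sq3) * J o1 o4 o5 o1
  + (- (1 / 12) * sq3) * J o2 o4 o5 o2
  + (- (1 / 6) * sq3) * J o2 o3 o5 o5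
  + (1 / 2) * J o1 o3 o5 o3
  + (1 / 2) * J o1 o4 o5 o4
  + (- (1 / 3) * sq3) * J o3 o4 o5 o3
  + (- (1 / 6) * sq3) * J o2 o3 o4 o4);
  [by jac_ring|by rewrite !J0 !mulr0 !addr0].
Qed.

Let zeros := (jacobi_a1, jacobi_a2, jacobi_a4, jacobi_a5,
  jacobi_b1, jacobi_b2, jacobi_b3, jacobi_b4, jacobi_b5_a3).

Ltac jac_ring' := rewrite /J !sum5 /C /frame_bracket /= !zeros; field: (@sqrt3_sq R).

(** With these vanishings, what remains is quadratic in a_3 and g. *)
Lemma jacobi_quad0 : (- (1 / 2)) * g o2 * u + g o1 * g o2 = 0.
Proof.
transitivity ((1 / 2) * J o1 o4 o5 o3);
  [by jac_ring'|by rewrite !J0 !mulr0 ?addr0].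
Qed.

Lemma jacobi_quad1 : (- 2) * g o3 * u + (- sq3) * g o3 * a o3 + g o1 * g o3 = 0.
Proof.
transitivity ((- (1 / 2)) * J o1 o4 o5 o2);
  [by jac_ring'|by rewrite !J0 !mulr0 ?addr0].
Qed.

Lemma jacobi_quad2 : (- (1 / 2)) * g o4 * u + g o1 * g o4 = 0.
Proof.
transitivity ((- (1 / 2)) * J o1 o2 o5 o3
  + (1 / 2) * J o1 o4 o5 o5);
  [by jac_ring'|by rewrite !J0 !mulr0 ?addr0].
Qed.

Lemma jacobi_quad3 : (- 2) * g o5 * u + (- sq3) * g o5 * a o3 + g o1 * g o5 = 0.
Proof.
transitivity ((- 1) * J o1 o3 o5 o3);
  [by jac_ring'|by rewrite !J0 !mulr0 ?addr0].
Qed.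

Lemma jacobi_quad4 : (- (1 / 6) * sq3) * u * u + (1 / 3 * sq3) * g o1 * u
  + (- (1 / 2)) * a o3 * u + g o1 * a o3 + (1 / 6 * sq3) * g o3 * g o3
  + (1 / 6 * sq3) * g o5 * g o5 = 0.
Proof.
transitivity ((- (1 / 12) * sq3) * J o3 o4 o5 o2);
  [by jac_ring'|by rewrite !J0 !mulr0 ?addr0].
Qed.

Lemma jacobi_quad5 : (- 1) * u * u + (1 / 2) * g o1 * u + g o2 * g o2 + g o4 * g o4 = 0.
Proof.
transitivity ((- (1 / 6) * sq3) * J o1 o4 o5 o5
  + (1 / 2) * J o2 o4 o5 o3);
  [by jac_ring'|by rewrite !J0 !mulr0 ?addr0].
Qed.

Lemma jacobi_quad6 : (1 / 2 * sq3) * a o3 * u + a o3 * a o3 = 0.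
Proof.
transitivity ((- (1 / 6) * sq3) * J o1 o4 o5 o5);
  [by jac_ring'|by rewrite !J0 !mulr0 ?addr0].
Qed.

(** The quadratic equation on a_3 alone has two roots: they are the two values
    of delta. If g_1 were not u / 2, then g_2 = g_4 = 0 and g_1 = 2 u, and the
    remaining equations would equate a positive quantity with 0. *)
Lemma jacobi_solutions : exists2 del : R, del = 0 \/ del = 1 &
  g o2 ^+ 2 + g o4 ^+ 2 = (sq3 / 2 * u) ^+ 2 /\
  forall j k i, C j k i = std_bracket (g o2) (g o4) (sq3 / 2 * u) del j k i.
Proof.
have s2 := sqrt3_sq R; have s0 := sqrt3_gt0 R.
have s_neq0 : sq3 != 0 :> R := lt0r_neq0 s0.
have h0 := jacobi_quad0; have h2 := jacobi_quad2; have h5 := jacobi_quad5.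
have u2 : 0 < u ^+ 2 by rewrite exprn_even_gt0.
(* The two values of delta. *)
have ht : a o3 = 0 \/ a o3 = - (sq3 / 2 * u).
  have /eqP : a o3 * (a o3 + sq3 / 2 * u) = 0.
    by rewrite -jacobi_quad6; field.
  by rewrite mulf_eq0 addr_eq0 => /orP[] /eqP ->; [left|right].
(* The alternative g_1 = 2 u is excluded by positivity. *)
have g1 : g o1 = u / 2.
  have [->//|ne] := eqVneq (g o1) (u / 2).
  have ne' : g o1 - u / 2 != 0 by rewrite subr_eq0.
  have e2 : g o2 = 0 by apply: (mulfI ne'); rewrite mulr0 -h0; field.
  have e4 : g o4 = 0 by apply: (mulfI ne'); rewrite mulr0 -h2; field.
  have e1 : g o1 = 2 * u.
    apply: (mulIf u_neq0); move: h5; rewrite e2 e4 => ?; lra.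
  exfalso; have := jacobi_quad4; rewrite e1.
  have g3 : 0 <= g o3 ^+ 2 := sqr_ge0 _; have g5 : 0 <= g o5 ^+ 2 := sqr_ge0 _.
  case: ht => aE; rewrite aE => E.
    have {}E : sq3 * (3 * u ^+ 2 + g o3 ^+ 2 + g o5 ^+ 2) = 0.
      by transitivity (6 * 0 : R); [rewrite -E; field|rewrite mulr0].
    by move/eqP: E; rewrite mulf_eq0 (negbTE s_neq0) /= => /eqP ?; lra.
  have h1 := jacobi_quad1; have h3 := jacobi_quad3.
  move: h1 h3; rewrite e1 => h1 h3.
  have g30 : g o3 = 0.
    by apply: (mulfI u_neq0); rewrite mulr0 -[RHS](mulr0 (2 / 3)) -h1 aE; field: s2.
  have g50 : g o5 = 0.
    by apply: (mulfI u_neq0); rewrite mulr0 -[RHS](mulr0 (2 / 3)) -h3 aE; field: s2.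
  have {}E : sq3 * u ^+ 2 = 0.
    by transitivity (- 4 * 0 : R); [rewrite -E g30 g50; field|rewrite mulr0].
  by move/eqP: E; rewrite mulf_eq0 (negbTE s_neq0) /= => /eqP ?; lra.
have sol : g o2 ^+ 2 + g o4 ^+ 2 = (sq3 / 2 * u) ^+ 2.
  by apply/eqP; rewrite -subr_eq0 -h5 g1; apply/eqP; field: s2.
have [g30 g50] : g o3 = 0 /\ g o5 = 0.
  case: ht => aE.
    have h1 := jacobi_quad1; have h3 := jacobi_quad3.
    move: h1 h3; rewrite g1 aE => h1 h3.
    split; apply: (mulfI u_neq0); rewrite mulr0.
      by rewrite -[RHS](mulr0 (- (2 / 3))) -h1; field.
    by rewrite -[RHS](mulr0 (- (2 / 3))) -h3; field.
  have sum0 : g o3 ^+ 2 + g o5 ^+ 2 = 0.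
    apply: (mulfI s_neq0); rewrite mulr0 -[RHS](mulr0 6) -jacobi_quad4 g1 aE.
    by field.
  move/eqP: sum0; rewrite paddr_eq0 ?sqr_ge0// !sqrf_eq0.
  by move=> /andP[/eqP -> /eqP ->].
(* Once all coefficients are known, both sides are tables. *)
have [del hdel aE] : exists2 del : R, del = 0 \/ del = 1 & a o3 = - (del * (sq3 / 2 * u)).
  case: ht => ->; [exists 0|exists 1]; [by left|by rewrite mul0r oppr0|by right|by rewrite mul1r].
exists del => //; split=> // j k i; rewrite /C /frame_bracket.
pose t := - (del * (sq3 / 2 * u)).
have aT (l : 'I_5) : a l = match val l with 2 => t | _ => 0 end.
  by elim/ord5_ind: l; rewrite /= ?zeros.
have bT (l : 'I_5) : b l = match val l with 4 => - t | _ => 0 end.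
  by elim/ord5_ind: l; rewrite /= ?zeros// aE.
have gT (l : 'I_5) : g l =
    match val l with 0 => u / 2 | 1 => g o2 | 3 => g o4 | _ => 0 end.
  by elim/ord5_ind: l.
rewrite !aT !bT (gT j) (gT k) /std_bracket /t.
move: (g o2) (g o4) => x y.
elim/ord5_ind: i; elim/ord5_ind: j; elim/ord5_ind: k; rewrite /=; by field: s2.
Qed.

End Classification.

(** * Lie derivatives and exterior derivatives along vectors *)

Section Derivations.
Variable R : realType.
Implicit Types (f g : 'rV[R]_5 -> R) (x xi u v w : 'rV[R]_5).

Definition has_partials f x : Prop :=
  forall m : 'I_5, derivable f x (delta_mx 0 m).

(** Derivative in a direction, computed from the partial derivatives, so that
    the Leibniz rule holds as soon as the partial derivatives exist. *)
Definition along xi f x : R := \sum_r xi 0 r * partial r f x.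

Lemma smooth_has_partials V f x : smooth_on V f -> V x -> has_partials f x.
Proof. by move=> /smooth_C1 c Vx; case: (c x Vx). Qed.

Lemma has_partials_cst a x : has_partials (fun=> a) x.
Proof. by move=> m; exact: derivable_cst. Qed.

Lemma has_partialsD f g x : has_partials f x -> has_partials g x ->
  has_partials (fun y => f y + g y) x.
Proof. by move=> df dg m; exact: derivableD. Qed.

Lemma has_partialsM f g x : has_partials f x -> has_partials g x ->
  has_partials (fun y => f y * g y) x.
Proof. by move=> df dg m; exact: derivableM. Qed.

Lemma has_partials_sum (I : Type) (r : seq I) (F : I -> 'rV[R]_5 -> R) x :
  (forall i, has_partials (F i) x) ->
  has_partials (fun y => \sum_(i <- r) F i y) x.
Proof.
move=> dF; elim: r => [|i r IH].
  rewrite (_ : (fun y => _) = (fun=> 0)); first exact: has_partials_cst.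
  by apply/funext => y; rewrite big_nil.
rewrite (_ : (fun y => _) = (fun y => F i y + \sum_(j <- r) F j y)).
  exact: has_partialsD (dF i) IH.
by apply/funext => y; rewrite big_cons.
Qed.

Lemma along_cst xi a x : along xi (fun=> a) x = 0.
Proof.
rewrite /along big1 // => r _.
by rewrite (_ : partial r _ x = 0) ?mulr0 //; exact: derive_cst.
Qed.

Lemma alongD xi f g x : has_partials f x -> has_partials g x ->
  along xi (fun y => f y + g y) x = along xi f x + along xi g x.
Proof.
move=> df dg; rewrite /along -big_split; apply: eq_bigr => r _ /=.
by rewrite -mulrDr; congr (_ * _); exact: deriveD.
Qed.

Lemma alongM xi f g x : has_partials f x -> has_partials g x ->
  along xi (fun y => f y * g y) x = along xi f x * g x + f x * along xi g x.
Proof.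
move=> df dg; rewrite /along mulr_suml mulr_sumr -big_split.
apply: eq_bigr => r _ /=.
have -> : partial r (fun y => f y * g y) x = f x * partial r g x + g x * partial r f x.
  exact: deriveM.
move: (xi 0 r) (partial r f x) (partial r g x) (f x) (g x) => *; ring.
Qed.

Lemma along_sum xi (I : Type) (r : seq I) (F : I -> 'rV[R]_5 -> R) x :
  (forall i, has_partials (F i) x) ->
  along xi (fun y => \sum_(i <- r) F i y) x = \sum_(i <- r) along xi (F i) x.
Proof.
move=> dF; elim: r => [|i r IH].
  rewrite (_ : (fun y => _) = (fun=> 0)); first by rewrite along_cst big_nil.
  by apply/funext => y; rewrite big_nil.
rewrite big_cons -IH -(alongD _ (dF i) (@has_partials_sum _ r _ _ dF)).
by congr (along xi _ x); apply/funext => y; rewrite big_cons.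
Qed.

Lemma along_ext V xi f g x : open V -> V x -> (forall y, V y -> f y = g y) ->
  along xi f x = along xi g x.
Proof.
by move=> oV Vx fg; apply: eq_bigr => r _; rewrite (partial_ext oV fg).
Qed.

Definition row_along xi (w : 'rV[R]_5 -> 'rV[R]_5) x : 'rV[R]_5 :=
  \row_j along xi (fun y => w y 0 j) x.

Definition row_has_partials (w : 'rV[R]_5 -> 'rV[R]_5) x : Prop :=
  forall j, has_partials (fun y => w y 0 j) x.

Lemma along_trilinear xi
    (Y : 'rV[R]_5 -> 'I_5 -> 'I_5 -> 'I_5 -> R) (p q s : 'rV[R]_5 -> 'rV[R]_5) x :
  (forall i j k, has_partials (fun y => Y y i j k) x) ->
  row_has_partials p x -> row_has_partials q x -> row_has_partials s x ->
  along xi (fun y => trilinear (Y y) (p y) (q y) (s y)) x =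
    trilinear (fun i j k => along xi (fun y => Y y i j k) x) (p x) (q x) (s x)
    + trilinear (Y x) (row_along xi p x) (q x) (s x)
    + trilinear (Y x) (p x) (row_along xi q x) (s x)
    + trilinear (Y x) (p x) (q x) (row_along xi s x).
Proof.
move=> dY dp dq ds; rewrite /trilinear -!big_split.
have d2 i j k := has_partialsM (dY i j k) (dp i).
have d3 i j k := has_partialsM (d2 i j k) (dq j).
have d4 i j k := has_partialsM (d3 i j k) (ds k).
rewrite along_sum => [|i]; last first.
  by apply: has_partials_sum => j; apply: has_partials_sum => k; exact: d4.
apply: eq_bigr => i _; rewrite -!big_split along_sum => [|j]; last first.
  by apply: has_partials_sum => k; exact: d4.
apply: eq_bigr => j _; rewrite -!big_split along_sum => [|k]; last exact: d4.
apply: eq_bigr => k _ /=.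
rewrite (alongM _ (d3 i j k) (ds k)) (alongM _ (d2 i j k) (dq j)).
rewrite (alongM _ (dY i j k) (dp i)) !mxE.
move: (along _ _ _) (along _ _ _) (along _ _ _) (along _ _ _) => *; ring.
Qed.

Definition bilinear (g : 'M[R]_5) u v : R := \sum_m \sum_n g m n * u 0 m * v 0 n.

Lemma bilinearE (g : 'M[R]_5) u v : bilinear g u v = (u *m g *m v^T) 0 0.
Proof.
rewrite /bilinear exchange_big mxE; apply: eq_bigr => n _.
rewrite !mxE mulr_suml; apply: eq_bigr => m _.
by rewrite [g m n * _]mulrC.
Qed.

Lemma along_bilinear xi (g : 'rV[R]_5 -> 'M[R]_5) (p q : 'rV[R]_5 -> 'rV[R]_5) x :
  (forall i j, has_partials (fun y => g y i j) x) ->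
  row_has_partials p x -> row_has_partials q x ->
  along xi (fun y => bilinear (g y) (p y) (q y)) x =
    bilinear (\matrix_(i, j) along xi (fun y => g y i j) x) (p x) (q x)
    + bilinear (g x) (row_along xi p x) (q x)
    + bilinear (g x) (p x) (row_along xi q x).
Proof.
move=> dg dp dq; rewrite /bilinear -!big_split.
have d2 i j := has_partialsM (dg i j) (dp i).
have d3 i j := has_partialsM (d2 i j) (dq j).
rewrite along_sum => [|i]; last by apply: has_partials_sum => j; exact: d3.
apply: eq_bigr => i _; rewrite -!big_split along_sum => [|j]; last exact: d3.
apply: eq_bigr => j _ /=.
rewrite (alongM _ (d2 i j) (dq j)) (alongM _ (dg i j) (dp i)) !mxE.
move: (along _ _ _) (along _ _ _) (along _ _ _) => *; ring.
Qed.

(** The identities below express the Lie derivative through the derivative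
    along X and the endomorphism u |-> row_along u X of the tangent space. *)
Lemma lie_cubic_contract (X : 'rV[R]_5 -> 'rV[R]_5)
    (Y : 'rV[R]_5 -> 'I_5 -> 'I_5 -> 'I_5 -> R) x u v w :
  trilinear (lie_cubic X Y x) u v w =
    trilinear (fun i j k => along (X x) (fun y => Y y i j k) x) u v w
    + trilinear (Y x) (row_along u X x) v w
    + trilinear (Y x) u (row_along v X x) w
    + trilinear (Y x) u v (row_along w X x).
Proof.
have -> : trilinear (Y x) (row_along u X x) v w =
    trilinear (fun i j k => \sum_r Y x r j k * partial i (fun y => X y 0 r) x) u v w.
  rewrite /trilinear.
  under eq_bigr => r _ do under eq_bigr => j _ do under eq_bigr => k _ do
    rewrite mxE /along mulr_sumr !mulr_suml.
  under eq_bigr => r _ do under eq_bigr => j _ do rewrite exchange_big.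
  under eq_bigr => r _ do rewrite exchange_big.
  rewrite exchange_big; apply: eq_bigr => i _ /=.
  rewrite exchange_big; apply: eq_bigr => j _ /=.
  rewrite exchange_big; apply: eq_bigr => k _ /=.
  rewrite !mulr_suml; apply: eq_bigr => r _.
  move: (Y x r j k) (partial _ _ _) (u 0 i) (v 0 j) (w 0 k) => *; ring.
have -> : trilinear (Y x) u (row_along v X x) w =
    trilinear (fun i j k => \sum_r Y x i r k * partial j (fun y => X y 0 r) x) u v w.
  rewrite /trilinear; apply: eq_bigr => i _.
  under eq_bigr => r _ do under eq_bigr => k _ do
    rewrite mxE /along mulr_sumr !mulr_suml.
  under eq_bigr => r _ do rewrite exchange_big.
  rewrite exchange_big; apply: eq_bigr => j _ /=.
  rewrite exchange_big; apply: eq_bigr => k _ /=.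
  rewrite !mulr_suml; apply: eq_bigr => r _.
  move: (Y x i r k) (partial _ _ _) (u 0 i) (v 0 j) (w 0 k) => *; ring.
have -> : trilinear (Y x) u v (row_along w X x) =
    trilinear (fun i j k => \sum_r Y x i j r * partial k (fun y => X y 0 r) x) u v w.
  rewrite /trilinear; apply: eq_bigr => i _; apply: eq_bigr => j _.
  under eq_bigr => r _ do rewrite mxE /along mulr_sumr.
  rewrite exchange_big; apply: eq_bigr => k _ /=.
  rewrite !mulr_suml; apply: eq_bigr => r _.
  move: (Y x i j r) (partial _ _ _) (u 0 i) (v 0 j) (w 0 k) => *; ring.
rewrite /trilinear -!big_split; apply: eq_bigr => i _.
rewrite -!big_split; apply: eq_bigr => j _.
rewrite -!big_split; apply: eq_bigr => k _ /=.
by rewrite /lie_cubic /along !big_split /= !mulrDl.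
Qed.

Lemma lie_metric_contract (X : 'rV[R]_5 -> 'rV[R]_5) (g : 'rV[R]_5 -> 'M[R]_5) x u v :
  bilinear (lie_metric X g x) u v =
    bilinear (\matrix_(i, j) along (X x) (fun y => g y i j) x) u v
    + bilinear (g x) (row_along u X x) v + bilinear (g x) u (row_along v X x).
Proof.
have -> : bilinear (g x) (row_along u X x) v =
    \sum_m \sum_n (\sum_r g x r n * partial m (fun y => X y 0 r) x) * u 0 m * v 0 n.
  rewrite /bilinear.
  under eq_bigr => r _ do under eq_bigr => n _ do
    rewrite mxE /along mulr_sumr !mulr_suml.
  under eq_bigr => r _ do rewrite exchange_big.
  rewrite exchange_big; apply: eq_bigr => m _ /=.
  rewrite exchange_big; apply: eq_bigr => n _ /=.
  rewrite !mulr_suml; apply: eq_bigr => r _.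
  move: (g x r n) (partial _ _ _) (u 0 m) (v 0 n) => *; ring.
have -> : bilinear (g x) u (row_along v X x) =
    \sum_m \sum_n (\sum_r g x m r * partial n (fun y => X y 0 r) x) * u 0 m * v 0 n.
  rewrite /bilinear; apply: eq_bigr => m _.
  under eq_bigr => r _ do rewrite mxE /along mulr_sumr.
  rewrite exchange_big; apply: eq_bigr => n _ /=.
  rewrite !mulr_suml; apply: eq_bigr => r _.
  move: (g x m r) (partial _ _ _) (u 0 m) (v 0 n) => *; ring.
rewrite /bilinear -!big_split; apply: eq_bigr => m _.
rewrite -!big_split; apply: eq_bigr => n _ /=.
by rewrite !mxE /along !big_split /= !mulrDl.
Qed.

Lemma field_bracket_along (X Z : 'rV[R]_5 -> 'rV[R]_5) x :
  field_bracket X Z x = row_along (X x) Z x - row_along (Z x) X x.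
Proof. by apply/rowP => r; rewrite !mxE /along sumrB. Qed.

Definition pair u v : R := \sum_m u 0 m * v 0 m.

Lemma lie_form_pair (X w : 'rV[R]_5 -> 'rV[R]_5) x u :
  pair (lie_form X w x) u =
    pair (row_along (X x) w x) u + pair (w x) (row_along u X x).
Proof.
have -> : pair (w x) (row_along u X x) =
    \sum_m (\sum_r w x 0 r * partial m (fun y => X y 0 r) x) * u 0 m.
  rewrite /pair; under eq_bigr => r _ do rewrite mxE /along mulr_sumr.
  rewrite exchange_big; apply: eq_bigr => m _ /=.
  rewrite !mulr_suml; apply: eq_bigr => r _.
  move: (w x 0 r) (partial _ _ _) (u 0 m) => *; ring.
rewrite /pair -big_split; apply: eq_bigr => m _ /=.
by rewrite !mxE /along big_split /= mulrDl.
Qed.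

Lemma ext_d_pair (w : 'rV[R]_5 -> 'rV[R]_5) x u v :
  bilinear (ext_d w x) u v = pair (row_along u w x) v - pair (row_along v w x) u.
Proof.
rewrite /pair.
under [X in _ = X - _]eq_bigr => n _ do rewrite mxE /along mulr_suml.
under [X in _ = _ - X]eq_bigr => m _ do rewrite mxE /along mulr_suml.
rewrite [X in _ = X - _]exchange_big -sumrB; apply: eq_bigr => m _ /=.
rewrite -sumrB; apply: eq_bigr => n _; rewrite mxE.
move: (partial _ _ _) (partial _ _ _) (u 0 m) (v 0 n) => *; ring.
Qed.

(** Cartan's formula for a 1-form evaluated on two fields. *)
Lemma ext_d_fields (w X Z : 'rV[R]_5 -> 'rV[R]_5) x :
  bilinear (ext_d w x) (X x) (Z x) =
    pair (lie_form X w x) (Z x) - pair (lie_form Z w x) (X x)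
    + pair (w x) (field_bracket X Z x).
Proof.
rewrite ext_d_pair !lie_form_pair field_bracket_along.
have -> : pair (w x) (row_along (X x) Z x - row_along (Z x) X x) =
    pair (w x) (row_along (X x) Z x) - pair (w x) (row_along (Z x) X x).
  by rewrite /pair -sumrB; apply: eq_bigr => m _; rewrite mxE [X in _ * (_ + X)]mxE mulrBr.
move: (pair _ _) (pair _ _) (pair _ _) (pair _ _) => *; ring.
Qed.

End Derivations.

(** * Brackets and changes of basis *)

Section Brackets.
Variable R : realType.
Implicit Types (c C : 'I_5 -> 'I_5 -> 'I_5 -> R) (u v w : 'rV[R]_5) (P : 'M[R]_5).

(** P expresses the basis with structure constants c through the basis with
    structure constants C. *)
Definition intertwines P c C : Prop :=
  forall u v, bracket_of c u v *m P = bracket_of C (u *m P) (v *m P).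

Lemma bracketDl c u u' v :
  bracket_of c (u + u') v = bracket_of c u v + bracket_of c u' v.
Proof.
apply/rowP => k; rewrite !mxE -big_split; apply: eq_bigr => i _ /=.
by rewrite -big_split; apply: eq_bigr => j _ /=; rewrite mxE !mulrDl.
Qed.

Lemma bracketZl c a u v : bracket_of c (a *: u) v = a *: bracket_of c u v.
Proof.
apply/rowP => k; rewrite !mxE mulr_sumr; apply: eq_bigr => i _ /=.
by rewrite mulr_sumr; apply: eq_bigr => j _; rewrite mxE !mulrA.
Qed.

Lemma bracketDr c u v v' :
  bracket_of c u (v + v') = bracket_of c u v + bracket_of c u v'.
Proof.
apply/rowP => k; rewrite !mxE -big_split; apply: eq_bigr => i _ /=.
by rewrite -big_split; apply: eq_bigr => j _ /=; rewrite mxE mulrDr mulrDl.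
Qed.

Lemma bracketZr c a u v : bracket_of c u (a *: v) = a *: bracket_of c u v.
Proof.
apply/rowP => k; rewrite !mxE mulr_sumr; apply: eq_bigr => i _ /=.
rewrite mulr_sumr; apply: eq_bigr => j _; rewrite mxE.
by move: (u 0 i) (v 0 j) (c i j k) => *; ring.
Qed.

Lemma bracket_delta c i j k :
  bracket_of c (delta_mx 0 i) (delta_mx 0 j) 0 k = c i j k.
Proof.
rewrite mxE (bigD1 i)//= [X in _ + X]big1 ?addr0 => [|i' ii]; last first.
  by rewrite big1// => j' _; rewrite mxE (negbTE ii) andbF !mul0r.
rewrite (bigD1 j)//= [X in _ + X]big1 ?addr0 => [|j' jj]; last first.
  by rewrite [delta_mx 0 j _ _]mxE (negbTE jj) andbF mulr0 mul0r.
by rewrite !mxE !eqxx !mul1r.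
Qed.

Lemma bracket_suml c (I : Type) (r : seq I) (F : I -> 'rV[R]_5) v :
  bracket_of c (\sum_(i <- r) F i) v = \sum_(i <- r) bracket_of c (F i) v.
Proof.
elim: r => [|i r IH]; last by rewrite !big_cons bracketDl IH.
by rewrite !big_nil -[X in bracket_of c X](scale0r 0) bracketZl scale0r.
Qed.

Lemma bracket_sumr c (I : Type) (r : seq I) (F : I -> 'rV[R]_5) u :
  bracket_of c u (\sum_(i <- r) F i) = \sum_(i <- r) bracket_of c u (F i).
Proof.
elim: r => [|i r IH]; last by rewrite !big_cons bracketDr IH.
by rewrite !big_nil -[X in bracket_of c u X](scale0r 0) bracketZr scale0r.
Qed.

Lemma intertwines_basis P c C :
  (forall s t i, \sum_u c s t u * P u i = \sum_j \sum_k P s j * P t k * C j k i) ->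
  intertwines P c C.
Proof.
move=> H; have basis s t :
    bracket_of c (delta_mx 0 s) (delta_mx 0 t) *m P =
    bracket_of C (delta_mx 0 s *m P) (delta_mx 0 t *m P).
  apply/rowP => i; rewrite -!rowE !mxE.
  under eq_bigr => u _ do rewrite bracket_delta.
  rewrite H; apply: eq_bigr => j _; apply: eq_bigr => k _.
  by rewrite [row s P _ _]mxE [row t P _ _]mxE.
move=> u v.
rewrite [u]row_sum_delta [v]row_sum_delta !bracket_suml !mulmx_suml !bracket_suml.
apply: eq_bigr => s _; rewrite !bracket_sumr !mulmx_suml.
apply: eq_bigr => t _.
by rewrite -!scalemxAl !bracketZl !bracketZr -!scalemxAl basis.
Qed.

Definition jacobi_identity c : Prop := forall u v w,
  bracket_of c (bracket_of c u v) w + bracket_of c (bracket_of c v w) u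
  + bracket_of c (bracket_of c w u) v = 0.

Lemma bracket_bracket_delta c (i j k v : 'I_5) :
  bracket_of c (bracket_of c (delta_mx 0 i) (delta_mx 0 j)) (delta_mx 0 k) 0 v =
  \sum_u c i j u * c u k v.
Proof.
rewrite [X in bracket_of c X]row_sum_delta bracket_suml summxE.
by apply: eq_bigr => u _; rewrite bracketZl mxE bracket_delta bracket_delta.
Qed.

Lemma jacobiP c : jacobi_identity c <-> jacobi c.
Proof.
split=> [J i j k v|J u v w].
  have /rowP/(_ v) := J (delta_mx 0 i) (delta_mx 0 j) (delta_mx 0 k).
  by rewrite !big_split /= -!bracket_bracket_delta !mxE.
have basis i j k : bracket_of c (bracket_of c (delta_mx 0 i) (delta_mx 0 j)) (delta_mx 0 k)
   + bracket_of c (bracket_of c (delta_mx 0 j) (delta_mx 0 k)) (delta_mx 0 i)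
   + bracket_of c (bracket_of c (delta_mx 0 k) (delta_mx 0 i)) (delta_mx 0 j) = 0.
  apply/rowP => v'; have := J i j k v'.
  by rewrite !big_split /= -!bracket_bracket_delta !mxE.
rewrite [u]row_sum_delta [v]row_sum_delta [w]row_sum_delta.
pose Bu i : 'rV[R]_5 := u 0 i *: delta_mx 0 i.
pose Bv i : 'rV[R]_5 := v 0 i *: delta_mx 0 i.
pose Bw i : 'rV[R]_5 := w 0 i *: delta_mx 0 i.
pose br2 x y z := bracket_of c (bracket_of c x y) z.
have e1 : bracket_of c (bracket_of c (\sum_j Bu j) (\sum_j Bv j)) (\sum_j Bw j) =
    \sum_i \sum_j \sum_k br2 (Bu i) (Bv j) (Bw k).
  rewrite !bracket_suml; apply: eq_bigr => i _.
  rewrite [X in bracket_of c X _]bracket_sumr bracket_suml.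
  by apply: eq_bigr => j _; rewrite bracket_sumr.
have e2 : bracket_of c (bracket_of c (\sum_j Bv j) (\sum_j Bw j)) (\sum_j Bu j) =
    \sum_i \sum_j \sum_k br2 (Bv j) (Bw k) (Bu i).
  rewrite [LHS]bracket_sumr; apply: eq_bigr => i _.
  rewrite !bracket_suml; apply: eq_bigr => j _.
  by rewrite [X in bracket_of c X _]bracket_sumr bracket_suml.
have e3 : bracket_of c (bracket_of c (\sum_j Bw j) (\sum_j Bu j)) (\sum_j Bv j) =
    \sum_i \sum_j \sum_k br2 (Bw k) (Bu i) (Bv j).
  rewrite [X in bracket_of c X _]bracket_sumr bracket_suml; apply: eq_bigr => i _.
  rewrite [LHS]bracket_sumr; apply: eq_bigr => j _.
  by rewrite !bracket_suml.
rewrite e1 e2 e3 -!big_split big1// => i _; rewrite -!big_split big1// => j _.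
rewrite -!big_split big1// => k _ /=; rewrite /br2 /Bu /Bv /Bw.
rewrite -[RHS](scaler0 _ (u 0 i * v 0 j * w 0 k)) -(basis i j k) !scalerDr.
congr (_ + _ + _); rewrite !(bracketZl, bracketZr) !scalerA; congr (_ *: _);
  by move: (u 0 i) (v 0 j) (w 0 k) => *; ring.
Qed.

Lemma intertwines_jacobi P c C : P \in unitmx -> intertwines P c C ->
  jacobi_identity c -> jacobi_identity C.
Proof.
move=> uP H J u v w.
have E (x : 'rV[R]_5) : x = (x *m invmx P) *m P by rewrite -mulmxA mulVmx ?mulmx1.
rewrite (E u) (E v) (E w) -!H -!mulmxDl.
by rewrite J mul0mx.
Qed.

Lemma intertwines_trans P Q c C D :
  intertwines P c C -> intertwines Q C D -> intertwines (P *m Q) c D.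
Proof. by move=> H K u v; rewrite mulmxA H K !mulmxA. Qed.

Lemma intertwines_inj P c C D : P \in unitmx ->
  intertwines P c C -> intertwines P c D -> forall j k i, C j k i = D j k i.
Proof.
move=> uP H K j k i.
have E (x : 'rV[R]_5) : x = (x *m invmx P) *m P by rewrite -mulmxA mulVmx ?mulmx1.
rewrite -!bracket_delta (E (delta_mx 0 j)) (E (delta_mx 0 k)).
by rewrite -H -K.
Qed.

Lemma intertwines_eqr P c C D : (forall j k i, C j k i = D j k i) ->
  intertwines P c C -> intertwines P c D.
Proof.
move=> CD H u v; rewrite H; apply/rowP => l; rewrite !mxE.
by apply: eq_bigr => i _; apply: eq_bigr => j _; rewrite CD.
Qed.

Definition trad c (s : 'I_5) : R := \sum_u c s u u.

(** The trace form of the adjoint representation is a covector. *)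
Lemma trad_intertwines P c C : P \in unitmx -> intertwines P c C ->
  forall s, trad c s = \sum_j P s j * trad C j.
Proof.
move=> uP H s.
pose ad (D : 'I_5 -> 'I_5 -> 'I_5 -> R) u : 'M[R]_5 :=
  \matrix_(i, k) bracket_of D u (delta_mx 0 i) 0 k.
have adE D u v : bracket_of D u v = v *m ad D u.
  rewrite [v in LHS]row_sum_delta bracket_sumr; apply/rowP => k.
  rewrite summxE mxE; apply: eq_bigr => i _.
  by rewrite bracketZr !mxE.
have tr_ad D u : \tr (ad D u) = \sum_j u 0 j * trad D j.
  rewrite /mxtrace; transitivity (\sum_i \sum_j u 0 j * D j i i).
    apply: eq_bigr => i _; rewrite mxE [u in LHS]row_sum_delta bracket_suml summxE.
    by apply: eq_bigr => j _; rewrite bracketZl mxE bracket_delta.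
  by rewrite exchange_big; apply: eq_bigr => j _; rewrite /trad mulr_sumr.
have cj : ad c (delta_mx 0 s) *m P = P *m ad C (row s P).
  apply/row_matrixP => i; rewrite !row_mul [row i (ad _ _)]rowE -adE H.
  by rewrite -!rowE adE.
have : \tr (ad c (delta_mx 0 s)) = \tr (ad C (row s P)).
  by rewrite -[ad c _](mulmxK uP) cj mxtrace_mulC mulKmx.
rewrite !tr_ad (bigD1 s)//= big1 ?addr0 => [|j js]; last first.
  by rewrite mxE (negbTE js) andbF mul0r.
rewrite mxE !eqxx mul1r => ->.
by apply: eq_bigr => j _; rewrite mxE.
Qed.

(** The trace of ad [x, y] = [ad x, ad y] is zero. *)
Lemma trad_derivation c r s : jacobi_identity c ->
  (forall i j k, c i j k = - c j i k) -> \sum_u c r s u * trad c u = 0.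
Proof.
move=> /jacobiP J sk.
have S : \sum_v \sum_u (c r s u * c u v v + c s v u * c u r v + c v r u * c u s v) = 0.
  by rewrite big1// => v _; exact: J.
apply: etrans S.
under [RHS]eq_bigr => v _ do rewrite !big_split /=.
rewrite !big_split /= [X in _ + X + _](_ : _ = - \sum_v \sum_u c v r u * c u s v); last first.
  rewrite exchange_big -sumrN; apply: eq_bigr => v _ /=.
  rewrite -sumrN; apply: eq_bigr => u _.
  by rewrite [c s u v]sk mulNr mulrC.
rewrite subrK exchange_big; apply: eq_bigr => u _ /=.
by rewrite /trad mulr_sumr.
Qed.

End Brackets.

(** * The action of a symmetry on an adapted coframe *)

Section Symmetries.
Variables (R : realType) (M : manifold R) (S : so3_structure M).
Variables (c : 'I_5 -> 'I_5 -> 'I_5 -> R).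
Variables (X : 'I_5 -> chart M -> 'rV[R]_5 -> 'rV[R]_5).
Hypothesis hG : transitive_symmetry_algebra S c X.
Implicit Types (a b : chart M) (x u v w : 'rV[R]_5) (th : 'I_5 -> 'rV[R]_5 -> 'rV[R]_5).

Lemma ups0_sym : symmetric3 (@ups0 R).
Proof.
by move=> i j k; have [? ?] := ups_coef_sym R i j k; rewrite !ups0E.
Qed.

Lemma cubic_form_ups0 (z : 'rV[R]_5) : cubic_form ups0 z = ups0_form z.
Proof.
rewrite ups0_formE /cubic_form; apply: eq_bigr => i _; apply: eq_bigr => j _.
by apply: eq_bigr => k _; rewrite ups0E.
Qed.

Definition adapted_at a x (Th : 'M[R]_5) : Prop :=
  metric S a x = Th^T *m Th /\
  forall v, cubic_form (ups S a x) v = ups0_form (v *m Th^T).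

Lemma adapted_trilinear a x Th u v w : cim a x -> adapted_at a x Th ->
  trilinear (ups S a x) u v w =
  trilinear ups0 (u *m Th^T) (v *m Th^T) (w *m Th^T).
Proof.
move=> ax [_ cf]; rewrite trilinear_polar; last by move=> i j k; exact: ups_sym.
by rewrite (trilinear_polar _ _ _ ups0_sym) !cf -!mulmxDl !cubic_form_ups0.
Qed.

Lemma adapted_bilinear a x Th u v : adapted_at a x Th ->
  bilinear (metric S a x) u v = bilinear 1%:M (u *m Th^T) (v *m Th^T).
Proof.
by move=> [-> _]; rewrite !bilinearE mulmx1 trmx_mul trmxK !mulmxA.
Qed.

Lemma bilinearDl (g : 'M[R]_5) u u' v :
  bilinear g (u + u') v = bilinear g u v + bilinear g u' v.
Proof. by rewrite !bilinearE !mulmxDl mxE. Qed.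

Lemma bilinearDr (g : 'M[R]_5) u v v' :
  bilinear g u (v + v') = bilinear g u v + bilinear g u v'.
Proof. by rewrite !bilinearE linearD /= mulmxDr mxE. Qed.

Lemma bilinear0l (g : 'M[R]_5) v : bilinear g 0 v = 0.
Proof. by rewrite bilinearE !mul0mx mxE. Qed.

Lemma bilinear0r (g : 'M[R]_5) u : bilinear g u 0 = 0.
Proof. by rewrite bilinearE trmx0 mulmx0 mxE. Qed.

Lemma bilinear_mx0 u v : bilinear 0 u v = 0.
Proof. by rewrite bilinearE mulmx0 mul0mx mxE. Qed.

Lemma bilinear_eq0 (g : 'M[R]_5) : (forall u v, bilinear g u v = 0) -> g = 0.
Proof.
move=> g0; apply/matrixP => i j; rewrite [RHS]mxE.
have := g0 (delta_mx 0 i) (delta_mx 0 j).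
by rewrite bilinearE -rowE trmx_delta -colE !mxE.
Qed.

Lemma trilinearZl (Y : 'I_5 -> 'I_5 -> 'I_5 -> R) t u v w :
  trilinear Y (t *: u) v w = t * trilinear Y u v w.
Proof.
rewrite /trilinear mulr_sumr; apply: eq_bigr => i _; rewrite mulr_sumr.
apply: eq_bigr => j _; rewrite mulr_sumr; apply: eq_bigr => k _; rewrite mxE.
move: (Y i j k) (u 0 i) (v 0 j) (w 0 k) => *; ring.
Qed.

Lemma trilinear0l (Y : 'I_5 -> 'I_5 -> 'I_5 -> R) v w : trilinear Y 0 v w = 0.
Proof. by rewrite -[X in trilinear Y X](scale0r 0) trilinearZl mul0r. Qed.

Lemma trilinear_suml (Y : 'I_5 -> 'I_5 -> 'I_5 -> R) (I : Type) (r : seq I)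
    (F : I -> 'rV[R]_5) v w :
  trilinear Y (\sum_(i <- r) F i) v w = \sum_(i <- r) trilinear Y (F i) v w.
Proof.
elim: r => [|i r IH]; first by rewrite !big_nil trilinear0l.
by rewrite !big_cons trilinearDl IH.
Qed.

Lemma trilinearD2 (Y : 'I_5 -> 'I_5 -> 'I_5 -> R) u v v' w : symmetric3 Y ->
  trilinear Y u (v + v') w = trilinear Y u v w + trilinear Y u v' w.
Proof. by move=> sY; rewrite !(trilinear_swap12 u _ _ sY) trilinearDl. Qed.

Lemma trilinearD3 (Y : 'I_5 -> 'I_5 -> 'I_5 -> R) u v w w' : symmetric3 Y ->
  trilinear Y u v (w + w') = trilinear Y u v w + trilinear Y u v w'.
Proof. by move=> sY; rewrite !(trilinear_swap23 u v _ sY) trilinearD2. Qed.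

Lemma trilinear_deltal (Y : 'I_5 -> 'I_5 -> 'I_5 -> R) u j k :
  trilinear Y u (delta_mx 0 j) (delta_mx 0 k) = \sum_l u 0 l * Y l j k.
Proof.
rewrite [u in LHS]row_sum_delta trilinear_suml; apply: eq_bigr => l _.
by rewrite trilinearZl trilinear_delta.
Qed.

Definition lie_mx a th (s : 'I_5) x : 'M[R]_5 :=
  \matrix_i lie_form (X s a) (th i) x.

Lemma coords_pair th x u i : (u *m (coframe_mx th x)^T) 0 i = pair (th i x) u.
Proof.
by rewrite mxE /pair; apply: eq_bigr => m _; rewrite !mxE mulrC.
Qed.

Lemma lie_mx_pair a th s x u i :
  (u *m (lie_mx a th s x)^T) 0 i = pair (lie_form (X s a) (th i) x) u.
Proof.
by rewrite mxE /pair; apply: eq_bigr => m _; rewrite !mxE mulrC.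
Qed.

Lemma has_partials_coords th x u : (forall i, row_has_partials (th i) x) ->
  row_has_partials (fun y => u *m (coframe_mx th y)^T) x.
Proof.
move=> dth i.
rewrite (_ : (fun y => _) = (fun y => \sum_m u 0 m * th i y 0 m)).
  apply: has_partials_sum => m.
  exact: has_partialsM (@has_partials_cst R (u 0 m) x) (dth i m).
by apply/funext => y; rewrite mxE; apply: eq_bigr => m _; rewrite !mxE.
Qed.

Lemma row_along_coords xi th x u : (forall i, row_has_partials (th i) x) ->
  forall i, row_along xi (fun y => u *m (coframe_mx th y)^T) x 0 i =
  pair (row_along xi (th i) x) u.
Proof.
move=> dth i; rewrite mxE.
rewrite (_ : (fun y => _) = (fun y => \sum_m u 0 m * th i y 0 m)); last first.
  by apply/funext => y; rewrite mxE; apply: eq_bigr => m _; rewrite !mxE.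
rewrite along_sum => [|m]; last first.
  exact: has_partialsM (@has_partials_cst R (u 0 m) x) (dth i m).
rewrite /pair; apply: eq_bigr => m _.
by rewrite (alongM _ (@has_partials_cst R (u 0 m) x) (dth i m)) along_cst mul0r add0r mxE mulrC.
Qed.

Lemma row_along_cst xi u x : row_along xi (fun=> u) x = 0.
Proof. by apply/rowP => i; rewrite !mxE along_cst. Qed.

Lemma row_has_partials_cst u x : row_has_partials (fun=> u) x.
Proof. by move=> j; exact: has_partials_cst. Qed.

Lemma lie_mx_coords a th s x u : (forall i, row_has_partials (th i) x) ->
  u *m (lie_mx a th s x)^T =
  row_along (X s a x) (fun y => u *m (coframe_mx th y)^T) x
  + row_along u (X s a) x *m (coframe_mx th x)^T.
Proof.
move=> dth; apply/rowP => i.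
rewrite [RHS]mxE lie_mx_pair row_along_coords// coords_pair.
exact: lie_form_pair.
Qed.

Lemma trilinear_along_cst xi (Y : 'I_5 -> 'I_5 -> 'I_5 -> R) x u v w :
  trilinear (fun i j k => along xi (fun=> Y i j k) x) u v w = 0.
Proof.
rewrite /trilinear big1// => i _; rewrite big1// => j _; rewrite big1// => k _.
by rewrite along_cst !mul0r.
Qed.

Section AdaptedOn.
Variables (a : chart M) (V : set 'rV[R]_5) (th : 'I_5 -> 'rV[R]_5 -> 'rV[R]_5).
Hypothesis adV : adapted_on S a V th.

Lemma adapted_on_at x : V x -> adapted_at a x (coframe_mx th x).
Proof. by case: adV => _ _ _ h /h. Qed.

Lemma adapted_open : open V. Proof. by case: adV. Qed.

Lemma adapted_cim x : V x -> cim a x.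
Proof. by case: adV => _ + _ _; apply. Qed.

Lemma adapted_unit x : V x -> coframe_mx th x \in unitmx.
Proof. by case: adV => _ _ [_ +] _; apply. Qed.

Lemma adapted_partials x : V x -> forall i, row_has_partials (th i) x.
Proof.
case: adV => _ _ [+ _] _ => sth Vx i j.
exact: smooth_has_partials (sth i j) Vx.
Qed.

Lemma symmetry_partials s x : V x -> row_has_partials (X s a) x.
Proof.
move=> Vx j.
by apply: smooth_has_partials (adapted_cim Vx); apply: (field_smooth hG).
Qed.

(** Derivative along the symmetry of the identity g = theta^T theta: the metric
    being invariant, what remains is skewness. *)
Lemma lie_mx_metric s x u v : V x ->
  bilinear 1%:M (u *m (lie_mx a th s x)^T) (v *m (coframe_mx th x)^T)
  + bilinear 1%:M (u *m (coframe_mx th x)^T) (v *m (lie_mx a th s x)^T) = 0.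
Proof.
move=> Vx; have dth := adapted_partials Vx.
have := lie_metric_contract (X s a) (metric S a) x u v.
rewrite (field_metric hG s (adapted_cim Vx)) bilinear_mx0.
have dg i j : has_partials (fun y => metric S a y i j) x.
  by apply: smooth_has_partials (adapted_cim Vx); exact: metric_smooth.
have := along_bilinear (X s a x) dg (@row_has_partials_cst u x)
  (@row_has_partials_cst v x).
rewrite !row_along_cst bilinear0l bilinear0r !addr0 => <-.
rewrite (along_ext (g := fun y => bilinear 1%:M (u *m (coframe_mx th y)^T)
   (v *m (coframe_mx th y)^T)) _ adapted_open Vx); last first.
  by move=> y Vy; apply: adapted_bilinear; exact: adapted_on_at.
have d1 i j : has_partials (fun=> (1%:M : 'M[R]_5) i j) x.
  exact: has_partials_cst.
rewrite (along_bilinear (g := fun=> 1%:M) _ d1 (has_partials_coords (u:=u) dth)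
  (has_partials_coords (u:=v) dth)).
rewrite (_ : \matrix_(i, j) _ = 0); last first.
  by apply/matrixP => i j; rewrite !mxE along_cst.
rewrite bilinear_mx0 add0r => ->.
rewrite !lie_mx_coords// !bilinearDl !bilinearDr.
rewrite !(adapted_bilinear _ _ (adapted_on_at Vx)).
move: (bilinear _ _ _) (bilinear _ _ _) (bilinear _ _ _) (bilinear _ _ _) => *.
ring.
Qed.

(** The same derivative for Upsilon, whose components in the coframe are the
    constants of the standard cubic form. *)
Lemma lie_mx_ups s x u v w : V x ->
  let T := (coframe_mx th x)^T in let L := (lie_mx a th s x)^T in
  trilinear ups0 (u *m L) (v *m T) (w *m T)
  + trilinear ups0 (u *m T) (v *m L) (w *m T)
  + trilinear ups0 (u *m T) (v *m T) (w *m L) = 0.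
Proof.
move=> Vx T L; have dth := adapted_partials Vx.
have := lie_cubic_contract (X s a) (ups S a) x u v w.
rewrite (_ : trilinear (lie_cubic _ _ _) _ _ _ = 0); last first.
  rewrite /trilinear big1// => i _; rewrite big1// => j _; rewrite big1// => k _.
  by rewrite (field_ups hG s i j k (adapted_cim Vx)) !mul0r.
have dY i j k : has_partials (fun y => ups S a y i j k) x.
  by apply: smooth_has_partials (adapted_cim Vx); exact: ups_smooth.
have s0 := ups0_sym.
have sY : symmetric3 (ups S a x).
  by move=> i j k; exact: ups_sym (adapted_cim Vx).
have := along_trilinear (X s a x) dY (@row_has_partials_cst u x)
  (@row_has_partials_cst v x) (@row_has_partials_cst w x).
rewrite !row_along_cst trilinear0l (trilinear_swap12 u 0 _ sY) trilinear0l.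
rewrite (trilinear_swap23 u v 0 sY) (trilinear_swap12 u 0 _ sY) trilinear0l.
rewrite !addr0 => <-.
rewrite (along_ext (g := fun y => trilinear ups0 (u *m (coframe_mx th y)^T)
   (v *m (coframe_mx th y)^T) (w *m (coframe_mx th y)^T)) _ adapted_open Vx); last first.
  by move=> y Vy; apply: adapted_trilinear; [exact: adapted_cim|exact: adapted_on_at].
have d1 i j k : has_partials (fun=> ups0 i j k : R) x by exact: has_partials_cst.
rewrite (along_trilinear (Y := fun=> ups0) _ d1 (has_partials_coords (u:=u) dth)
  (has_partials_coords (u:=v) dth) (has_partials_coords (u:=w) dth)).
rewrite trilinear_along_cst add0r.
rewrite !(adapted_trilinear _ _ _ (adapted_cim Vx) (adapted_on_at Vx)) => ->.
rewrite /L !lie_mx_coords// -/T.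
rewrite trilinearDl (trilinearD2 _ _ _ _ s0) (trilinearD3 _ _ _ _ s0).
move: (trilinear _ _ _ _) (trilinear _ _ _ _) (trilinear _ _ _ _)
  (trilinear _ _ _ _) (trilinear _ _ _ _) (trilinear _ _ _ _) => *.
ring.
Qed.

(** The two previous identities say that the matrix by which X_s acts on the
    coframe is skew and stabilises the cubic form. *)
Lemma lie_adapted s x : V x -> exists u : 'I_3 -> R,
  lie_mx a th s x = (\sum_t u t *: Emx t) *m coframe_mx th x.
Proof.
move=> Vx; set Th := coframe_mx th x; set L := lie_mx a th s x.
have uT : Th \in unitmx := adapted_unit Vx.
have uTt : Th^T \in unitmx by rewrite unitmx_tr.
pose A := L *m invmx Th.
have LE : L = A *m Th by rewrite /A mulmxKV.
clearbody A.
have eT i : (delta_mx 0 i : 'rV[R]_5) *m invmx Th^T *m Th^T = delta_mx 0 i.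
  by rewrite mulmxKV.
have eL i : (delta_mx 0 i : 'rV[R]_5) *m invmx Th^T *m L^T = delta_mx 0 i *m A^T.
  by rewrite LE trmx_mul mulmxA eT.
have [] := @so3_stabiliser R A; [| |by move=> u AE; exists u; rewrite -AE].
- apply/eqP; rewrite -subr_eq0 opprK; apply/eqP; apply: bilinear_eq0 => u v.
  have := lie_mx_metric s (u *m invmx Th^T) (v *m invmx Th^T) Vx.
  rewrite -/Th -/L !mulmxKV// LE !trmx_mul !mulmxA !mulmxKV// !bilinearE !mulmx1.
  by rewrite trmx_mul trmxK mulmxA mulmxDr mulmxDl => H; rewrite [LHS]mxE.
- move=> i j k.
  have := lie_mx_ups s (delta_mx 0 i *m invmx Th^T)
    (delta_mx 0 j *m invmx Th^T) (delta_mx 0 k *m invmx Th^T) Vx.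
  rewrite /= -/Th -/L !eT !eL.
  have s0 := ups0_sym.
  rewrite trilinear_deltal (trilinear_swap12 _ (_ *m _) _ s0) trilinear_deltal.
  rewrite (trilinear_swap23 _ _ (_ *m _) s0) (trilinear_swap12 _ (_ *m _) _ s0).
  rewrite trilinear_deltal -!big_split /= => H; apply: etrans H.
  apply: eq_bigr => l _; rewrite -!rowE !mxE.
  have [-> _] := s0 i l k; have [_ ->] := s0 i j l; have [-> _] := s0 i l j.
  by [].
Qed.

(** The structure equations: the brackets of the symmetries, read in the
    coframe, differ from d theta by the rotations with which they act on it. *)
Lemma structure_equation s t i x : V x ->
  bilinear (ext_d (th i) x) (X s a x) (X t a x) =
    pair (lie_form (X s a) (th i) x) (X t a x)
    - pair (lie_form (X t a) (th i) x) (X s a x)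
    + \sum_u c s t u * pair (th i x) (X u a x).
Proof.
move=> Vx; rewrite ext_d_fields (field_closed hG s t (adapted_cim Vx)).
congr (_ + _); rewrite /pair.
under eq_bigr => m _ do rewrite summxE mulr_sumr.
rewrite exchange_big; apply: eq_bigr => u _ /=; rewrite mulr_sumr.
by apply: eq_bigr => m _; rewrite mxE mulrCA.
Qed.

End AdaptedOn.
End Symmetries.

(** * Torsions of type Lambda2_3 *)

Section Hodge.
Variable R : realType.

(** Laplace expansion along the first row, on functions of indices: unlike the
    Leibniz formula, it computes. *)
Fixpoint det_fun (n : nat) (f : nat -> nat -> int) : int :=
  if n is n'.+1 then
    foldr (fun j acc => (if f 0%N j == 0 then 0 else
        f 0%N j * ((-1) ^+ j * det_fun n' (fun i k => f i.+1 (bump j k)))) + acc)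
      0 (iota 0 n'.+1)
  else 1.

Lemma det_funE n (f : nat -> nat -> int) :
  \det (\matrix_(i < n, j < n) (f i j)%:~R : 'M[R]_n) = (det_fun n f)%:~R.
Proof.
elim: n f => [|n IH] f; first by rewrite det_mx00.
rewrite (expand_det_row _ ord0) /cofactor.
have E : forall j : 'I_n.+1, (\matrix_(i < n.+1, k < n.+1) (f i k)%:~R : 'M[R]_n.+1) ord0 j *
   ((-1) ^+ ((ord0 : 'I_n.+1) + j) *
   \det (row' ord0 (col' j (\matrix_(i < n.+1, k < n.+1) (f i k)%:~R : 'M[R]_n.+1)))) =
   (if f 0%N j == 0 then 0 else
     f 0%N j * ((-1) ^+ (nat_of_ord j) * det_fun n (fun i k => f i.+1 (bump j k))))%:~R.
  move=> j; rewrite mxE; case: eqP => [->|_]; first by rewrite mul0r.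
  rewrite !rmorphM /= rmorphXn /= rmorphN1 -IH; congr (_ * (_ * _)).
  by congr (\det _); apply/matrixP => i k; rewrite !mxE.
rewrite (eq_bigr _ (fun j _ => E j)) -rmorph_sum /=; congr (_%:~R).
rewrite -(big_mkord xpredT (fun j => if f 0%N j == 0 then 0 else
  f 0%N j * ((-1) ^+ j * det_fun n (fun i k => f i.+1 (bump j k))))) /index_iota subn0.
by rewrite unlock.
Qed.

Definition sign5 (i j k l m : nat) : int :=
  det_fun 5 (fun r s => (nth 0%N [:: i; j; k; l; m] r == s)%:R).

Lemma levi_civita_sign5 (i j k l m : 'I_5) :
  levi_civita_symbol (nth o1 [:: i; j; k; l; m]) = (sign5 i j k l m)%:~R :> R.
Proof.
rewrite -det_funE; congr (\det _); apply/matrixP => r s; rewrite !mxE.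
rewrite -val_eqE /= (_ : val _ = nth 0%N [:: i : nat; j : nat; k : nat; l : nat; m : nat] r).
  by case: (_ == _).
by elim/ord5_ind: r.
Qed.

Definition alternating3 (T : 'I_5 -> 'I_5 -> 'I_5 -> R) : Prop :=
  forall i j k, T i j k = - T j i k /\ T i j k = - T i k j.

(** A linear combination that simplifies to its nonzero terms. *)
Fixpoint sparse_sum (zs : seq int) (ts : seq R) : R :=
  match zs, ts with
  | z :: zs', t :: ts' =>
    if z is Posz 0 then sparse_sum zs' ts' else z%:~R * t + sparse_sum zs' ts'
  | _, _ => 0
  end.

Lemma sparse_sumE (I : Type) (s : seq I) (f : I -> int) (F : I -> R) :
  sparse_sum [seq f x | x <- s] [seq F x | x <- s] = \sum_(x <- s) (f x)%:~R * F x.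
Proof.
elim: s => [|x s IH] /=; first by rewrite big_nil.
by rewrite big_cons IH; case: (f x) => [[|n]|n]; rewrite // mul0r add0r.
Qed.

Let indices : seq 'I_5 := [:: o1; o2; o3; o4; o5].

Let triples : seq ('I_5 * 'I_5 * 'I_5) :=
  [seq (p, k) | p <- [seq (i, j) | i <- indices, j <- indices], k <- indices].

Lemma hodge3E T l m : hodge3 T l m = 6^-1 * sparse_sum
  [seq sign5 t.1.1 t.1.2 t.2 l m | t : 'I_5 * 'I_5 * 'I_5 <- triples]
  [seq T t.1.1 t.1.2 t.2 | t <- triples].
Proof.
have sumE (F : 'I_5 -> R) : \sum_i F i = \sum_(i <- indices) F i.
  by rewrite sum5 /indices !big_cons big_nil addr0 !addrA.
rewrite mxE sparse_sumE /triples big_allpairs_dep big_allpairs_dep; congr (_ * _).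
rewrite sumE; apply: eq_bigr => i _; rewrite sumE; apply: eq_bigr => j _.
rewrite sumE; apply: eq_bigr => k _.
by rewrite levi_civita_sign5.
Qed.

(* Six of the 125 signs of the sum are nonzero. *)
Ltac hodge_terms := rewrite hodge3E; match goal with |- context [sparse_sum ?zs _] =>
  let v := eval vm_compute in zs in
  rewrite (_ : zs = v); last by vm_compute end; rewrite /= /intmul /= ?mulr1n.

(** Each component of the dual is the complementary component of the 3-form,
    up to the sign of a permutation. *)
Lemma hodge3_table T : alternating3 T ->
  [/\ hodge3 T o1 o2 = T o3 o4 o5, hodge3 T o1 o3 = - T o2 o4 o5,
      hodge3 T o1 o4 = T o2 o3 o5, hodge3 T o1 o5 = - T o2 o3 o4 &
  [/\ hodge3 T o2 o3 = T o1 o4 o5, hodge3 T o2 o4 = - T o1 o3 o5,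
      hodge3 T o2 o5 = T o1 o3 o4, hodge3 T o3 o4 = T o1 o2 o5 &
      hodge3 T o3 o5 = - T o1 o2 o4 /\ hodge3 T o4 o5 = T o1 o2 o3]].
Proof.
move=> aT.
have six (i j k : 'I_5) : [/\ T j i k = - T i j k, T i k j = - T i j k,
    T j k i = T i j k, T k i j = T i j k & T k j i = - T i j k].
  have [a1 a2] := aT i j k; have [b1 b2] := aT j i k.
  have [c1 c2] := aT k i j; have [d1 d2] := aT i k j.
  by split; lra.
split; [| | | |split; [| | | |split]]; hodge_terms.
- have [-> -> -> -> ->] := six o3 o4 o5; by field.
- have [-> -> -> -> ->] := six o2 o4 o5; by field.
- have [-> -> -> -> ->] := six o2 o3 o5; by field.
- have [-> -> -> -> ->] := six o2 o3 o4; by field.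
- have [-> -> -> -> ->] := six o1 o4 o5; by field.
- have [-> -> -> -> ->] := six o1 o3 o5; by field.
- have [-> -> -> -> ->] := six o1 o3 o4; by field.
- have [-> -> -> -> ->] := six o1 o2 o5; by field.
- have [-> -> -> -> ->] := six o1 o2 o4; by field.
- have [-> -> -> -> ->] := six o1 o2 o3; by field.
Qed.

Lemma alternating3_ext T T' : alternating3 T -> alternating3 T' ->
  (forall i j k : 'I_5, (i < j < k)%N -> T i j k = T' i j k) ->
  forall i j k, T i j k = T' i j k.
Proof.
move=> aT aT' E.
have diag U i k : alternating3 U -> U i i k = 0.
  by move=> aU; have [h _] := aU i i k; lra.
have diag' U i k : alternating3 U -> U i k k = 0.
  by move=> aU; have [_ h] := aU i k k; lra.
have step (i j k : 'I_5) : (i < j)%N -> T i j k = T' i j k.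
  move=> ij; case: (ltngtP j k) => [jk|kj|/val_inj ->]; last by rewrite !diag'.
    by apply: E; rewrite ij.
  have [_ ->] := aT i j k; have [_ ->] := aT' i j k; congr (- _).
  case: (ltngtP i k) => [ik|ki|/val_inj ->]; last by rewrite !diag.
    by apply: E; rewrite ik.
  have [-> _] := aT i k j; have [-> _] := aT' i k j; congr (- _).
  by apply: E; rewrite ki.
move=> i j k; case: (ltngtP i j) => [|ji|/val_inj ->]; last by rewrite !diag.
  exact: step.
by have [-> _] := aT i j k; have [-> _] := aT' i j k; rewrite step.
Qed.

Lemma tau_alternating (u0 u1 u2 : R) :
  alternating3 (fun i j k : 'I_5 => tau u0 u1 u2 i j k).
Proof.
by elim/ord5_ind; elim/ord5_ind; elim/ord5_ind; split; rewrite /= ?opprK ?oppr0.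
Qed.

(** The ten independent components of T are those of its Hodge dual. *)
Lemma torsion_of_hodge T : alternating3 T -> in_Lambda2_3 (hodge3 T) ->
  exists u : 'I_3 -> R,
    forall i j k : 'I_5, T i j k = tau (u q1) (u q2) (u q3) i j k.
Proof.
move=> aT [u E]; exists u; apply: alternating3_ext => //.
  exact: tau_alternating.
have t l m : hodge3 T l m =
    u q1 * E_coef 0 l m + u q2 * E_coef 1 l m + u q3 * E_coef 2 l m.
  by rewrite E E_combE.
have [] := hodge3_table aT; rewrite !t /= => e1 e2 e3 e4 [] e5 e6 e7 e8 [e9 e10].
elim/ord5_ind; elim/ord5_ind; elim/ord5_ind => //= _; lra.
Qed.

End Hodge.

(** * The symmetry algebra at a point *)

Section AtAPoint.
Variables (R : realType) (M : manifold R) (S : so3_structure M).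
Variables (c : 'I_5 -> 'I_5 -> 'I_5 -> R).
Variables (X : 'I_5 -> chart M -> 'rV[R]_5 -> 'rV[R]_5).
Hypothesis hG : transitive_symmetry_algebra S c X.
Implicit Types (a b : chart M) (x u v w : 'rV[R]_5) (th : 'I_5 -> 'rV[R]_5 -> 'rV[R]_5).

Definition sym_mx a x : 'M[R]_5 := \matrix_s X s a x.

Lemma sym_mx_unit a x : cim a x -> sym_mx a x \in unitmx.
Proof. exact: (field_transitive hG). Qed.

Lemma sym_mx_inj a x (k : 'I_5 -> R) : cim a x ->
  \sum_i k i *: X i a x = 0 -> forall i, k i = 0.
Proof.
move=> ax E j.
have : (\row_i k i) *m sym_mx a x = 0.
  rewrite mulmx_sum_row -[RHS]E; apply: eq_bigr => i _.
  by rewrite rowK mxE.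
move=> /(congr1 (mulmx^~ (invmx (sym_mx a x)))).
rewrite mulmxK ?sym_mx_unit// mul0mx => /rowP/(_ j).
by rewrite !mxE.
Qed.

Lemma structure_constants_skew a x : cim a x ->
  forall s t i, c s t i = - c t s i.
Proof.
move=> ax s t i; apply/eqP; rewrite -addr_eq0; apply/eqP; move: i.
apply: (sym_mx_inj ax); under eq_bigr => i _ do rewrite scalerDl.
rewrite big_split /= -!(field_closed hG)// !field_bracket_along.
by rewrite addrC subrKA subrr.
Qed.

(** The derivatives of the components of the fields make up the bracket, as
    the second derivatives of f cancel. *)
Lemma along_comm V (Z W : 'rV[R]_5 -> 'rV[R]_5) (f : 'rV[R]_5 -> R) x :
  open V -> V x -> smooth_row V Z -> smooth_row V W -> smooth_on V f ->
  along (Z x) (fun y => along (W y) f y) x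
  - along (W x) (fun y => along (Z y) f y) x = along (field_bracket Z W x) f x.
Proof.
move=> oV Vx sZ sW sf.
have E (P Q : 'rV[R]_5 -> 'rV[R]_5) : smooth_row V Q ->
   along (P x) (fun y => along (Q y) f y) x =
   \sum_n along (P x) (fun y => Q y 0 n) x * partial n f x
   + \sum_m \sum_n P x 0 m * Q x 0 n * partial m (partial n f) x.
  move=> sQ; rewrite {2}/along.
  have d1 n : has_partials (fun y => Q y 0 n) x.
    exact: smooth_has_partials (sQ n) Vx.
  have d2 n : has_partials (partial n f) x.
    exact: smooth_has_partials (smooth_partial n sf) Vx.
  rewrite along_sum => [|n]; last exact: has_partialsM.
  under eq_bigr => n _ do rewrite (alongM _ (d1 n) (d2 n)).
  rewrite big_split; congr (_ + _); rewrite exchange_big; apply: eq_bigr => n _ /=.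
  rewrite /along mulr_sumr; apply: eq_bigr => m _.
  by rewrite mulrA [P x 0 m * _]mulrC.
rewrite E// E// opprD addrACA [X in _ + X = _](_ : _ = 0) ?addr0; last first.
  rewrite [X in _ - X]exchange_big -sumrB big1// => m _; rewrite -sumrB big1// => n _.
  by rewrite (partial_comm m n oV sf Vx) /= [W x 0 n * _]mulrC subrr.
rewrite -sumrB {3}/along; apply: eq_bigr => n _.
by rewrite field_bracket_along !mxE mulrBl.
Qed.

(** The Jacobi identity: second derivatives cancel by their symmetry. *)
Lemma structure_constants_jacobi a x : cim a x -> jacobi_identity c.
Proof.
move=> ax; apply/jacobiP; have oU : open (cim a) by exact: cim_open.
have sk := structure_constants_skew ax.
have sX s : smooth_row (cim a) (X s a) by exact: (field_smooth hG).
pose L s (f : 'rV[R]_5 -> R) y := along (X s a y) f y.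
have cl s t k y : cim a y ->
    L s (fun z => X t a z 0 k) y - L t (fun z => X s a z 0 k) y =
    \sum_i c s t i * X i a y 0 k.
  move=> ay; have /rowP/(_ k) := field_closed hG s t ay.
  rewrite field_bracket_along !mxE summxE => ->.
  by apply: eq_bigr => i _; rewrite mxE.
have sL s t k : smooth_on (cim a) (L s (fun z => X t a z 0 k)).
  apply: smooth_sum => // m; apply: smoothM => //; first exact: sX.
  exact/smooth_partial/sX.
have cc r s t k : L r (L s (fun z => X t a z 0 k)) x - L s (L r (fun z => X t a z 0 k)) x
    = \sum_i c r s i * L i (fun z => X t a z 0 k) x.
  rewrite (along_comm oU ax (sX r) (sX s) (sX t k)) (field_closed hG)//.
  rewrite /L /along; under eq_bigr => m _ do rewrite summxE mulr_suml.
  rewrite exchange_big; apply: eq_bigr => i _ /=; rewrite mulr_sumr.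
  by apply: eq_bigr => m _; rewrite mxE mulrA.
have dc r s t k : L t (L r (fun z => X s a z 0 k)) x - L t (L s (fun z => X r a z 0 k)) x
    = \sum_i c r s i * L t (fun z => X i a z 0 k) x.
  have p1 := smooth_has_partials (sL r s k) ax.
  have p2 := smooth_has_partials (sL s r k) ax.
  have p3 i := smooth_has_partials (sX i k) ax.
  transitivity (along (X t a x) (fun y => L r (fun z => X s a z 0 k) y
       + (-1) * L s (fun z => X r a z 0 k) y) x).
    rewrite (alongD _ p1 (has_partialsM (@has_partials_cst R (-1) x) p2)).
    by rewrite (alongM _ (@has_partials_cst R (-1) x) p2) along_cst mul0r add0r mulN1r.
  rewrite (along_ext (g := fun y => \sum_i c r s i * X i a y 0 k) _ oU ax).
    rewrite along_sum => [|i]; last exact: has_partialsM (@has_partials_cst R _ x) (p3 i).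
    apply: eq_bigr => i _.
    by rewrite (alongM _ (@has_partials_cst R _ x) (p3 i)) along_cst mul0r add0r.
  by move=> y ay; rewrite mulN1r cl.
move=> r s t; apply: (sym_mx_inj ax); apply/rowP => k; rewrite summxE mxE.
have two p q m : \sum_i c p q i * L i (fun z => X m a z 0 k) x
   - \sum_i c p q i * L m (fun z => X i a z 0 k) x =
   \sum_v (\sum_i c p q i * c i m v) * X v a x 0 k.
  rewrite -sumrB; under eq_bigr => i _ do rewrite -mulrBr cl// mulr_sumr.
  rewrite exchange_big; apply: eq_bigr => v _ /=; rewrite mulr_suml.
  by apply: eq_bigr => i _; rewrite mulrA.
under eq_bigr => v _ do rewrite mxE !big_split /= !mulrDl.
rewrite !big_split /= -!two -!cc -!dc.
move: (L _ _ x) (L _ _ x) (L _ _ x) (L _ _ x) (L _ _ x) (L _ _ x) => *.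
ring.
Qed.

End AtAPoint.

(** * Rotations of the frame *)

Section Rotations.
Variable R : realType.
Implicit Types (u v w : 'rV[R]_5) (O : 'M[R]_5) (a b g : 'I_5 -> R).

Definition Emat (t0 t1 t2 : R) : 'M[R]_5 :=
  \matrix_(i, j) (t0 * E_coef 0 i j + t1 * E_coef 1 i j + t2 * E_coef 2 i j).

(** The so(3)-valued 1-form with components a, b, g along E_1, E_2, E_3. *)
Definition so3_form a b g u : 'M[R]_5 := \sum_j u 0 j *: Emat (a j) (b j) (g j).

Lemma frame_bracketE a b g t0 t1 t2 u v i :
  bracket_of (frame_bracket a b g t0 t1 t2) u v 0 i =
    trilinear (fun i j k => tau t0 t1 t2 i j k) (delta_mx 0 i) u v
    - (v *m (so3_form a b g u)^T) 0 i + (u *m (so3_form a b g v)^T) 0 i.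
Proof.
have F p q : (q *m (so3_form a b g p)^T) 0 i = \sum_j \sum_k p 0 j * q 0 k *
    (a j * E_coef 0 i k + b j * E_coef 1 i k + g j * E_coef 2 i k).
  rewrite mxE exchange_big; apply: eq_bigr => k _ /=.
  rewrite mxE summxE mulr_sumr; apply: eq_bigr => j _.
  by rewrite !mxE mulrCA mulrA.
rewrite !F.
have -> : trilinear (fun i j k => tau t0 t1 t2 i j k) (delta_mx 0 i) u v =
    \sum_j \sum_k u 0 j * v 0 k * tau t0 t1 t2 i j k.
  rewrite /trilinear (bigD1 i)//= [X in _ + X]big1 ?addr0 => [|i' ii]; last first.
    rewrite big1 // => j' _; rewrite big1 // => k' _.
    by rewrite mxE (negbTE ii) andbF mulr0 !mul0r.
  apply: eq_bigr => j _; apply: eq_bigr => k _.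
  rewrite [delta_mx _ _ _ _]mxE !eqxx mulr1.
  by move: (tau _ _ _ _ _ _) (u 0 j) (v 0 k) => *; ring.
rewrite [X in _ = _ + X]exchange_big -sumrB -big_split mxE; apply: eq_bigr => j _ /=.
rewrite -sumrB -big_split; apply: eq_bigr => k _ /=.
rewrite /frame_bracket mulrDr mulrBr; congr (_ + _).
by rewrite [v 0 k * _]mulrC.
Qed.

Lemma trilinear_perm12 (Y : 'I_5 -> 'I_5 -> 'I_5 -> R) u v w :
  trilinear Y u v w = trilinear (fun i j k => Y j i k) v u w.
Proof.
rewrite /trilinear exchange_big; apply: eq_bigr => i _; apply: eq_bigr => j _.
by apply: eq_bigr => k _; rewrite [in LHS](mulrAC _ (u 0 j)).
Qed.

Lemma trilinear_perm23 (Y : 'I_5 -> 'I_5 -> 'I_5 -> R) u v w :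
  trilinear Y u v w = trilinear (fun i j k => Y i k j) u w v.
Proof.
rewrite /trilinear; apply: eq_bigr => i _; rewrite exchange_big.
by apply: eq_bigr => j _; apply: eq_bigr => k _; rewrite mulrAC.
Qed.

Lemma trilinear_rowl (Y : 'I_5 -> 'I_5 -> 'I_5 -> R) O u v w :
  trilinear Y (u *m O) v w = \sum_i u 0 i * trilinear Y (row i O) v w.
Proof.
rewrite mulmx_sum_row trilinear_suml; apply: eq_bigr => i _.
by rewrite trilinearZl.
Qed.

Lemma trilinear_change (Y : 'I_5 -> 'I_5 -> 'I_5 -> R) O u v w :
  trilinear Y (u *m O) (v *m O) (w *m O) =
  trilinear (fun i j k => trilinear Y (row i O) (row j O) (row k O)) u v w.
Proof.
rewrite trilinear_rowl; apply: eq_bigr => i _.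
rewrite trilinear_perm12 trilinear_rowl mulr_sumr; apply: eq_bigr => j _.
rewrite -trilinear_perm12 trilinear_perm23 trilinear_perm12 trilinear_rowl !mulr_sumr.
apply: eq_bigr => k _; rewrite -trilinear_perm12 -trilinear_perm23.
move: (trilinear _ _ _ _) => t.
by move: (u 0 i) (v 0 j) (w 0 k) => *; ring.
Qed.

Definition in_SO3 O : Prop :=
  O *m O^T = 1%:M /\ forall z : 'rV[R]_5, ups0_form (z *m O^T) = ups0_form z.

(** Compatibility of a rotation of R^5 with the map m of so(3) that it induces:
    m gives the action both on so(3) and on the torsions of type Lambda2_3. *)
Definition induces O (m0 m1 m2 : R -> R -> R -> R) : Prop :=
  [/\ O^T *m O = 1%:M,
      forall t0 t1 t2, O *m Emat t0 t1 t2 *m O^T =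
        Emat (m0 t0 t1 t2) (m1 t0 t1 t2) (m2 t0 t1 t2) &
      forall t0 t1 t2 (i j k : 'I_5),
        trilinear (fun i j k => tau t0 t1 t2 i j k) (row i O) (row j O) (row k O) =
        tau (m0 t0 t1 t2) (m1 t0 t1 t2) (m2 t0 t1 t2) i j k].

Lemma induces_intertwines O m0 m1 m2 a b g t0 t1 t2 : induces O m0 m1 m2 ->
  exists a' b' g' : 'I_5 -> R,
    intertwines O^T (frame_bracket a b g t0 t1 t2)
      (frame_bracket a' b' g' (m0 t0 t1 t2) (m1 t0 t1 t2) (m2 t0 t1 t2)).
Proof.
move=> [oO hE hT].
pose at_row (f : 'I_5 -> R) j := \sum_l O j l * f l.
exists (fun j => m0 (at_row a j) (at_row b j) (at_row g j)).
exists (fun j => m1 (at_row a j) (at_row b j) (at_row g j)).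
exists (fun j => m2 (at_row a j) (at_row b j) (at_row g j)).
set a' := fun j => m0 _ _ _; set b' := fun j => m1 _ _ _; set g' := fun j => m2 _ _ _.
have phiE u : so3_form a' b' g' (u *m O^T) = O *m so3_form a b g u *m O^T.
  have -> : so3_form a b g u = \sum_j (u *m O^T) 0 j *:
      Emat (at_row a j) (at_row b j) (at_row g j).
    apply/matrixP => p q; rewrite !summxE.
    have E j : ((u *m O^T) 0 j *: Emat (at_row a j) (at_row b j) (at_row g j)) p q =
       \sum_l (u *m O^T) 0 j * O j l * Emat (a l) (b l) (g l) p q.
      rewrite mxE [Emat _ _ _ _ _]mxE /at_row !mulr_suml -!big_split mulr_sumr.
      apply: eq_bigr => l _; rewrite [Emat _ _ _ _ _]mxE /=.
      move: ((u *m O^T) 0 j) (O j l) (a l) (b l) (g l) => *; ring.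
    under [RHS]eq_bigr => j _ do rewrite E.
    rewrite exchange_big; apply: eq_bigr => l _; rewrite mxE -mulr_suml; congr (_ * _).
    transitivity ((u *m O^T *m O) 0 l); first by rewrite -mulmxA oO mulmx1.
    by rewrite mxE.
  rewrite mulmx_sumr mulmx_suml; apply: eq_bigr => j _.
  by rewrite -scalemxAr -scalemxAl hE.
have uO u : u *m O^T *m O = u by rewrite -mulmxA oO mulmx1.
move=> u v; apply/rowP => i; rewrite frame_bracketE !phiE.
have swing (p q : 'rV[R]_5) : q *m O^T *m (O *m so3_form a b g p *m O^T)^T =
    q *m (so3_form a b g p)^T *m O^T.
  by rewrite trmx_mul trmxK [(O *m _)^T]trmx_mul !mulmxA uO.
rewrite !swing.
set F := frame_bracket a b g t0 t1 t2.
have -> : bracket_of F u v = \row_l trilinear (fun i j k => tau t0 t1 t2 i j k) (delta_mx 0 l) u v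
   - v *m (so3_form a b g u)^T + u *m (so3_form a b g v)^T.
  by apply/rowP => l; rewrite frame_bracketE !mxE.
rewrite !mulmxDl mulNmx [LHS]mxE; congr (_ + _); rewrite [LHS]mxE; congr (_ + _); last first.
  by rewrite [LHS]mxE.
transitivity (trilinear (fun i j k => tau t0 t1 t2 i j k) (row i O) u v).
  rewrite mxE [row i O]row_sum_delta trilinear_suml; apply: eq_bigr => l _.
  by rewrite trilinearZl !mxE mulrC.
rewrite -[in LHS](uO u) -[in LHS](uO v) rowE trilinear_change.
apply: eq_bigr => p _; apply: eq_bigr => q _; apply: eq_bigr => r _.
by rewrite hT.
Qed.

Definition rot3_coef (c s : R) (i j : nat) : R :=
  match i, j with
  | 0, 0 => 1
  | 1, 1 | 3, 3 => c ^+ 2 - s ^+ 2 | 1, 3 => 2 * c * s | 3, 1 => - (2 * c * s)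
  | 2, 2 | 4, 4 => c | 2, 4 => s | 4, 2 => - s
  | _, _ => 0
  end.

Definition rot1_coef (c s : R) (i j : nat) : R :=
  let C := c ^+ 2 - s ^+ 2 in let S := 2 * c * s in
  match i, j with
  | 0, 0 => (3 * C + 1) / 4 | 0, 3 | 3, 0 => sq3 * (C - 1) / 4
  | 3, 3 => (C + 3) / 4
  | 0, 4 => sq3 / 2 * S | 4, 0 => - (sq3 / 2 * S)
  | 3, 4 => S / 2 | 4, 3 => - (S / 2) | 4, 4 => C
  | 1, 1 | 2, 2 => c | 1, 2 => s | 2, 1 => - s
  | _, _ => 0
  end.

(** The rotations generated by E_3 and E_1, with (c, s) = (cos t, sin t). *)
Definition rot3 (c s : R) : 'M[R]_5 := \matrix_(i, j) rot3_coef c s i j.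
Definition rot1 (c s : R) : 'M[R]_5 := \matrix_(i, j) rot1_coef c s i j.

Lemma rot3_row c s i j : row i (rot3 c s) 0 j = rot3_coef c s i j.
Proof. by rewrite !mxE. Qed.

Lemma rot1_row c s i j : row i (rot1 c s) 0 j = rot1_coef c s i j.
Proof. by rewrite !mxE. Qed.

Lemma rot_orthogonal O : O *m O^T = 1%:M -> O^T *m O = 1%:M.
Proof. exact: mulmx1C. Qed.

Lemma rot3_orthogonal (c s : R) : c ^+ 2 = 1 - s ^+ 2 -> rot3 c s *m (rot3 c s)^T = 1%:M.
Proof.
move=> cs; apply/matrixP => i j; rewrite !mxE sum5 !mxE.
elim/ord5_ind: i; elim/ord5_ind: j; rewrite /=; ring: cs.
Qed.

Lemma rot1_orthogonal (c s : R) : c ^+ 2 = 1 - s ^+ 2 -> rot1 c s *m (rot1 c s)^T = 1%:M.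
Proof.
move=> cs; apply/matrixP => i j; rewrite !mxE sum5 !mxE.
elim/ord5_ind: i; elim/ord5_ind: j; rewrite /=; by field: cs (sqrt3_sq R).
Qed.

Definition minor3 u v w (i j k : 'I_5) : R :=
  u 0 i * (v 0 j * w 0 k - v 0 k * w 0 j) - u 0 j * (v 0 i * w 0 k - v 0 k * w 0 i)
  + u 0 k * (v 0 i * w 0 j - v 0 j * w 0 i).

(** Written with minors, the form is visibly the 3-form it encodes; on rows of
    a rotation matrix the minors are computed entry by entry. *)
Lemma trilinear_tau t0 t1 t2 u v w :
  trilinear (fun i j k => tau t0 t1 t2 i j k) u v w =
    t0 * (minor3 u v w o1 o2 o3 + minor3 u v w o1 o4 o5 - sq3 * minor3 u v w o2 o3 o4)
    + t1 * (minor3 u v w o1 o2 o5 + minor3 u v w o1 o3 o4 - sq3 * minor3 u v w o2 o4 o5)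
    - t2 * (minor3 u v w o1 o2 o4 + 2 * minor3 u v w o1 o3 o5).
Proof.
rewrite /trilinear !sum5 /= /minor3.
move: (u 0 o1) (u 0 o2) (u 0 o3) (u 0 o4) (u 0 o5) => u1 u2 u3 u4 u5.
move: (v 0 o1) (v 0 o2) (v 0 o3) (v 0 o4) (v 0 o5) => v1 v2 v3 v4 v5.
move: (w 0 o1) (w 0 o2) (w 0 o3) (w 0 o4) (w 0 o5) => w1 w2 w3 w4 w5.
ring.
Qed.

Lemma trilinear_rows_alternating (Y : 'I_5 -> 'I_5 -> 'I_5 -> R) O :
  alternating3 Y ->
  alternating3 (fun i j k => trilinear Y (row i O) (row j O) (row k O)).
Proof.
have opp (Z Z' : 'I_5 -> 'I_5 -> 'I_5 -> R) u v w :
    (forall i j k, Z i j k = - Z' i j k) -> trilinear Z u v w = - trilinear Z' u v w.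
  move=> ZZ; rewrite /trilinear -sumrN; apply: eq_bigr => i _.
  rewrite -sumrN; apply: eq_bigr => j _; rewrite -sumrN; apply: eq_bigr => k _.
  by rewrite ZZ !mulNr.
move=> aY i j k; split.
  by rewrite trilinear_perm12; apply: opp => p q r; have [] := aY q p r.
by rewrite trilinear_perm23; apply: opp => p q r; have [] := aY p r q.
Qed.

Lemma rot3_SO3 (c s : R) : c ^+ 2 = 1 - s ^+ 2 -> in_SO3 (rot3 c s).
Proof.
move=> cs; split=> [|z]; first exact: rot3_orthogonal.
have E i : (z *m (rot3 c s)^T) 0 i = \sum_j z 0 j * rot3 c s i j.
  by rewrite mxE; apply: eq_bigr => j _; rewrite [_^T _ _]mxE.
rewrite /ups0_form !E !sum5 !mxE /= -[Num.sqrt 3]/(@sq3 R).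
move: (z 0 o1) (z 0 o2) (z 0 o3) (z 0 o4) (z 0 o5) => z1 z2 z3 z4 z5.
by field: cs.
Qed.

Lemma rot1_SO3 (c s : R) : c ^+ 2 = 1 - s ^+ 2 -> in_SO3 (rot1 c s).
Proof.
move=> cs; split=> [|z]; first exact: rot1_orthogonal.
have E i : (z *m (rot1 c s)^T) 0 i = \sum_j z 0 j * rot1 c s i j.
  by rewrite mxE; apply: eq_bigr => j _; rewrite [_^T _ _]mxE.
rewrite /ups0_form !E !sum5 !mxE /= -[Num.sqrt 3]/(@sq3 R).
move: (z 0 o1) (z 0 o2) (z 0 o3) (z 0 o4) (z 0 o5) => z1 z2 z3 z4 z5.
by field: cs (sqrt3_sq R).
Qed.

Lemma rot3_induces (c s : R) : c ^+ 2 = 1 - s ^+ 2 ->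
  induces (rot3 c s) (fun t0 t1 _ => c * t0 - s * t1)
    (fun t0 t1 _ => s * t0 + c * t1) (fun _ _ t2 => t2).
Proof.
move=> cs; split=> [|t0 t1 t2|t0 t1 t2].
- exact/rot_orthogonal/rot3_orthogonal.
- apply/matrixP => i j.
  have E : (rot3 c s *m Emat t0 t1 t2 *m (rot3 c s)^T) i j =
      \sum_k (\sum_l rot3 c s i l * Emat t0 t1 t2 l k) * rot3 c s j k.
    by rewrite mxE; apply: eq_bigr => k _; rewrite mxE [_^T _ _]mxE.
  rewrite {}E !sum5 !mxE; elim/ord5_ind: i; elim/ord5_ind: j; rewrite /=; ring: cs.
- apply: alternating3_ext.
  + exact/trilinear_rows_alternating/tau_alternating.
  + exact: tau_alternating.
  + by elim/ord5_ind; elim/ord5_ind; elim/ord5_ind => //= _;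
      rewrite trilinear_tau /minor3 !rot3_row /=; ring: cs.
Qed.

Lemma rot1_induces (c s : R) : c ^+ 2 = 1 - s ^+ 2 ->
  induces (rot1 c s) (fun t0 _ _ => t0) (fun _ t1 t2 => c * t1 - s * t2)
    (fun _ t1 t2 => s * t1 + c * t2).
Proof.
move=> cs; have s3 := sqrt3_sq R; split=> [|t0 t1 t2|t0 t1 t2].
- exact/rot_orthogonal/rot1_orthogonal.
- apply/matrixP => i j.
  have E : (rot1 c s *m Emat t0 t1 t2 *m (rot1 c s)^T) i j =
      \sum_k (\sum_l rot1 c s i l * Emat t0 t1 t2 l k) * rot1 c s j k.
    by rewrite mxE; apply: eq_bigr => k _; rewrite mxE [_^T _ _]mxE.
  rewrite {}E !sum5 !mxE; elim/ord5_ind: i; elim/ord5_ind: j; rewrite /=; by field: cs s3.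
- apply: alternating3_ext.
  + exact/trilinear_rows_alternating/tau_alternating.
  + exact: tau_alternating.
  + by elim/ord5_ind; elim/ord5_ind; elim/ord5_ind => //= _;
      rewrite trilinear_tau /minor3 !rot1_row /=; by field: cs s3.
Qed.

End Rotations.

(** * Standard frames *)

Section StandardFrame.
Variable R : realType.
Implicit Types (O P : 'M[R]_5).

(** The rotation of the plane taking (x, y) to the second half-axis. *)
Lemma cos_sin_alignment (x y : R) : exists c s : R,
  [/\ c ^+ 2 = 1 - s ^+ 2, c * x - s * y = 0 &
      s * x + c * y = Num.sqrt (x ^+ 2 + y ^+ 2)].
Proof.
set r := Num.sqrt _; have r2 : r ^+ 2 = x ^+ 2 + y ^+ 2.
  by rewrite sqr_sqrtr// addr_ge0 ?sqr_ge0.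
have [r0|r0] := eqVneq r 0.
  move: r2; rewrite r0 expr0n /= => /esym/eqP.
  rewrite paddr_eq0 ?sqr_ge0// !sqrf_eq0 => /andP[/eqP -> /eqP ->].
  by exists 1, 0; split; ring.
exists (y / r), (x / r); split.
- by have -> : (y / r) ^+ 2 = 1 - (x / r) ^+ 2 by
    rewrite !expr_div_n -[1](divff (expf_neq0 2 r0)) r2 -mulrBl addrAC subrr add0r.
- by rewrite mulrAC -[y * x / r]mulrAC; ring.
- apply: (mulIf r0); rewrite -expr2 r2 mulrDl.
  by field.
Qed.

(** The rotation [rot3] acts through the double of its angle on the plane of
    theta^2, theta^4, where (x, y) lives. *)
Lemma half_angle (x y r : R) : 0 < r -> x ^+ 2 + y ^+ 2 = r ^+ 2 ->
  exists c s : R, [/\ c ^+ 2 = 1 - s ^+ 2, x = r * (c ^+ 2 - s ^+ 2) &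
    y = r * (2 * c * s)].
Proof.
move=> r0 E; have rn0 := lt0r_neq0 r0.
have xr : `|x| <= r.
  rewrite -(ler_pXn2r (n := 2)) ?nnegrE ?normr_ge0 ?(ltW r0)// real_normK ?num_real//.
  by have := sqr_ge0 y; move: E => ? ?; lra.
have d0 : 0 <= r + x by move: xr; rewrite ler_norml => /andP[h _]; lra.
have [rx0|rx0] := eqVneq (r + x) 0.
  exists 0, 1; have xE : x = - r by lra.
  have y0 : y = 0.
    by apply/eqP; rewrite -sqrf_eq0; apply/eqP; move: E; rewrite xE sqrrN; lra.
  by rewrite xE y0; split; ring.
pose c := Num.sqrt ((r + x) / (2 * r)).
have c2 : c ^+ 2 = (r + x) / (2 * r).
  by rewrite sqr_sqrtr// divr_ge0// mulr_ge0// (ltW r0).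
have cn0 : c != 0.
  by rewrite -sqrf_eq0 c2 mulf_neq0// invr_eq0 mulf_neq0.
have s2 : (y / (2 * r * c)) ^+ 2 = (r - x) / (2 * r).
  rewrite expr_div_n exprMn c2.
  have -> : y ^+ 2 = (r - x) * (r + x) by move: E => ?; rewrite -subr_sqr; lra.
  by field; rewrite rx0 rn0.
exists c, (y / (2 * r * c)); split.
- by rewrite s2 c2; field.
- by rewrite s2 c2; field.
- by field; rewrite rn0 cn0.
Qed.

Definition minor2 (u v : 'rV[R]_5) (i j : 'I_5) : R := u 0 i * v 0 j - u 0 j * v 0 i.

Lemma std_bracketE x y w del (u v : 'rV[R]_5) :
  let m := minor2 u v in let br := bracket_of (std_bracket x y w del) u v in
  [/\ br 0 o1 = - (2 / 3 * sq3 * w) * (m o2 o4 + (2 - 3 * del) * m o3 o5),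
      br 0 o2 = - (2 * x) * m o2 o4,
      br 0 o3 = - x * m o2 o5 + sq3 * w * (1 - del) * m o1 o5
        + w * del * m o2 o3 + (del * w - y) * m o4 o5,
      br 0 o4 = - (2 * y) * m o2 o4 &
      br 0 o5 = x * m o2 o3 + sq3 * w * (del - 1) * m o1 o3
        - w * del * m o2 o5 - (del * w + y) * m o3 o4].
Proof.
rewrite /= /bracket_of /minor2; split; rewrite mxE !sum5 /std_bracket /=;
  move: (u 0 o1) (u 0 o2) (u 0 o3) (u 0 o4) (u 0 o5) => u1 u2 u3 u4 u5;
  move: (v 0 o1) (v 0 o2) (v 0 o3) (v 0 o4) (v 0 o5) => v1 v2 v3 v4 v5; by field.
Qed.

(** The rotations about E_3 preserve a torsion along E_3 and shift the angle
    phi of the system; here the angle is brought to 0. *)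
Lemma std_bracket_rotate (r w del c s : R) : c ^+ 2 = 1 - s ^+ 2 ->
  intertwines (rot3 c s)^T
    (std_bracket (r * (c ^+ 2 - s ^+ 2)) (r * (2 * c * s)) w del)
    (std_bracket r 0 w del).
Proof.
move=> cs u v; apply/rowP.
have E (z : 'rV[R]_5) i : (z *m (rot3 c s)^T) 0 i = \sum_j z 0 j * rot3_coef c s i j.
  by rewrite mxE; apply: eq_bigr => j _; rewrite !mxE.
set C := std_bracket (r * _) _ _ _; set D := std_bracket r _ _ _.
have [b1 b2 b3 b4 b5] := std_bracketE (r * (c ^+ 2 - s ^+ 2)) (r * (2 * c * s)) w del u v.
have [d1 d2 d3 d4 d5] := std_bracketE r 0 w del (u *m (rot3 c s)^T) (v *m (rot3 c s)^T).
apply: ord5_ind; rewrite E !sum5 ?d1 ?d2 ?d3 ?d4 ?d5 /C b1 b2 b3 b4 b5 /minor2 !E !sum5 /=;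
  move: (u 0 o1) (u 0 o2) (u 0 o3) (u 0 o4) (u 0 o5) => u1 u2 u3 u4 u5;
  move: (v 0 o1) (v 0 o2) (v 0 o3) (v 0 o4) (v 0 o5) => v1 v2 v3 v4 v5; by field: cs.
Qed.

(** Up to a rotation of the frame, a Lie algebra with nonzero torsion of type
    Lambda2_3 is a standard one: two rotations bring the torsion on the axis
    E_3, the classification applies, and a last one kills the angle. *)
Lemma standard_frame P c a b g (t0 t1 t2 : R) : P \in unitmx ->
  jacobi_identity c -> intertwines P c (frame_bracket a b g t0 t1 t2) ->
  ~ [/\ t0 = 0, t1 = 0 & t2 = 0] ->
  exists O rho eps del,
    [/\ in_SO3 O, 0 < rho, eps = 1 \/ eps = -1, del = 0 \/ del = 1 &
        intertwines (P *m O^T) c (std_bracket rho 0 (rho * eps) del)].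
Proof.
move=> uP J H tn0.
have SO3_unit O : in_SO3 O -> O^T \in unitmx.
  by move=> [/mulmx1_unit[_ h] _].
have SO3_mul O O' : in_SO3 O -> in_SO3 O' -> in_SO3 (O' *m O).
  move=> [h1 h2] [k1 k2]; split=> [|z].
    by rewrite trmx_mul mulmxA -(mulmxA O') h1 mulmx1.
  by rewrite trmx_mul mulmxA k2 h2.
have [c1 [s1 [cs1 e0 e1]]] := cos_sin_alignment t0 t1.
have [a1 [b1 [g1 H1]]] := induces_intertwines a b g t0 t1 t2 (rot3_induces cs1).
move: H1; rewrite /= e0 e1; set r1 := Num.sqrt _ => H1.
have [c2 [s2 [cs2 f0 f1]]] := cos_sin_alignment r1 t2.
have [a2 [b2 [g2 H2]]] := induces_intertwines a1 b1 g1 0 r1 t2 (rot1_induces cs2).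
move: H2; rewrite /= f0 f1; set u := Num.sqrt _ => H2.
have u0 : u != 0.
  apply/eqP => u0; apply: tn0.
  have : r1 ^+ 2 + t2 ^+ 2 = 0.
    by rewrite -(sqr_sqrtr (addr_ge0 (sqr_ge0 _) (sqr_ge0 _))) -/u u0 expr0n.
  move=> /eqP; rewrite paddr_eq0 ?sqr_ge0// !sqrf_eq0 => /andP[/eqP r10 /eqP ->].
  have : t0 ^+ 2 + t1 ^+ 2 = 0.
    by rewrite -(sqr_sqrtr (addr_ge0 (sqr_ge0 _) (sqr_ge0 _))) -/r1 r10 expr0n.
  by move=> /eqP; rewrite paddr_eq0 ?sqr_ge0// !sqrf_eq0 => /andP[/eqP -> /eqP ->].
pose O2 := rot1 c2 s2 *m rot3 c1 s1.
have O2_SO3 : in_SO3 O2 by apply: SO3_mul; [exact: rot3_SO3|exact: rot1_SO3].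
have HP2 : intertwines (P *m O2^T) c (frame_bracket a2 b2 g2 0 0 u).
  rewrite trmx_mul mulmxA; apply: intertwines_trans H2.
  exact: intertwines_trans H H1.
have uP2 : P *m O2^T \in unitmx by rewrite unitmx_mul uP SO3_unit.
have J2 := (jacobiP _).1 (intertwines_jacobi uP2 HP2 J).
have [del hdel [xy E]] := jacobi_solutions u0 J2.
set w := sq3 / 2 * u in xy E; set x := g2 o2 in xy E; set y := g2 o4 in xy E.
have wn0 : w != 0 by rewrite mulf_neq0// mulf_neq0 ?invr_eq0 ?pnatr_eq0// lt0r_neq0 ?sqrt3_gt0.
have rho0 : 0 < `|w| by rewrite normr_gt0.
have xyr : x ^+ 2 + y ^+ 2 = `|w| ^+ 2 by rewrite real_normK ?num_real.
have [c3 [s3 [cs3 xE yE]]] := half_angle rho0 xyr.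
(* rho is the absolute value of w and epsilon its sign. *)
exists (rot3 c3 s3 *m O2), `|w|, (Num.sg w), del; split=> //.
- by apply: SO3_mul => //; exact: rot3_SO3.
- by case: (ltrgt0P w) wn0 => // ? _; [left; rewrite gtr0_sg|right; rewrite ltr0_sg].
- rewrite trmx_mul mulmxA mulrC -numEsg.
  apply: intertwines_trans (intertwines_eqr E HP2) _.
  by rewrite xE yE; exact: std_bracket_rotate.
Qed.

End StandardFrame.

(** * The brackets of the symmetries and the characteristic torsion *)

(* Keeps the coefficients folded at symbolic indices. *)
Local Arguments E_coef : simpl nomatch.

Section CharacteristicTorsion.
Variables (R : realType).
Implicit Types (x u v : 'rV[R]_5) (w : 'M[R]_5) (th : 'I_5 -> 'rV[R]_5 -> 'rV[R]_5).

Lemma frame_comp_bilinear th x w u v : coframe_mx th x \in unitmx ->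
  bilinear w u v =
  bilinear (frame_comp th x w) (u *m (coframe_mx th x)^T) (v *m (coframe_mx th x)^T).
Proof.
move=> uT; rewrite !bilinearE /frame_comp trmx_mul trmxK !mulmxA.
by rewrite -(mulmxA u (coframe_mx th x)^T) -trmx_mul mulVmx// trmx1 mulmx1 mulmxKV.
Qed.

Lemma bilinear_wedge (p q u v : 'rV[R]_5) :
  bilinear (wedge p q) u v = pair p u * pair q v - pair p v * pair q u.
Proof.
rewrite /pair !mulr_suml -sumrB /bilinear.
transitivity (\sum_m \sum_n (p 0 m * u 0 m * (q 0 n * v 0 n)) -
    \sum_m \sum_n (p 0 n * v 0 n * (q 0 m * u 0 m))).
  rewrite -sumrB; apply: eq_bigr => m _; rewrite -sumrB; apply: eq_bigr => n _.
  rewrite mxE; move: (p 0 m) (p 0 n) (q 0 m) (q 0 n) (u 0 m) (v 0 n) => *; ring.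
rewrite [X in _ - X]exchange_big -sumrB; apply: eq_bigr => m _.
by rewrite !mulr_sumr.
Qed.

Lemma bilinear_mxD (w w' : 'M[R]_5) u v :
  bilinear (w + w') u v = bilinear w u v + bilinear w' u v.
Proof. by rewrite !bilinearE mulmxDr mulmxDl mxE. Qed.

Lemma bilinear_mx_sum (I : Type) (r : seq I) (F : I -> 'M[R]_5) u v :
  bilinear (\sum_(i <- r) F i) u v = \sum_(i <- r) bilinear (F i) u v.
Proof.
elim: r => [|i r IH]; first by rewrite !big_nil bilinear_mx0.
by rewrite !big_cons bilinear_mxD IH.
Qed.

Lemma pair_conn (ga : 'I_3 -> 'rV[R]_5 -> 'rV[R]_5) i j x u :
  pair (conn_form ga i j x) u = \sum_(s < 3) E_coef s i j * pair (ga s x) u.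
Proof.
rewrite /pair /conn_form; under eq_bigr => m _ do rewrite summxE mulr_suml.
rewrite exchange_big; apply: eq_bigr => s _; rewrite mulr_sumr.
by apply: eq_bigr => m _; rewrite mxE EmxE mulrA.
Qed.

Lemma torsion_bilinear th ga x i u v : coframe_mx th x \in unitmx ->
  let T := (coframe_mx th x)^T in
  \sum_j \sum_k torsion th ga x i j k * (u *m T) 0 j * (v *m T) 0 k =
  bilinear (ext_d (th i) x) u v
  + \sum_l (pair (conn_form ga i l x) u * (v *m T) 0 l
            - pair (conn_form ga i l x) v * (u *m T) 0 l).
Proof.
move=> uT T.
transitivity (bilinear (ext_d (th i) x + \sum_l wedge (conn_form ga i l x) (th l x)) u v).
  by rewrite (frame_comp_bilinear _ _ _ uT).
rewrite bilinear_mxD bilinear_mx_sum; congr (_ + _); apply: eq_bigr => l _.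
by rewrite bilinear_wedge /T !coords_pair.
Qed.

Lemma frame_comp_skew th x w : w^T = - w -> (frame_comp th x w)^T = - frame_comp th x w.
Proof. by move=> sw; rewrite !trmx_mul trmxK sw mulNmx mulmxN mulmxA. Qed.

Lemma wedge_skew (p q : 'rV[R]_5) : (wedge p q)^T = - wedge p q.
Proof. by apply/matrixP => i j; rewrite !mxE opprB. Qed.

Lemma ext_d_skew (f : 'rV[R]_5 -> 'rV[R]_5) x : (ext_d f x)^T = - ext_d f x.
Proof. by apply/matrixP => i j; rewrite !mxE opprB. Qed.

Lemma torsion_skew th ga x i j k : torsion th ga x i j k = - torsion th ga x i k j.
Proof.
rewrite /torsion; set w := (X in frame_comp _ _ X).
have /frame_comp_skew : w^T = - w.
  rewrite /w linearD /= ext_d_skew linear_sum /= opprD -sumrN; congr (_ + _).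
  by apply: eq_bigr => l _; rewrite wedge_skew.
by move=> /(_ th x)/matrixP/(_ k j); rewrite !mxE.
Qed.

Lemma torsion_alternating V th ga x : characteristic_connection V th ga -> V x ->
  alternating3 (torsion th ga x).
Proof. by move=> [_ h] Vx i j k; split; [exact: h|exact: torsion_skew]. Qed.

Variables (M : manifold R) (S : so3_structure M).
Variables (c : 'I_5 -> 'I_5 -> 'I_5 -> R).
Variables (X : 'I_5 -> chart M -> 'rV[R]_5 -> 'rV[R]_5).
Hypothesis hG : transitive_symmetry_algebra S c X.

Definition symmetry_frame (a : chart M) x (Th : 'M[R]_5) : 'M[R]_5 := sym_mx X a x *m Th^T.

Lemma symmetry_frameE a th x s i :
  symmetry_frame a x (coframe_mx th x) s i = (X s a x *m (coframe_mx th x)^T) 0 i.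
Proof.
rewrite /symmetry_frame -[X s a x](rowK (fun s => X s a x) s) -row_mul.
by rewrite [RHS]mxE.
Qed.

Lemma symmetry_frame_unit a x Th : cim a x -> Th \in unitmx ->
  symmetry_frame a x Th \in unitmx.
Proof.
by move=> ax uT; rewrite unitmx_mul unitmx_tr uT (sym_mx_unit hG).
Qed.

(** The symmetries rotate the coframe infinitesimally. Adding these rotations
    to the values of the characteristic connection on the X_s gives the
    so(3)-valued covector of the right-hand side, with the same torsion. *)
Lemma symmetry_brackets a V th ga x : adapted_on S a V th ->
  characteristic_connection V th ga -> V x ->
  in_Lambda2_3 (hodge3 (torsion th ga x)) ->
  exists A B G t0 t1 t2,
    (forall i j k, torsion th ga x i j k = tau t0 t1 t2 i j k) /\
    intertwines (symmetry_frame a x (coframe_mx th x)) c (frame_bracket A B G t0 t1 t2).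
Proof.
move=> adV cc Vx hT; set T := (coframe_mx th x)^T.
have uT : coframe_mx th x \in unitmx := adapted_unit adV Vx.
have ax := adapted_cim adV Vx.
have [t tE] := torsion_of_hodge (torsion_alternating cc Vx) hT.
have [phi phiE] := choice (fun s => lie_adapted hG adV s Vx).
set P := symmetry_frame a x (coframe_mx th x).
have uP : P \in unitmx by exact: symmetry_frame_unit.
(* The rotations and the connection enter only through their sum, which is
   then expressed in the frame: gam is its matrix. *)
pose Phi s q := phi s q + pair (ga q x) (X s a x).
pose gam q j := \sum_s invmx P j s * Phi s q.
have gamE s q : Phi s q = \sum_j P s j * gam q j.
  under eq_bigr => j _ do rewrite /gam mulr_sumr.
  rewrite exchange_big /=; under eq_bigr => r _ do
    (under eq_bigr => j _ do rewrite mulrA; rewrite -mulr_suml).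
  rewrite (bigD1 s)//= [X in _ = _ + X]big1 ?addr0 => [|r rs]; last first.
    have /matrixP/(_ s r) := mulmxV uP; rewrite !mxE eq_sym (negbTE rs) => ->.
    by rewrite mul0r.
  by have /matrixP/(_ s s) := mulmxV uP; rewrite !mxE eqxx => ->; rewrite mul1r.
exists (gam q1), (gam q2), (gam q3), (t q1), (t q2), (t q3); split=> //.
apply: intertwines_basis => s r i.
have PE s' l : (X s' a x *m T) 0 l = P s' l by rewrite /P symmetry_frameE.
have L s' v : pair (lie_form (X s' a) (th i) x) v =
    \sum_(l < 5) (\sum_(q < 3) phi s' q * E_coef q i l) * (v *m T) 0 l.
  rewrite -lie_mx_pair phiE trmx_mul mulmxA mxE; apply: eq_bigr => l _.
  by rewrite mulrC [_^T l i]mxE E_combE sum3.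
have key := structure_equation hG adV s r i Vx.
have tors := torsion_bilinear ga i (X s a x) (X r a x) uT.
rewrite /= -/T in tors.
rewrite key !L in tors.
have G s' (l : 'I_5) : \sum_j P s' j * (gam q1 j * E_coef 0 i l + gam q2 j * E_coef 1 i l
      + gam q3 j * E_coef 2 i l) =
      \sum_(q < 3) (phi s' q + pair (ga q x) (X s' a x)) * E_coef q i l.
  rewrite sum3 -!/(Phi s' _) !gamE !mulr_suml -!big_split; apply: eq_bigr => j _ /=.
  by rewrite !mulrDr !mulrA.
have -> : \sum_j \sum_k P s j * P r k *
     frame_bracket (gam q1) (gam q2) (gam q3) (t q1) (t q2) (t q3) j k i =
   \sum_j \sum_k torsion th ga x i j k * P s j * P r k
   - \sum_(l < 5) P r l * (\sum_(q < 3) (phi s q + pair (ga q x) (X s a x)) * E_coef q i l)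
   + \sum_(l < 5) P s l * (\sum_(q < 3) (phi r q + pair (ga q x) (X r a x)) * E_coef q i l).
  under [X in _ = _ - X + _]eq_bigr => l _ do rewrite -G mulr_sumr.
  under [X in _ = _ + X]eq_bigr => l _ do rewrite -G mulr_sumr.
  rewrite [X in _ = _ - X + _]exchange_big -sumrB -big_split; apply: eq_bigr => j _ /=.
  rewrite -sumrB -big_split; apply: eq_bigr => k _ /=.
  rewrite /frame_bracket tE.
  move: (tau _ _ _ _ _ _) (P s j) (P r k) => *; ring.
have -> : \sum_j \sum_k torsion th ga x i j k * P s j * P r k =
   \sum_j \sum_k torsion th ga x i j k * (X s a x *m T) 0 j * (X r a x *m T) 0 k.
  by apply: eq_bigr => j _; apply: eq_bigr => k _; rewrite !PE.
rewrite tors.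
have -> : \sum_u c s r u * pair (th i x) (X u a x) = \sum_u c s r u * P u i.
  by apply: eq_bigr => u _; rewrite -PE coords_pair.
rewrite sumrB.
have E1 s' r' :
   \sum_(l < 5) P r' l * (\sum_(q < 3) (phi s' q + pair (ga q x) (X s' a x)) * E_coef q i l) =
   \sum_(l < 5) (\sum_(q < 3) phi s' q * E_coef q i l) * (X r' a x *m T) 0 l
   + \sum_(l < 5) pair (conn_form ga i l x) (X s' a x) * (X r' a x *m T) 0 l.
  rewrite -big_split; apply: eq_bigr => l _ /=.
  rewrite PE pair_conn -mulrDl mulrC -big_split; congr (_ * _).
  by apply: eq_bigr => q _ /=; rewrite mulrDl [X in _ + X = _]mulrC.
rewrite !E1.
move: (\sum_l _) (\sum_l _) (\sum_l _) (\sum_l _) (\sum_u _) => *; ring.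
Qed.

End CharacteristicTorsion.

(** * The algebra of a cubic form at a point *)

Section CubicAlgebra.
Variables (R : realType) (g : 'M[R]_5) (Y : 'I_5 -> 'I_5 -> 'I_5 -> R).
Implicit Types (u v w x y z : 'rV[R]_5).

(** With respect to the metric, a trace-free cubic form satisfying the square
    identity is a commutative product on R^5: u . v is the image of v under
    Upsilon_u, and the form itself is the scalar product of u . v and w. *)
Definition dot u v : R := bilinear g u v.
Definition prd u v : 'rV[R]_5 := v *m (cubic_end g Y u)^T.

Hypotheses (g_sym : g^T = g) (g_pos : forall v, v != 0 -> 0 < dot v v).
Hypothesis Y_sym : symmetric3 Y.
Hypothesis Y_trace : forall v, \tr (cubic_end g Y v) = 0.
Hypothesis Y_square : forall v, prd v (prd v v) = dot v v *: v.

Lemma dotDl u u' v : dot (u + u') v = dot u v + dot u' v.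
Proof. exact: bilinearDl. Qed.
Lemma dotC u v : dot u v = dot v u.
Proof.
rewrite /dot !bilinearE.
have -> : (u *m g *m v^T) 0 0 = (u *m g *m v^T)^T 0 0 by rewrite [RHS]mxE.
by rewrite !trmx_mul trmxK g_sym mulmxA.
Qed.
Lemma dotDr u v v' : dot u (v + v') = dot u v + dot u v'.
Proof. by rewrite !(dotC u) dotDl. Qed.
Lemma dotZl k u v : dot (k *: u) v = k * dot u v.
Proof. by rewrite /dot !bilinearE -!scalemxAl mxE. Qed.
Lemma dotZr k u v : dot u (k *: v) = k * dot u v.
Proof. by rewrite !(dotC u) dotZl. Qed.
Lemma dotNl u v : dot (- u) v = - dot u v.
Proof. by rewrite -scaleN1r dotZl mulN1r. Qed.
Lemma dotNr u v : dot u (- v) = - dot u v.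
Proof. by rewrite !(dotC u) dotNl. Qed.
Lemma dot0l v : dot 0 v = 0. Proof. by rewrite -(scale0r 0) dotZl mul0r. Qed.
Lemma dot0r v : dot v 0 = 0. Proof. by rewrite dotC dot0l. Qed.

Lemma dot_eq0 v : dot v v = 0 -> v = 0.
Proof. by move=> d0; apply/eqP; apply: contraT => /g_pos; rewrite d0 ltxx. Qed.

Lemma dot_inj u v : (forall w, dot u w = dot v w) -> u = v.
Proof.
move=> h; apply/eqP; rewrite -subr_eq0; apply/eqP/dot_eq0.
by rewrite dotDl dotNl h subrr.
Qed.

Lemma g_unit : g \in unitmx.
Proof.
rewrite -row_free_unit -kermx_eq0; apply/eqP/row_matrixP => i.
rewrite row0; apply: dot_eq0; rewrite /dot bilinearE.
have : row i (kermx g) *m g = 0 by rewrite -row_mul mulmx_ker row0.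
by move=> ->; rewrite mul0mx mxE.
Qed.

Lemma dot_prd u v w : dot (prd u v) w = trilinear Y u v w.
Proof.
rewrite /dot bilinearE /prd /cubic_end trmx_mul trmx_inv g_sym.
rewrite mulmxA mulmxKV ?g_unit// !mxE /trilinear.
under [RHS]eq_bigr => i _ do rewrite exchange_big.
rewrite exchange_big; apply: eq_bigr => k _ /=.
rewrite exchange_big mxE mulr_suml; apply: eq_bigr => j _ /=.
rewrite !mxE mulr_sumr mulr_suml; apply: eq_bigr => i _.
have [e1 e2] := Y_sym i j k; have [e3 _] := Y_sym k j i; have [_ e4] := Y_sym j i k.
rewrite e1 e4 e3.
by move: (Y j k i) (u 0 i) (v 0 j) (w 0 k) => *; ring.
Qed.

Lemma prdC u v : prd u v = prd v u.
Proof. by apply: dot_inj => w; rewrite !dot_prd (trilinear_swap12 _ _ _ Y_sym). Qed.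
Lemma dot_prd_swap u v w : dot (prd u v) w = dot v (prd u w).
Proof.
rewrite [RHS]dotC !dot_prd.
by rewrite (trilinear_swap23 _ _ _ Y_sym).
Qed.
Lemma prdDr u v v' : prd u (v + v') = prd u v + prd u v'.
Proof. exact: mulmxDl. Qed.
Lemma prdDl u u' v : prd (u + u') v = prd u v + prd u' v.
Proof. by rewrite !(prdC _ v) prdDr. Qed.
Lemma prdZr k u v : prd u (k *: v) = k *: prd u v.
Proof. by rewrite /prd -scalemxAl. Qed.
Lemma prdZl k u v : prd (k *: u) v = k *: prd u v.
Proof. by rewrite !(prdC _ v) prdZr. Qed.
Lemma prdNr u v : prd u (- v) = - prd u v.
Proof. by rewrite -scaleN1r prdZr scaleN1r. Qed.
Lemma prdNl u v : prd (- u) v = - prd u v.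
Proof. by rewrite !(prdC _ v) prdNr. Qed.
Lemma prd0r u : prd u 0 = 0. Proof. exact: mul0mx. Qed.

(** Polarisations of the defining identity of the cubic form. *)
Lemma prd_polar1 x y :
  2 *: prd y (prd x y) + prd x (prd y y) = (2 * dot x y) *: y + dot y y *: x.
Proof.
apply: dot_inj => w.
have h1 := congr1 (dot^~ w) (Y_square (x + y)).
have h2 := congr1 (dot^~ w) (Y_square (x - y)).
have h3 := congr1 (dot^~ w) (Y_square x).
move: h1 h2 h3; rewrite !(prdDl, prdDr, prdNl, prdNr, dotDl, dotDr, dotNl, dotNr, dotZl).
rewrite !(prdC y x) !(dotC y x).
move: (dot (prd x (prd x y)) w) (dot (prd x (prd x x)) w) (dot (prd y (prd x x)) w)
  (dot (prd y (prd x y)) w) (dot (prd x (prd y y)) w) (dot (prd y (prd y y)) w)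
  (dot x x) (dot x y) (dot y y) (dot x w) (dot y w) => *; lra.
Qed.

Lemma prd_polar2 x y z :
  prd x (prd y z) + prd y (prd x z) + prd z (prd x y) =
  dot x y *: z + dot y z *: x + dot x z *: y.
Proof.
apply: dot_inj => w.
have h1 := congr1 (dot^~ w) (prd_polar1 x (y + z)).
have h2 := congr1 (dot^~ w) (prd_polar1 x y).
have h3 := congr1 (dot^~ w) (prd_polar1 x z).
move: h1 h2 h3; rewrite !(prdDl, prdDr, dotDl, dotDr, dotZl).
rewrite !(prdC z y) !(dotC z y).
move: (dot (prd x (prd y z)) w) (dot (prd y (prd x z)) w) (dot (prd z (prd x y)) w)
  (dot (prd x (prd y y)) w) (dot (prd x (prd z z)) w) (dot (prd y (prd x y)) w)
  (dot (prd z (prd x z)) w) (dot x y) (dot x z) (dot y z) (dot y y) (dot z z)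
  (dot x w) (dot y w) (dot z w) => *; lra.
Qed.

Section Frame.
Variable a : 'rV[R]_5.
Hypotheses (a_unit : dot a a = 1) (a_null : dot a (prd a a) = 0).
Let e := prd a a.

Lemma prd_a_e : prd a e = a.
Proof. by rewrite Y_square a_unit scale1r. Qed.

Lemma dot_e_e : dot e e = 1.
Proof. by rewrite {1}/e dot_prd_swap prd_a_e. Qed.

Lemma dot_a_e : dot a e = 0. Proof. exact: a_null. Qed.

Lemma prd_e b : prd e b = b + (2 * dot a b) *: a - 2 *: prd a (prd a b).
Proof.
have := prd_polar1 b a; rewrite a_unit scale1r (dotC b a) (prdC b a) (prdC b e).
by move=> E; apply/eqP; rewrite eq_sym subr_eq addrC [X in _ == X]addrC E addrC.
Qed.

Lemma prd_e_e : prd e e = - e.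
Proof.
rewrite prd_e dot_a_e mulr0 scale0r addr0 prd_a_e -/e.
by rewrite scaler_nat mulr2n opprD addrA subrr sub0r.
Qed.

(** On the orthogonal of a and e, multiplication by a has eigenvalues 0 and
    plus or minus sqrt 3 / 2. *)
Lemma prd_a_cube b : dot a b = 0 -> dot e b = 0 ->
  prd a (prd a (prd a b)) = (3 / 4) *: prd a b.
Proof.
move=> ab eb; set L := prd a.
have L_a v : dot a (L v) = dot e v by rewrite -dot_prd_swap.
have L_e v : dot e (L v) = dot a v by rewrite -dot_prd_swap prd_a_e.
have pe v : dot a v = 0 -> prd e v = v - 2 *: L (L v).
  by move=> av; rewrite prd_e av mulr0 scale0r addr0.
have L4 : L (L (L (L b))) = (3 / 4) *: L (L b).
  have := prd_polar1 b e.
  rewrite prd_e_e prdNr (prdC b e) (dotC b e) eb mulr0 scale0r dot_e_e scale1r add0r.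
  rewrite (pe b ab) (prdDr e) prdNr prdZr (pe b ab) pe; last by rewrite !(L_a, L_e).
  move=> E; apply: dot_inj => w; have := congr1 (dot^~ w) E.
  rewrite !(dotDl, dotNl, dotZl) => ?; lra.
pose d := L (L (L b)) - (3 / 4) *: L b.
apply/eqP; rewrite -subr_eq0; apply/eqP; apply: dot_eq0; rewrite -/d.
have Ld : L d = 0 by rewrite /d /L prdDr prdNr prdZr -/L L4 subrr.
have dE : d = L (L (L b) - (3 / 4) *: b) by rewrite /d /L (prdDr a) prdNr prdZr.
by rewrite {1}dE dot_prd_swap -/L Ld dot0r.
Qed.

Definition orth b : 'rV[R]_5 := b - dot a b *: a - dot e b *: e.

Lemma dot_a_orth b : dot a (orth b) = 0.
Proof.
by rewrite /orth !(dotDr, dotNr, dotZr) a_unit dot_a_e mulr0 oppr0 mulr1 addr0 subrr.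
Qed.

Lemma dot_e_orth b : dot e (orth b) = 0.
Proof.
rewrite /orth !(dotDr, dotNr, dotZr) dot_e_e (dotC e a) dot_a_e.
by rewrite mulr0 oppr0 mulr1 addr0 subrr.
Qed.

(** A multiple of the projection on the eigenspace of k when k is plus or
    minus sqrt 3 / 2: the other eigenvalues are killed by the factors t and
    t + k of the polynomial t (t + k). *)
Definition eigen_proj (k : R) b : 'rV[R]_5 :=
  prd a (prd a (orth b)) + k *: prd a (orth b).

Lemma prd_eigen_proj k b : k ^+ 2 = 3 / 4 ->
  prd a (eigen_proj k b) = k *: eigen_proj k b.
Proof.
move=> k2; rewrite /eigen_proj prdDr prdZr prd_a_cube ?dot_a_orth ?dot_e_orth//.
by rewrite scalerDr scalerA -expr2 k2 addrC.
Qed.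

(** If the projection killed all basis vectors, the endomorphism B N would be
    zero; but its trace is 3 / 2, since Upsilon_a and Upsilon_e are trace free. *)
Lemma eigen_proj_neq0 k : exists i, eigen_proj k (delta_mx 0 i) != 0.
Proof.
pose A := (cubic_end g Y a)^T; pose N := A *m A + k *: A.
pose B : 'M[R]_5 := 1%:M - g *m a^T *m a - g *m e^T *m e.
have pA v : v *m A = prd a v by [].
have out u v : v *m (g *m u^T *m u) = dot u v *: u.
  rewrite !mulmxA.
  by rewrite dotC /dot bilinearE -mul_scalar_mx -mx11_scalar.
have E b : eigen_proj k b = b *m (B *m N).
  have -> : eigen_proj k b = orth b *m N.
    by rewrite /eigen_proj /N mulmxDr mulmxA -scalemxAr.
  by rewrite mulmxA; congr (_ *m _); rewrite /orth /B !mulmxBr mulmx1 !out.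
apply/existsP; apply: contraT => /existsPn H.
have BN0 : B *m N = 0.
  apply/row_matrixP => i; rewrite row0 rowE -E.
  by move: (H i); rewrite negbK => /eqP.
have AA : 2 *: (A *m A) = 1%:M + 2 *: (g *m a^T *m a) - (cubic_end g Y e)^T.
  apply/row_matrixP => i; rewrite !rowE.
  set d : 'rV[R]_5 := delta_mx 0 i.
  rewrite -scalemxAr mulmxA !pA mulmxBr mulmxDr mulmx1 -scalemxAr out.
  rewrite -[d *m (cubic_end g Y e)^T]/(prd e d) prd_e.
  by rewrite scalerA opprB addrCA subrr addr0.
have tr_out u v : \tr (g *m u^T *m v) = dot v u.
  rewrite mxtrace_mulC mulmxA /dot bilinearE /mxtrace big_ord1.
  by [].
have trA : \tr A = 0 by rewrite mxtrace_tr Y_trace.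
have trAA : \tr (A *m A) = 7 / 2.
  have := congr1 mxtrace AA; rewrite mxtraceZ raddfB /= mxtraceD mxtrace1 mxtraceZ.
  rewrite tr_out a_unit mxtrace_tr Y_trace => ?; lra.
have NE v : v *m N = prd a (prd a v) + k *: prd a v.
  by rewrite /N mulmxDr mulmxA -scalemxAr.
have : \tr (B *m N) = 3 / 2.
  rewrite /B !mulmxBl mul1mx !raddfB /= -!(mulmxA (g *m _^T)) !tr_out !NE.
  rewrite -/e prd_a_e -/e !dotDl !dotZl a_unit dot_e_e (dotC e a) dot_a_e !mulr0 !addr0.
  rewrite /N mxtraceD mxtraceZ trA trAA; lra.
by rewrite BN0 mxtrace0 => /esym/eqP; rewrite mulf_eq0 invr_eq0 !pnatr_eq0.
Qed.

(** Two unit eigenvectors determine the multiplication table of R^5. *)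
Section Multiplication.
Variables e3 e5 : 'rV[R]_5.
Hypotheses (e3_unit : dot e3 e3 = 1) (e5_unit : dot e5 e5 = 1).
Hypotheses (a_e3 : prd a e3 = - (sq3 / 2) *: e3) (a_e5 : prd a e5 = (sq3 / 2) *: e5).
Let e2 := (2 / sq3) *: prd e3 e5.

Let sq3_neq0 : sq3 != 0 :> R. Proof. exact/lt0r_neq0/sqrt3_gt0. Qed.

Lemma eigen_orthogonal k b : k ^+ 2 = 3 / 4 -> prd a b = k *: b ->
  dot a b = 0 /\ dot e b = 0.
Proof.
move=> k2 ab.
have h1 : k * dot e b = dot a b by rewrite -dotZr -ab -dot_prd_swap prd_a_e.
have h2 : k * dot a b = dot e b by rewrite -dotZr -ab -dot_prd_swap.
have h3 : dot a b = 0.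
  have : k ^+ 2 * dot a b = dot a b by rewrite expr2 -mulrA h2 h1.
  rewrite k2 => ?; lra.
by split=> //; rewrite -h2 h3 mulr0.
Qed.

Let k5 : (sq3 / 2) ^+ 2 = 3 / 4 :> R.
Proof. by field: (sqrt3_sq R). Qed.
Let k3 : (- (sq3 / 2)) ^+ 2 = 3 / 4 :> R.
Proof. by rewrite sqrrN k5. Qed.

Lemma dot_a_e3 : dot a e3 = 0. Proof. by case: (eigen_orthogonal k3 a_e3). Qed.
Lemma dot_e_e3 : dot e e3 = 0. Proof. by case: (eigen_orthogonal k3 a_e3). Qed.
Lemma dot_a_e5 : dot a e5 = 0. Proof. by case: (eigen_orthogonal k5 a_e5). Qed.
Lemma dot_e_e5 : dot e e5 = 0. Proof. by case: (eigen_orthogonal k5 a_e5). Qed.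

Lemma dot_e3_e5 : dot e3 e5 = 0.
Proof.
have : dot (prd a e3) e5 = dot e3 (prd a e5) by rewrite dot_prd_swap.
rewrite a_e3 a_e5 dotZl dotZr => h.
by apply: (mulfI sq3_neq0); rewrite mulr0; lra.
Qed.

Lemma prd_e_eigen k b : k ^+ 2 = 3 / 4 -> prd a b = k *: b -> prd e b = - 2^-1 *: b.
Proof.
move=> k2 ab; have [ab0 _] := eigen_orthogonal k2 ab.
rewrite prd_e ab0 mulr0 scale0r addr0 ab prdZr ab !scalerA -mulrA -expr2 k2.
by rewrite -{1}(scale1r b) -scalerBl; congr (_ *: _); field.
Qed.

(** The polarised square identity at (e, b) and (a, b) is a linear system for
    the vector b . b. *)
Lemma prd_eigen_sq k b : k ^+ 2 = 3 / 4 -> dot b b = 1 -> prd a b = k *: b ->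
  prd b b = k *: a - 2^-1 *: e.
Proof.
move=> k2 b1 ab; have [ab0 eb0] := eigen_orthogonal k2 ab.
have h1 := prd_polar1 e b; have h2 := prd_polar1 a b.
rewrite (prdC b (prd a b)) ab prdZl in h2.
rewrite (prd_e_eigen k2 ab) prdZr eb0 mulr0 scale0r add0r b1 scale1r in h1.
rewrite ab0 mulr0 scale0r add0r b1 scale1r in h2.
set q := prd b b in h1 h2 *.
have aq : dot a q = k by rewrite -dot_prd_swap (prdC b a) ab dotZl b1 mulr1.
have Lq : prd a q = a - (2 * k) *: q.
  by apply/eqP; rewrite eq_sym subr_eq addrC -scalerA h2.
have LLq : prd a (prd a q) = e - (2 * k) *: a + 3 *: q.
  rewrite {1}Lq prdDr prdNr prdZr -/e Lq; apply: dot_inj => w.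
  rewrite !(dotDl, dotNl, dotZl).
  move: (dot q w) (dot a w) (dot e w) => r1 r2 r3.
  transitivity (r3 - 2 * k * r2 + 4 * k ^+ 2 * r1); first ring.
  by rewrite k2; field.
rewrite (prd_e q) aq LLq in h1.
apply: dot_inj => w; have := congr1 (dot^~ w) h1.
rewrite !(dotDl, dotNl, dotZl); move: (dot q w) (dot a w) (dot e w) => r1 r2 r3.
by move=> h; lra.
Qed.

Lemma prd_e3_e3 : prd e3 e3 = - (sq3 / 2) *: a - 2^-1 *: e.
Proof. exact: prd_eigen_sq k3 e3_unit a_e3. Qed.

Lemma prd_e5_e5 : prd e5 e5 = (sq3 / 2) *: a - 2^-1 *: e.
Proof. exact: prd_eigen_sq k5 e5_unit a_e5. Qed.

Lemma prd_e_e3 : prd e e3 = - 2^-1 *: e3.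
Proof. exact: prd_e_eigen k3 a_e3. Qed.

Lemma prd_e_e5 : prd e e5 = - 2^-1 *: e5.
Proof. exact: prd_e_eigen k5 a_e5. Qed.

Lemma prd_e3_e2 : prd e3 e2 = (sq3 / 2) *: e5.
Proof.
have := prd_polar1 e5 e3; rewrite (dotC e5 e3) dot_e3_e5 mulr0 scale0r add0r.
rewrite e3_unit scale1r prd_e3_e3 prdDr prdNr !prdZr (prdC e5 a) (prdC e5 e).
rewrite a_e5 prd_e_e5 (prdC e5 e3) => h; rewrite /e2 ?prdZr.
apply: dot_inj => w; have := congr1 (dot^~ w) h.
rewrite !(dotDl, dotNl, dotZl).
move: (dot _ w) (dot e5 w) => r1 r2 h'.
have -> : r1 = (3 / 8 + sq3 ^+ 2 / 8) * r2 by lra.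
by field: (sqrt3_sq R); rewrite sq3_neq0.
Qed.

Lemma prd_e5_e2 : prd e5 e2 = (sq3 / 2) *: e3.
Proof.
have := prd_polar1 e3 e5; rewrite dot_e3_e5 mulr0 scale0r add0r.
rewrite e5_unit scale1r prd_e5_e5 prdDr prdNr !prdZr (prdC e3 a) (prdC e3 e).
rewrite a_e3 prd_e_e3 => h; rewrite /e2 ?prdZr.
apply: dot_inj => w; have := congr1 (dot^~ w) h.
rewrite !(dotDl, dotNl, dotZl).
move: (dot _ w) (dot e3 w) => r1 r2 h'.
have -> : r1 = (3 / 8 + sq3 ^+ 2 / 8) * r2 by lra.
by field: (sqrt3_sq R); rewrite sq3_neq0.
Qed.

Lemma prd_e3_e5 : prd e3 e5 = (sq3 / 2) *: e2.
Proof.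
by rewrite /e2 scalerA (_ : _ * _ = 1) ?scale1r//; field; rewrite sq3_neq0.
Qed.

Lemma dot_e2 w : dot e2 w = 2 / sq3 * dot e5 (prd e3 w).
Proof. by rewrite /e2 dotZl dot_prd_swap. Qed.

Lemma dot_e2_e3 : dot e2 e3 = 0.
Proof.
rewrite dot_e2 prd_e3_e3 !(dotDr, dotNr, dotZr) (dotC e5 a) (dotC e5 e).
by rewrite dot_a_e5 dot_e_e5 !mulr0 subrr mulr0.
Qed.

Lemma dot_e2_e5 : dot e2 e5 = 0.
Proof.
rewrite dot_e2 (prdC e3 e5) -dot_prd_swap prd_e5_e5 !(dotDl, dotNl, dotZl).
by rewrite dot_a_e3 dot_e_e3 !mulr0 subrr mulr0.
Qed.

Lemma dot_e2_a : dot e2 a = 0.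
Proof. by rewrite dot_e2 prdC a_e3 dotZr (dotC e5 e3) dot_e3_e5 !mulr0. Qed.

Lemma dot_e2_e : dot e2 e = 0.
Proof. by rewrite dot_e2 prdC prd_e_e3 dotZr (dotC e5 e3) dot_e3_e5 !mulr0. Qed.

Lemma dot_e2_e2 : dot e2 e2 = 1.
Proof.
by rewrite dot_e2 prd_e3_e2 dotZr e5_unit mulr1; field; rewrite sq3_neq0.
Qed.

Lemma prd_a_e2 : prd a e2 = 0.
Proof.
have := prd_polar2 a e3 e5; rewrite dot_a_e3 dot_e3_e5 dot_a_e5 !scale0r !addr0.
rewrite a_e3 a_e5 !prdZr (prdC e5 e3) => h.
rewrite /e2 ?prdZr (_ : prd a (prd e3 e5) = 0) ?scaler0//.
rewrite -[RHS]h -addrA -scalerDl.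
by rewrite addrN scale0r addr0.
Qed.

Lemma prd_e_e2 : prd e e2 = e2.
Proof.
by rewrite prd_e (dotC a) dot_e2_a mulr0 scale0r addr0 prd_a_e2 prd0r scaler0 subr0.
Qed.

Lemma prd_e2_e2 : prd e2 e2 = e.
Proof.
have h1 := prd_polar1 a e2; rewrite prd_a_e2 prd0r scaler0 add0r in h1.
rewrite (dotC a) dot_e2_a mulr0 scale0r add0r dot_e2_e2 scale1r in h1.
have := prd_polar1 e e2; rewrite prd_e_e2 (dotC e) dot_e2_e mulr0 scale0r add0r.
rewrite dot_e2_e2 scale1r (prd_e (prd e2 e2)) h1 -/e -dot_prd_swap (prdC e2 a).
rewrite prd_a_e2 dot0l mulr0 scale0r addr0 => h.
apply: dot_inj => w; have := congr1 (dot^~ w) h.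
rewrite !(dotDl, dotNl, dotZl) => ?; lra.
Qed.

(** The order of the vectors comes from the standard form, in which
    e_4 . e_4 = e_1 and e_3 . e_5 is proportional to e_2. *)
Definition cubic_frame : 'M[R]_5 :=
  \matrix_i nth 0 [:: e; e2; e3; a; e5] i.

Lemma cubic_frameE (i : 'I_5) : row i cubic_frame = nth 0 [:: e; e2; e3; a; e5] i.
Proof. exact: rowK. Qed.

Lemma cubic_frame_dot (i j : 'I_5) :
  dot (nth 0 [:: e; e2; e3; a; e5] i) (nth 0 [:: e; e2; e3; a; e5] j) = (i == j)%:R.
Proof.
have c1 := dotC e a; have c2 := dotC e e2; have c3 := dotC e3 e.
have c4 := dotC e5 e; have c5 := dotC a e2; have c6 := dotC e3 e2.
have c7 := dotC e5 e2; have c8 := dotC e3 a; have c9 := dotC e5 a.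
have c10 := dotC e5 e3.
by elim/ord5_ind: i; elim/ord5_ind: j; rewrite /= ?dot_e_e ?dot_e2_e2 ?e3_unit ?a_unit
  ?e5_unit ?c1 ?c2 ?c3 ?c4 ?c5 ?c6 ?c7 ?c8 ?c9 ?c10 ?dot_a_e ?dot_e2_e ?dot_e_e3
  ?dot_e_e5 ?dot_e2_a ?dot_e2_e3 ?dot_e2_e5 ?dot_a_e3 ?dot_a_e5 ?dot_e3_e5.
Qed.

Lemma cubic_frame_orthonormal : cubic_frame *m g *m cubic_frame^T = 1%:M.
Proof.
apply/matrixP => i j; rewrite [RHS]mxE -cubic_frame_dot -!cubic_frameE.
rewrite /dot bilinearE -row_mul [LHS]mxE [RHS]mxE; apply: eq_bigr => k _.
by congr (_ * _); rewrite !mxE.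
Qed.

Lemma cubic_frame_standard (i j k : 'I_5) :
  trilinear Y (row i cubic_frame) (row j cubic_frame) (row k cubic_frame) = ups0 i j k.
Proof.
have d l := cubic_frame_dot l k.
have d1 := d o1; have d2 := d o2; have d3 := d o3; have d4 := d o4; have d5 := d o5.
rewrite -dot_prd !cubic_frameE ups0E; move: d1 d2 d3 d4 d5.
set z := nth 0 [:: e; e2; e3; a; e5] k; rewrite /= => d1 d2 d3 d4 d5.
have fe := prd_e_e; have fe2 := prd_e_e2; have fe3 := prd_e_e3.
have fa := prd_a_e; have fe5 := prd_e_e5; have f22 := prd_e2_e2.
have f2a := prd_a_e2; have f32 := prd_e3_e2; have f52 := prd_e5_e2.
have f33 := prd_e3_e3; have f55 := prd_e5_e5; have f35 := prd_e3_e5.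
have c1 := prdC e2 e; have c2 := prdC e3 e; have c3 := prdC e5 e.
have c4 := prdC e a; have c5 := prdC e2 e3; have c6 := prdC e2 e5.
have c7 := prdC e2 a; have c8 := prdC e3 a; have c9 := prdC e5 a.
have c10 := prdC e5 e3; have faa : prd a a = e by [].
have d6 : dot (prd e3 e5) z = sq3 / 2 * (o2 == k)%:R by rewrite f35 dotZl d2.
elim/ord5_ind: i; elim/ord5_ind: j;
  rewrite /= ?c1 ?c2 ?c3 ?c4 ?c5 ?c6 ?c7 ?c8 ?c9 ?c10
    ?fe ?fe2 ?fe3 ?fe5 ?fa ?f22 ?f2a ?f32 ?f52 ?f33 ?f55 ?f35 ?faa ?a_e3 ?a_e5
    ?(dotDl, dotNl, dotZl, dot0l) ?d1 ?d2 ?d3 ?d4 ?d5 ?d6;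
  clear z d1 d2 d3 d4 d5 d6 d; elim/ord5_ind: k => /=; by field; rewrite ?sq3_neq0.
Qed.

End Multiplication.
End Frame.
End CubicAlgebra.

(** * The trace form of the symmetry algebra as an invariant of the geometry *)

Section TraceForm.
Variables (R : realType) (M : manifold R) (S : so3_structure M).
Variables (c : 'I_5 -> 'I_5 -> 'I_5 -> R).
Variables (X : 'I_5 -> chart M -> 'rV[R]_5 -> 'rV[R]_5).
Hypothesis hG : transitive_symmetry_algebra S c X.
Implicit Types (a b : chart M) (x u v w : 'rV[R]_5) (th : 'I_5 -> 'rV[R]_5 -> 'rV[R]_5).

Lemma pairC u v : pair u v = pair v u.
Proof. by apply: eq_bigr => m _; rewrite mulrC. Qed.

Lemma pairDr u v w : pair u (v + w) = pair u v + pair u w.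
Proof.
by rewrite /pair -big_split; apply: eq_bigr => m _; rewrite mxE mulrDr.
Qed.

Lemma pairZr k u v : pair u (k *: v) = k * pair u v.
Proof.
by rewrite /pair mulr_sumr; apply: eq_bigr => m _; rewrite mxE mulrCA.
Qed.

Lemma bilinearZl (g : 'M[R]_5) k u v : bilinear g (k *: u) v = k * bilinear g u v.
Proof. by rewrite !bilinearE -!scalemxAl mxE. Qed.

Lemma pairE u v : pair u v = (v *m u^T) 0 0.
Proof. by rewrite mxE; apply: eq_bigr => m _; rewrite !mxE mulrC. Qed.

Lemma pair0r u : pair u 0 = 0.
Proof. by rewrite /pair big1// => m _; rewrite mxE mulr0. Qed.

Lemma pair0l u : pair 0 u = 0.
Proof. by rewrite /pair big1// => m _; rewrite mxE mul0r. Qed.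

Lemma bilinear_pair (g : 'M[R]_5) u v : bilinear g u v = pair (u *m g) v.
Proof.
rewrite /pair /bilinear exchange_big; apply: eq_bigr => n _ /=.
by rewrite mxE mulr_suml; apply: eq_bigr => m _; rewrite [g m n * _]mulrC.
Qed.

Lemma pair_eq0 u : (forall v, pair u v = 0) -> u = 0.
Proof.
move=> h; apply/rowP => j; rewrite mxE -(h (delta_mx 0 j)) /pair (bigD1 j)//=.
rewrite mxE !eqxx mulr1 big1 ?addr0// => i ij.
by rewrite mxE (negbTE ij) andbF mulr0.
Qed.

Lemma along_pair xi (p q : 'rV[R]_5 -> 'rV[R]_5) x :
  row_has_partials p x -> row_has_partials q x ->
  along xi (fun y => pair (p y) (q y)) x =
    pair (row_along xi p x) (q x) + pair (p x) (row_along xi q x).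
Proof.
move=> dp dq; rewrite /pair along_sum => [|m]; last exact: has_partialsM (dp m) (dq m).
rewrite -big_split; apply: eq_bigr => m _ /=.
by rewrite (alongM _ (dp m) (dq m)) !mxE.
Qed.

Lemma smooth_row_partials V (w : 'rV[R]_5 -> 'rV[R]_5) x :
  smooth_row V w -> V x -> row_has_partials w x.
Proof. by move=> sw Vx j; exact: smooth_has_partials (sw j) Vx. Qed.

Lemma smooth_rowM V n (w : 'rV[R]_5 -> 'rV[R]_n) (A : 'rV[R]_5 -> 'M[R]_(n, 5)) :
  open V -> (forall j, smooth_on V (fun x => w x 0 j)) ->
  (forall i j, smooth_on V (fun x => A x i j)) -> smooth_row V (fun x => w x *m A x).
Proof.
move=> oV sw sA m; apply: (smooth_mulmx oV) => [i j|]; last exact: sA.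
by apply: (smooth_ext oV _ (sw j)) => x _; rewrite ord1.
Qed.

(** The covector field taking on X_s the trace of ad X_s, and its metric dual. *)
Definition trace_form a x : 'rV[R]_5 := (\row_s trad c s) *m (invmx (sym_mx X a x))^T.
Definition trace_field a x : 'rV[R]_5 := trace_form a x *m invmx (metric S a x).

Lemma trace_formE a x s : cim a x -> pair (trace_form a x) (X s a x) = trad c s.
Proof.
move=> ax; rewrite pairE /trace_form trmx_mul trmxK.
have -> : X s a x = row s (sym_mx X a x) by rewrite rowK.
rewrite mulmxA -row_mul mulmxV ?(sym_mx_unit hG)//.
by rewrite row1 -rowE !mxE.
Qed.

Lemma sym_span a x (h : 'rV[R]_5) : cim a x ->
  (forall s, pair h (X s a x) = 0) -> h = 0.
Proof.
move=> ax h0; apply: pair_eq0 => v.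
rewrite -[v](mulmxKV (sym_mx_unit hG ax)) mulmx_sum_row.
rewrite (_ : pair h _ = \sum_s (v *m invmx (sym_mx X a x)) 0 s * pair h (X s a x)).
  by rewrite big1// => s _; rewrite h0 mulr0.
elim: (index_enum _) => [|s r IH].
  by rewrite !big_nil pair0r.
by rewrite !big_cons pairDr pairZr IH rowK.
Qed.

Lemma metric_unit a x : cim a x -> metric S a x \in unitmx.
Proof.
move=> ax; apply: g_unit => [v v0]; rewrite /dot bilinearE.
exact: metric_pos.
Qed.

Lemma trace_fieldE a x v : cim a x ->
  bilinear (metric S a x) (trace_field a x) v = pair (trace_form a x) v.
Proof. by move=> ax; rewrite bilinear_pair mulmxKV ?metric_unit. Qed.

Lemma sym_mx_smooth a i j : smooth_on (cim a) (fun x => sym_mx X a x i j).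
Proof.
have oU : open (cim a) by exact: cim_open.
apply: (smooth_ext oU (f := fun x => X i a x 0 j)); last exact: (field_smooth hG).
by move=> x _; rewrite mxE.
Qed.

Lemma trace_form_smooth a : smooth_row (cim a) (trace_form a).
Proof.
have oU : open (cim a) by exact: cim_open.
apply: (smooth_rowM oU) => [j|i j]; first exact: smooth_cst.
apply: (smooth_ext oU (f := fun x => invmx (sym_mx X a x) j i)) => [x _|].
  by rewrite [RHS]mxE.
apply: (smooth_invmx oU); first exact: sym_mx_smooth.
by move=> x; exact: (sym_mx_unit hG).
Qed.

Lemma trace_field_smooth a : smooth_row (cim a) (trace_field a).
Proof.
have oU : open (cim a) by exact: cim_open.
apply: (smooth_rowM oU); first exact: trace_form_smooth.
apply: (smooth_invmx oU); first by move=> i j; exact: metric_smooth.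
by move=> x; exact: metric_unit.
Qed.

(** The trace of ad vanishes on brackets, hence the pairings of the trace form
    with the symmetries are constant and the form is invariant. *)
Lemma lie_trace_form a x s : cim a x -> lie_form (X s a) (trace_form a) x = 0.
Proof.
move=> ax; apply: (sym_span ax) => t.
have oU : open (cim a) by exact: cim_open.
have dX r : row_has_partials (X r a) x.
  by apply: smooth_row_partials ax; exact: (field_smooth hG).
have db := smooth_row_partials (@trace_form_smooth a) ax.
have := along_pair (X s a x) db (dX t).
rewrite (along_ext (g := fun=> trad c t) _ oU ax) => [|y ay]; last exact: trace_formE.
rewrite along_cst lie_form_pair => h.
have := trad_derivation s t (structure_constants_jacobi hG ax)
  (structure_constants_skew hG ax).
under eq_bigr => r _ do rewrite -(trace_formE r ax) -pairZr.
have -> : \sum_r pair (trace_form a x) (c s t r *: X r a x) =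
    pair (trace_form a x) (\sum_r c s t r *: X r a x).
  elim: (index_enum _) => [|r q IH].
    by rewrite !big_nil pair0r.
  by rewrite !big_cons pairDr IH.
rewrite -(field_closed hG)// field_bracket_along -scaleN1r pairDr pairZr.
move: h; move: (pair _ _) (pair _ _) (pair _ _) => *; lra.
Qed.

(** The metric dual of an invariant form commutes with the symmetries. *)
Lemma trace_field_invariant a x s : cim a x ->
  row_along (X s a x) (trace_field a) x = row_along (trace_field a x) (X s a) x.
Proof.
move=> ax; apply/eqP; rewrite -subr_eq0; apply/eqP.
have oU : open (cim a) by exact: cim_open.
have dB := smooth_row_partials (@trace_field_smooth a) ax.
have db := smooth_row_partials (@trace_form_smooth a) ax.
have dg i j : has_partials (fun y => metric S a y i j) x.
  by apply: smooth_has_partials ax; exact: metric_smooth.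
suff H v : bilinear (metric S a x) (row_along (X s a x) (trace_field a) x
    - row_along (trace_field a x) (X s a) x) v = 0.
  have : (row_along (X s a x) (trace_field a) x
    - row_along (trace_field a x) (X s a) x) *m metric S a x = 0.
    by apply: pair_eq0 => v; rewrite -bilinear_pair.
  move=> /(congr1 (mulmx^~ (invmx (metric S a x)))).
  by rewrite mulmxK ?metric_unit// mul0mx.
have h1 := along_bilinear (X s a x) dg dB (@row_has_partials_cst R v x).
rewrite row_along_cst bilinear0r addr0 in h1.
rewrite (along_ext (g := fun y => pair (trace_form a y) v) _ oU ax) in h1; last first.
  by move=> y ay; exact: trace_fieldE.
rewrite (along_pair _ db (@row_has_partials_cst R v x)) row_along_cst in h1.
have h2 := lie_metric_contract (X s a) (metric S a) x (trace_field a x) v.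
rewrite (field_metric hG s ax) bilinear_mx0 (trace_fieldE (row_along _ _ _) ax) in h2.
have h3 := lie_form_pair (X s a) (trace_form a) x v.
rewrite lie_trace_form// pair0l in h3.
have p0 : pair (trace_form a x) 0 = 0.
  exact: pair0r.
rewrite bilinearDl -scaleN1r bilinearZl.
move: h1 h2 h3; rewrite p0.
by move=> h1 h2 h3; lra.
Qed.

Definition trace_norm a x : R := bilinear (metric S a x) (trace_field a x) (trace_field a x).
Definition trace_cubic a x : R := cubic_form (ups S a x) (trace_field a x).

(** An invariant function is locally constant, by transitivity. *)
Lemma partial_eq0 a (f : 'rV[R]_5 -> R) x : cim a x ->
  (forall s, along (X s a x) f x = 0) -> forall m, partial m f x = 0.
Proof.
move=> ax h m; have : (\row_m partial m f x) = 0.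
  apply: (sym_span ax) => s; rewrite -[RHS](h s) /pair /along.
  by apply: eq_bigr => r _; rewrite mxE mulrC.
by move=> /rowP/(_ m); rewrite !mxE.
Qed.

Lemma trace_norm_partial a x m : cim a x -> partial m (trace_norm a) x = 0.
Proof.
move=> ax; apply: (partial_eq0 ax) => s.
have dB := smooth_row_partials (@trace_field_smooth a) ax.
have dg i j : has_partials (fun y => metric S a y i j) x.
  by apply: smooth_has_partials ax; exact: metric_smooth.
rewrite (along_bilinear _ dg dB dB) trace_field_invariant// -lie_metric_contract.
by rewrite (field_metric hG s ax) bilinear_mx0.
Qed.

Lemma trace_cubic_partial a x m : cim a x -> partial m (trace_cubic a) x = 0.
Proof.
move=> ax; apply: (partial_eq0 ax) => s.
have dB := smooth_row_partials (@trace_field_smooth a) ax.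
have dY i j k : has_partials (fun y => ups S a y i j k) x.
  by apply: smooth_has_partials ax; exact: ups_smooth.
rewrite (_ : along _ _ _ = along (X s a x) (fun y => trilinear (ups S a y)
  (trace_field a y) (trace_field a y) (trace_field a y)) x)//.
rewrite (along_trilinear _ dY dB dB dB) trace_field_invariant// -lie_cubic_contract.
rewrite /trilinear big1// => i _; rewrite big1// => j _; rewrite big1// => k _.
by rewrite (field_ups hG s i j k ax) !mul0r.
Qed.

Lemma trace_norm_smooth a : smooth_on (cim a) (trace_norm a).
Proof.
have oU : open (cim a) by exact: cim_open.
rewrite /trace_norm /bilinear; apply: (@smooth_sum _ _ _ _ _ oU) => m.
apply: (@smooth_sum _ _ _ _ _ oU) => n.
apply: (smoothM oU); last exact: trace_field_smooth.
apply: (smoothM oU); last exact: trace_field_smooth.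
exact: metric_smooth.
Qed.

Lemma trace_cubic_smooth a : smooth_on (cim a) (trace_cubic a).
Proof.
have oU : open (cim a) by exact: cim_open.
rewrite /trace_cubic /cubic_form.
apply: (@smooth_sum _ _ _ _ _ oU) => i; apply: (@smooth_sum _ _ _ _ _ oU) => j.
apply: (@smooth_sum _ _ _ _ _ oU) => k.
apply: (smoothM oU); last exact: trace_field_smooth.
apply: (smoothM oU); last exact: trace_field_smooth.
apply: (smoothM oU); last exact: trace_field_smooth.
exact: ups_smooth.
Qed.

Lemma trace_invariants_locally_constant a x : cim a x ->
  exists2 r : R, 0 < r & ball x r `<=` cim a /\
    forall y, ball x r y ->
      trace_norm a y = trace_norm a x /\ trace_cubic a y = trace_cubic a x.
Proof.
move=> ax; have oU : open (cim a) by exact: cim_open.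
have [r r0 rV] := open_ball_sub oU ax; exists r => //; split=> // y xy; split.
- apply: (constant_on_ball rV _ _ xy); first exact/smooth_C1/trace_norm_smooth.
  by move=> m z; exact: trace_norm_partial.
- apply: (constant_on_ball rV _ _ xy); first exact/smooth_C1/trace_cubic_smooth.
  by move=> m z; exact: trace_cubic_partial.
Qed.

End TraceForm.

(** * The invariant coframe *)

Section CanonicalCoframe.
Variables (R : realType) (M : manifold R) (S : so3_structure M).
Variables (c : 'I_5 -> 'I_5 -> 'I_5 -> R).
Variables (X : 'I_5 -> chart M -> 'rV[R]_5 -> 'rV[R]_5).
Hypothesis hG : transitive_symmetry_algebra S c X.
Variable a : chart M.
Implicit Types (x y u v w : 'rV[R]_5).

Let g y := metric S a y.
Let Y y := ups S a y.

Lemma point_sym y : cim a y -> (g y)^T = g y.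
Proof. exact: Defs.metric_sym. Qed.

Lemma point_pos y : cim a y -> forall v, v != 0 -> 0 < dot (g y) v v.
Proof. by move=> ay v v0; rewrite /dot bilinearE; exact: metric_pos. Qed.

Lemma point_ups_sym y : cim a y -> symmetric3 (Y y).
Proof. by move=> ay i j k; exact: ups_sym. Qed.

Lemma point_trace y : cim a y -> forall v, \tr (cubic_end (g y) (Y y) v) = 0.
Proof. by move=> ay v; exact: ups_tracefree. Qed.

Lemma point_square y : cim a y -> forall v,
  prd (g y) (Y y) v (prd (g y) (Y y) v v) = dot (g y) v v *: v.
Proof.
move=> ay v; have := @ups_square R M S a y v ay.
rewrite /prd /dot bilinearE => E.
have h (C : 'M[R]_5) w : w *m C^T *m C^T = (C *m (C *m w^T))^T.
  by rewrite !trmx_mul trmxK.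
by rewrite h E linearZ /= trmxK.
Qed.

Lemma smooth_row_prd V (u v : 'rV[R]_5 -> 'rV[R]_5) : open V -> V `<=` cim a ->
  smooth_row V u -> smooth_row V v ->
  smooth_row V (fun y => prd (g y) (Y y) (u y) (v y)).
Proof.
move=> oV sV su sv; apply: (smooth_rowM oV) => [|i j]; first exact: sv.
apply: (smooth_ext oV (f := fun y => cubic_end (g y) (Y y) (u y) j i)) => [y _|].
  by rewrite [RHS]mxE.
apply: (smooth_mulmx oV) => [p q|p q].
  apply: smooth_sub sV _; apply: smooth_invmx; first exact: cim_open.
    by move=> *; exact: metric_smooth.
  by move=> y; exact: metric_unit.
apply: (smooth_ext oV (f := fun y => \sum_k Y y p q k * u y 0 k)) => [y _|].
  by rewrite mxE.
apply: (@smooth_sum _ _ _ _ _ oV) => k; apply: (smoothM oV); last exact: su.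
by apply: smooth_sub sV _; exact: ups_smooth.
Qed.

Lemma smooth_dot V (u v : 'rV[R]_5 -> 'rV[R]_5) : open V -> V `<=` cim a ->
  smooth_row V u -> smooth_row V v -> smooth_on V (fun y => dot (g y) (u y) (v y)).
Proof.
move=> oV sV su sv; rewrite /dot /bilinear; apply: (@smooth_sum _ _ _ _ _ oV) => m.
apply: (@smooth_sum _ _ _ _ _ oV) => n.
apply: (smoothM oV); last exact: sv.
apply: (smoothM oV); last exact: su.
by apply: smooth_sub sV _; exact: metric_smooth.
Qed.

Lemma smooth_rowD V (u v : 'rV[R]_5 -> 'rV[R]_5) : open V ->
  smooth_row V u -> smooth_row V v -> smooth_row V (fun y => u y + v y).
Proof.
move=> oV su sv m; apply: (smooth_ext oV (f := fun y => u y 0 m + v y 0 m)).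
  by move=> y _; rewrite mxE.
exact: smoothD (su m) (sv m).
Qed.

Lemma smooth_rowZ V (f : 'rV[R]_5 -> R) (u : 'rV[R]_5 -> 'rV[R]_5) : open V ->
  smooth_on V f -> smooth_row V u -> smooth_row V (fun y => f y *: u y).
Proof.
move=> oV sf su m; apply: (smooth_ext oV (f := fun y => f y * u y 0 m)).
  by move=> y _; rewrite mxE.
exact: smoothM sf (su m).
Qed.

Lemma smooth_rowN V (u : 'rV[R]_5 -> 'rV[R]_5) : open V ->
  smooth_row V u -> smooth_row V (fun y => - u y).
Proof.
move=> oV su m; apply: (smooth_ext oV (f := fun y => (-1) * u y 0 m)).
  by move=> y _; rewrite mxE mulN1r.
exact: smoothM (smooth_cst (-1) oV) (su m).
Qed.

Lemma smooth_row_cst V u : open V -> smooth_row V (fun=> u).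
Proof. by move=> oV m; exact: smooth_cst. Qed.

Lemma smooth_eigen_proj V (av : 'rV[R]_5 -> 'rV[R]_5) k b : open V -> V `<=` cim a ->
  smooth_row V av -> smooth_row V (fun y => eigen_proj (g y) (Y y) (av y) k b).
Proof.
move=> oV sV sa.
have se := smooth_row_prd oV sV sa sa.
have sb := smooth_row_cst b oV.
have so : smooth_row V (fun y => orth (g y) (Y y) (av y) b).
  apply: (smooth_rowD oV).
    apply: (smooth_rowD oV); first exact: sb.
    apply: (smooth_rowN oV); apply: (smooth_rowZ oV); last exact: sa.
    exact: (smooth_dot oV sV sa sb).
  apply: (smooth_rowN oV); apply: (smooth_rowZ oV); last exact: se.
  exact: (smooth_dot oV sV se sb).
have sp := smooth_row_prd oV sV sa so.
apply: (smooth_rowD oV); first exact: (smooth_row_prd oV sV sa sp).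
by apply: (smooth_rowZ oV); [exact: smooth_cst|exact: sp].
Qed.

(** Positivity persists on a neighbourhood: it lets a nonzero eigenvector be
    normalised smoothly. *)
Lemma positive_near V (f : 'rV[R]_5 -> R) x : open V -> V x -> smooth_on V f ->
  0 < f x -> exists2 r : R, 0 < r & ball x r `<=` V /\ forall y, ball x r y -> 0 < f y.
Proof.
move=> oV Vx sf fx0; have [r1 r10 B1] := open_ball_sub oV Vx.
have [cf _] := smooth_C1 sf Vx.
have /nbhs_ballP[r2 /= r20 B2] := cf _ (nbhsx_ballx _ _ fx0).
exists (Num.min r1 r2); first by rewrite lt_min r10.
split=> [y xy|y xy].
  by apply: B1; apply: le_ball xy; rewrite ge_min lexx.
have := B2 y (le_ball _ xy); rewrite ge_min lexx orbT => /(_ isT).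
move=> h; have {}h : `|f x - f y| < f x by exact: h.
by have := ler_norm (f x - f y) => ?; lra.
Qed.

Variable rho : R.
Hypothesis rho_gt0 : 0 < rho.

Let av y := (2 * rho)^-1 *: trace_field S c X a y.

(** The trace field, divided by its constant length, is the vector e_4 of a
    frame, and the projections of two fixed basis vectors on the eigenspaces of
    Upsilon at e_4 give e_3 and e_5. All is smooth, since these projections are
    nonzero at x, hence near x. *)
Lemma canonical_coframe x : cim a x -> trace_norm S c X a x = (2 * rho) ^+ 2 ->
  trace_cubic S c X a x = 0 ->
  exists r th, [/\ 0 < r, adapted_on S a (ball x r) th &
    forall y s, ball x r y -> trad c s = 2 * rho * (X s a y *m (coframe_mx th y)^T) 0 o4].
Proof.
move=> ax hn hc; have [r0 r00 [B0 cst]] := trace_invariants_locally_constant hG ax.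
have rho2 : 2 * rho != 0 by rewrite mulf_neq0 ?lt0r_neq0.
set U := ball x r0; have oU : open U by exact: ball_open.
have Ux : U x by exact: ballxx.
have unit y : U y -> dot (g y) (av y) (av y) = 1.
  move=> Uy; have [E _] := cst y Uy.
  rewrite dotZl dotZr ?(point_sym (B0 _ Uy))// -[dot _ _ _]/(trace_norm S c X a y) E hn.
  by field; exact: lt0r_neq0.
have null y : U y -> dot (g y) (av y) (prd (g y) (Y y) (av y) (av y)) = 0.
  move=> Uy; have [_ E] := cst y Uy; have ay := B0 _ Uy.
  rewrite (dotC (point_sym ay)) (dot_prd (point_sym ay) (point_pos ay) (point_ups_sym ay)).
  have sY := point_ups_sym ay.
  rewrite trilinearZl (trilinear_swap12 _ _ _ sY) trilinearZl.
  rewrite (trilinear_swap23 _ _ _ sY) (trilinear_swap12 _ _ _ sY) trilinearZl.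
  by rewrite -[trilinear _ _ _ _]/(trace_cubic S c X a y) E hc !mulr0.
have sav : smooth_row U av.
  apply: (smooth_rowZ oU); first exact: smooth_cst.
  by move=> m; apply: smooth_sub B0 _; exact: trace_field_smooth.
pose k5 : R := sq3 / 2; pose k3 : R := - (sq3 / 2).
have nz k := eigen_proj_neq0 (point_sym ax) (point_pos ax) (point_ups_sym ax)
  (point_trace ax) (point_square ax) (unit x Ux) (null x Ux) k.
have [i5 p5] := nz k5; have [i3 p3] := nz k3.
pose ev k i y := eigen_proj (g y) (Y y) (av y) k (delta_mx 0 i).
have sev k i : smooth_row U (ev k i) by exact: (smooth_eigen_proj _ _ oU B0 sav).
have snn k i : smooth_on U (fun y => dot (g y) (ev k i y) (ev k i y))
  by exact: (smooth_dot oU B0 (sev k i) (sev k i)).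
have [r5 r50 [B5 pos5]] := positive_near oU Ux (snn k5 i5) (point_pos ax p5).
have [r3 r30 [B3 pos3]] := positive_near oU Ux (snn k3 i3) (point_pos ax p3).
pose r := Num.min r5 r3; have r0' : 0 < r by rewrite lt_min r50.
set V := ball x r; have oV : open V by exact: ball_open.
have V5 : V `<=` ball x r5 by apply: le_ball; rewrite ge_min lexx.
have V3 : V `<=` ball x r3 by apply: le_ball; rewrite ge_min lexx orbT.
have VU : V `<=` U by move=> y /V5/B5.
have Va : V `<=` cim a by move=> y /VU/B0.
pose nv k i y := (Num.sqrt (dot (g y) (ev k i y) (ev k i y)))^-1 *: ev k i y.
have snv k i : (forall y, V y -> 0 < dot (g y) (ev k i y) (ev k i y)) -> smooth_row V (nv k i).
  move=> pos; have sd := smooth_sub VU (snn k i).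
  apply: (smooth_rowZ oV); last by move=> m; apply: smooth_sub VU _; exact: sev.
  apply: (smoothV oV); first exact: (smooth_sqrt oV sd pos).
  by move=> y Vy; rewrite sqrtr_eq0 -ltNge pos.
have nv1 k i y : V y -> 0 < dot (g y) (ev k i y) (ev k i y) ->
    dot (g y) (nv k i y) (nv k i y) = 1.
  move=> Vy pos; rewrite dotZl dotZr ?(point_sym (Va _ Vy))//.
  rewrite mulrA -invfM -expr2 sqr_sqrtr ?(ltW pos)// mulVf ?lt0r_neq0//.
have nvE k i y : V y -> k ^+ 2 = 3 / 4 ->
    prd (g y) (Y y) (av y) (nv k i y) = k *: nv k i y.
  move=> Vy k2; have ay := Va _ Vy.
  rewrite prdZr prd_eigen_proj//; [|exact: point_sym|exact: point_pos
    |exact: point_ups_sym|exact: point_square|exact/unit/VU|exact/null/VU].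
  by rewrite !scalerA mulrC.
have k52 : k5 ^+ 2 = 3 / 4 by rewrite /k5; field: (sqrt3_sq R).
have k32 : k3 ^+ 2 = 3 / 4 by rewrite sqrrN k52.
pose E y := cubic_frame (g y) (Y y) (av y) (nv k3 i3 y) (nv k5 i5 y).
exists r, (fun i y => row i (E y *m g y)).
have coE y : coframe_mx (fun i y => row i (E y *m g y)) y = E y *m g y.
  by apply/row_matrixP => i; rewrite rowK.
have pos5' y : V y -> 0 < dot (g y) (ev k5 i5 y) (ev k5 i5 y) by move=> /V5/pos5.
have pos3' y : V y -> 0 < dot (g y) (ev k3 i3 y) (ev k3 i3 y) by move=> /V3/pos3.
have orth y : V y -> E y *m g y *m (E y)^T = 1%:M.
  move=> Vy; have ay := Va _ Vy.
  by apply: cubic_frame_orthonormal; [exact: point_sym|exact: point_pos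
    |exact: point_ups_sym|exact: point_square|exact/unit/VU|exact/null/VU
    |exact/nv1/pos3'|exact/nv1/pos5'|exact: nvE|exact: nvE].
have std y i j k : V y ->
    trilinear (Y y) (row i (E y)) (row j (E y)) (row k (E y)) = ups0 i j k.
  move=> Vy; have ay := Va _ Vy.
  by apply: cubic_frame_standard; [exact: point_sym|exact: point_pos
    |exact: point_ups_sym|exact: point_square|exact/unit/VU|exact/null/VU
    |exact/nv1/pos3'|exact/nv1/pos5'|exact: nvE|exact: nvE].
have sav' : smooth_row V av by move=> m; apply: smooth_sub VU _; exact: sav.
have sE i : smooth_row V (fun y => row i (E y)).
  have s5 : smooth_row V (nv k5 i5) by exact: snv.
  have s3 : smooth_row V (nv k3 i3) by exact: snv.
  have se := smooth_row_prd oV Va sav' sav'.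
  have s2 : smooth_row V (fun y => (2 / sq3) *: prd (g y) (Y y) (nv k3 i3 y) (nv k5 i5 y)).
    apply: (smooth_rowZ oV); first exact: smooth_cst.
    exact: (smooth_row_prd oV Va s3 s5).
  move=> m; apply: (smooth_ext oV (f := fun y => (nth 0 [::
     prd (g y) (Y y) (av y) (av y); (2 / sq3) *: prd (g y) (Y y) (nv k3 i3 y) (nv k5 i5 y);
     nv k3 i3 y; av y; nv k5 i5 y] i : 'rV[R]_5) 0 m)) => [y _|].
    by rewrite cubic_frameE.
  by elim/ord5_ind: i => /=; [exact: se|exact: s2|exact: s3|exact: sav'|exact: s5].
split; [exact: r0'| |].
  split; [exact: oV|exact: Va| |move=> y Vy].
    split=> [i m|y Vy].
      apply: (smooth_ext oV (f := fun y => (row i (E y) *m g y) 0 m)) => [y _|].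
        by rewrite row_mul.
      apply: (smooth_rowM oV) => [|p q]; first exact: sE.
      by apply: smooth_sub Va _; exact: metric_smooth.
    rewrite coE unitmx_mul (metric_unit S (Va _ Vy)) andbT.
    by have [] := mulmx1_unit (etrans (mulmxA _ _ _) (orth y Vy)).
  rewrite coE; have gs := point_sym (Va _ Vy).
  have EgE : (E y)^T *m (E y *m g y) = 1%:M by apply: mulmx1C; exact: orth.
  have gEE : (E y *m g y)^T *m E y = 1%:M.
    by rewrite trmx_mul gs; apply: mulmx1C; rewrite mulmxA orth.
  split=> [|v]; first by rewrite trmx_mul gs -mulmxA EgE mulmx1.
  rewrite -cubic_form_ups0.
  have -> : cubic_form (Y y) v = trilinear (Y y) v v v by [].
  rewrite -[v in LHS]mulmx1 -gEE mulmxA trilinear_change.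
  apply: eq_bigr => i _; apply: eq_bigr => j _; apply: eq_bigr => k _.
  by rewrite std.
move=> y s Vy; rewrite coE trmx_mul (point_sym (Va _ Vy)) mulmxA.
have -> : (X s a y *m g y *m (E y)^T) 0 o4 = dot (g y) (X s a y) (row o4 (E y)).
  rewrite /dot bilinearE [LHS]mxE [RHS]mxE; apply: eq_bigr => k _.
  by congr (_ * _); rewrite !mxE.
rewrite cubic_frameE /= dotC ?point_sym//; last exact: Va.
have ay := Va _ Vy; rewrite dotZl /dot trace_fieldE// (trace_formE hG s ay).
by rewrite mulrA divff// mul1r.
Qed.

End CanonicalCoframe.

(** * Constancy of the brackets in the invariant coframe *)

Section Invariance.
Variables (R : realType) (M : manifold R) (S : so3_structure M).
Variables (c : 'I_5 -> 'I_5 -> 'I_5 -> R).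
Variables (X : 'I_5 -> chart M -> 'rV[R]_5 -> 'rV[R]_5).
Hypothesis hG : transitive_symmetry_algebra S c X.
Variables (a : chart M) (V : set 'rV[R]_5) (th : 'I_5 -> 'rV[R]_5 -> 'rV[R]_5).
Hypothesis adV : adapted_on S a V th.
Variable rho : R.
Hypothesis rho_gt0 : 0 < rho.
Hypothesis th4 : forall y s, V y ->
  trad c s = 2 * rho * (X s a y *m (coframe_mx th y)^T) 0 o4.
Implicit Types (x y u v w : 'rV[R]_5).

Let rho2 : 2 * rho != 0. Proof. by rewrite mulf_neq0 ?lt0r_neq0. Qed.

Lemma th4_trace_form y : V y -> th o4 y = (2 * rho)^-1 *: trace_form c X a y.
Proof.
move=> Vy; have ay := adapted_cim adV Vy.
apply/eqP; rewrite -subr_eq0; apply/eqP; apply: (sym_span hG ay) => s.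
rewrite pairC -scaleNr pairDr pairZr !(pairC (X s a y)) (trace_formE hG s ay) (th4 s Vy).
by rewrite coords_pair mulrA mulNr mulVf// mulN1r subrr.
Qed.

(** The rotation by which X_s acts on the coframe kills theta^4, and no nonzero
    element of so(3) has a zero fourth row. *)
Lemma lie_form_invariant s i y : V y -> lie_form (X s a) (th i) y = 0.
Proof.
move=> Vy; have ay := adapted_cim adV Vy; have oV := adapted_open adV.
have L4 : lie_form (X s a) (th o4) y = 0.
  apply: pair_eq0 => v; rewrite lie_form_pair.
  have -> : row_along (X s a y) (th o4) y =
      (2 * rho)^-1 *: row_along (X s a y) (trace_form c X a) y.
    have db := smooth_row_partials (@trace_form_smooth _ _ _ c _ hG a) ay.
    apply/rowP => m; rewrite !mxE.
    rewrite (along_ext (g := fun z => (2 * rho)^-1 * trace_form c X a z 0 m) _ oV Vy).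
      by rewrite (alongM _ (@has_partials_cst R _ y) (db m)) along_cst mul0r add0r.
    by move=> z Vz; rewrite th4_trace_form// mxE.
  rewrite th4_trace_form// !(pairC (_ *: _)) !pairZr -mulrDr !(pairC _ (trace_form _ _ _ _)).
  by rewrite (pairC v) -lie_form_pair (lie_trace_form hG s ay) pair0l mulr0.
have [u uE] := lie_adapted hG adV s Vy.
have uT := adapted_unit adV Vy.
have A4 : row o4 (\sum_t u t *: Emx t : 'M[R]_5) = 0.
  rewrite -[LHS](mulmxK uT) -row_mul -uE.
  by rewrite rowK L4 mul0mx.
have z (j : 'I_5) : u q1 * E_coef 0 o4 j + u q2 * E_coef 1 o4 j + u q3 * E_coef 2 o4 j = 0.
  by rewrite -E_combE; move/rowP: A4 => /(_ j); rewrite !mxE.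
have := z o5; have := z o3; have := z o2; rewrite /= => z2 z3 z5.
have u1 : u q1 = 0 by lra.
have u2 : u q2 = 0 by lra.
have u3 : u q3 = 0 by lra.
have -> : lie_form (X s a) (th i) y = row i (lie_mx X a th s y) by rewrite rowK.
by rewrite uE sum3 u1 u2 u3 !scale0r !addr0 mul0mx row0.
Qed.

Let P y := symmetry_frame X a y (coframe_mx th y).

Lemma frame_unit y : V y -> P y \in unitmx.
Proof.
by move=> Vy; apply: (symmetry_frame_unit hG (adapted_cim adV Vy)); exact: (adapted_unit adV).
Qed.

Lemma frame_pair y s i : P y s i = pair (th i y) (X s a y).
Proof. by rewrite /P symmetry_frameE coords_pair. Qed.

Lemma frame_smooth s i : smooth_on V (fun y => P y s i).
Proof.
have oV := adapted_open adV; have Va : V `<=` cim a by move=> y; exact: (adapted_cim adV).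
have sth : forall i, smooth_row V (th i) by case: adV => _ _ [].
apply: (smooth_ext oV (f := fun y => \sum_m th i y 0 m * X s a y 0 m)) => [y _|].
  by rewrite frame_pair.
apply: (@smooth_sum _ _ _ _ _ oV) => m; apply: (smoothM oV); first exact: sth.
by apply: smooth_sub Va _; exact: (field_smooth hG).
Qed.

(** In an invariant coframe, the matrix theta^i(X_s) varies by the brackets. *)
Lemma along_frame r s i y : V y ->
  along (X r a y) (fun z => P z s i) y = \sum_u c r s u * P y u i.
Proof.
move=> Vy; have ay := adapted_cim adV Vy.
have dth := adapted_partials adV Vy.
have dX q : row_has_partials (X q a) y by exact: (symmetry_partials hG adV).
rewrite (_ : (fun z => _) = (fun z => pair (th i z) (X s a z))); last first.
  by apply/funext => z; exact: frame_pair.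
rewrite (along_pair _ (dth i) (dX s)).
have := lie_form_pair (X r a) (th i) y (X s a y).
rewrite lie_form_invariant// pair0l => h.
have : pair (th i y) (field_bracket (X r a) (X s a) y) =
    pair (row_along (X r a y) (th i) y) (X s a y)
    + pair (th i y) (row_along (X r a y) (X s a) y).
  rewrite field_bracket_along -scaleN1r pairDr pairZr.
  move: h; move: (pair _ _) (pair _ _) (pair _ _) => *; lra.
move=> <-; rewrite (field_closed hG)//.
elim: (index_enum _) => [|u q IH]; first by rewrite !big_nil pair0r.
by rewrite !big_cons pairDr pairZr IH frame_pair.
Qed.

Lemma bracket_skew y u v : V y -> bracket_of c u v = - bracket_of c v u.
Proof.
move=> Vy; have sk := structure_constants_skew hG (adapted_cim adV Vy).
apply/rowP => k; rewrite !mxE exchange_big -sumrN; apply: eq_bigr => i _ /=.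
rewrite -sumrN; apply: eq_bigr => j _; rewrite [c j i k]sk.
by move: (c i j k) (u 0 j) (v 0 i) => *; ring.
Qed.

Lemma bracket_bilinear u v l :
  bracket_of c u v 0 l = bilinear (\matrix_(p, q) c p q l) u v.
Proof.
rewrite mxE; apply: eq_bigr => i _; apply: eq_bigr => j _.
by rewrite mxE mulrC mulrA.
Qed.

Let n j y : 'rV[R]_5 := row j (invmx (P y)).

Lemma dual_smooth j : smooth_row V (n j).
Proof.
have oV := adapted_open adV; move=> m.
apply: (smooth_ext oV (f := fun y => invmx (P y) j m)) => [y _|]; first by rewrite mxE.
by apply: (smooth_invmx oV); [exact: frame_smooth|exact: frame_unit].
Qed.

Lemma along_dual r j y : V y ->
  row_along (X r a y) (n j) y = - bracket_of c (delta_mx 0 r) (n j y).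
Proof.
move=> Vy; have oV := adapted_open adV; have uP := frame_unit Vy.
have dn := smooth_row_partials (dual_smooth j) Vy.
have dP (s i : 'I_5) := smooth_has_partials (frame_smooth s i) Vy.
have E : row_along (X r a y) (n j) y *m P y =
    - bracket_of c (delta_mx 0 r) (n j y) *m P y.
  apply/rowP => i.
  have : along (X r a y) (fun z => \sum_u n j z 0 u * P z u i) y = 0.
    rewrite (along_ext (g := fun=> (j == i)%:R) _ oV Vy) ?along_cst// => z Vz.
    have /rowP/(_ i) : n j z *m P z = delta_mx 0 j.
      by rewrite /n -row_mul mulVmx ?frame_unit// rowE mulmx1.
    by rewrite !mxE eqxx eq_sym.
  rewrite along_sum => [|u]; last exact: has_partialsM (dn u) (dP u i).
  under eq_bigr => u _ do rewrite (alongM _ (dn u) (dP u i)) along_frame//.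
  rewrite big_split /= => /eqP; rewrite addr_eq0 => /eqP h.
  rewrite mxE; under eq_bigr => u _ do rewrite mxE.
  rewrite h mulNmx [RHS]mxE; congr (- _).
  rewrite [n j y in RHS]row_sum_delta bracket_sumr mulmx_suml summxE.
  apply: eq_bigr => u _; rewrite bracketZr -scalemxAl [RHS]mxE; congr (_ * _).
  by rewrite mxE; apply: eq_bigr => l _; rewrite bracket_delta.
by rewrite -[LHS](mulmxK uP) E mulmxK.
Qed.

(** By the Jacobi identity the brackets of the symmetries have constant
    coefficients in an invariant frame. *)
Lemma frame_brackets_constant x r : 0 < r -> V = ball x r ->
  exists C, forall y, V y -> intertwines (P y) c C.
Proof.
move=> r0 VE; have oV := adapted_open adV.
pose D y (j k i : 'I_5) := (bracket_of c (n j y) (n k y) *m P y) 0 i.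
have DH y : V y -> intertwines (P y) c (D y).
  move=> Vy u v; apply/rowP => i; have uP := frame_unit Vy.
  have back (w : 'rV[R]_5) : w = \sum_j (w *m P y) 0 j *: n j y.
    rewrite -[LHS](mulmxK uP) mulmx_sum_row.
    by apply: eq_bigr => j _; exact: erefl.
  rewrite {1}(back u) {1}(back v) bracket_suml mulmx_suml summxE [RHS]mxE.
  apply: eq_bigr => j _; rewrite bracket_sumr mulmx_suml summxE; apply: eq_bigr => k _.
  by rewrite bracketZl bracketZr -!scalemxAl [LHS]mxE [X in _ * X = _]mxE mulrA.
have Vx : V x by rewrite VE; exact: ballxx.
exists (D x) => y Vy; apply: intertwines_eqr (DH y Vy) => j k i.
have dn (q : 'I_5) z (Vz : V z) := smooth_row_partials (dual_smooth q) Vz.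
have dP (u : 'I_5) z (Vz : V z) := smooth_has_partials (frame_smooth u i) Vz.
pose f z := \sum_l bracket_of c (n j z) (n k z) 0 l * P z l i.
have fE z : D z j k i = f z by rewrite /D mxE.
rewrite !fE; have rV : ball x r `<=` V by rewrite VE.
have sf : smooth_on V f.
  apply: (@smooth_sum _ _ _ _ _ oV) => l; apply: (smoothM oV); last exact: frame_smooth.
  apply: (smooth_ext oV (f := fun z => bilinear (\matrix_(p, q) c p q l) (n j z) (n k z))).
    by move=> z _; rewrite bracket_bilinear.
  rewrite /bilinear; apply: (@smooth_sum _ _ _ _ _ oV) => p.
  apply: (@smooth_sum _ _ _ _ _ oV) => q; apply: (smoothM oV); last exact: dual_smooth.
  by apply: (smoothM oV); [exact: smooth_cst|exact: dual_smooth].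
apply: (constant_on_ball rV (smooth_C1 sf)); last by rewrite -VE.
move=> m z Vz; apply: (partial_eq0 hG (adapted_cim adV Vz)) => s.
have cst p q : has_partials (fun=> (\matrix_(i, j) c i j p : 'M[R]_5) q.1 q.2) z.
  exact: has_partials_cst.
have db l : has_partials (fun y => bilinear (\matrix_(p, q) c p q l) (n j y) (n k y)) z.
  apply: has_partials_sum => p; apply: has_partials_sum => q.
  exact: (has_partialsM (has_partialsM (cst l (p, q)) (dn j z Vz p)) (dn k z Vz q)).
have -> : f = fun z => \sum_l bilinear (\matrix_(p, q) c p q l) (n j z) (n k z) * P z l i.
  by apply/funext => z'; apply: eq_bigr => l _; rewrite bracket_bilinear.
rewrite along_sum => [|l]; last exact: has_partialsM (db l) (dP l z Vz).
have c0 (l : 'I_5) : forall p q, has_partials (fun=> (\matrix_(i, j) c i j l : 'M[R]_5) p q) z.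
  by move=> p q; exact: (cst l (p, q)).
have mx0 (l : 'I_5) :
    \matrix_(p, q) along (X s a z) (fun=> (\matrix_(i, j) c i j l : 'M[R]_5) p q) z = 0.
  by apply/matrixP => p q; rewrite !mxE along_cst.
under eq_bigr => l _.
  rewrite (alongM _ (db l) (dP l z Vz)).
  rewrite (along_bilinear (g := fun=> \matrix_(p, q) c p q l) _ (c0 l) (dn j z Vz) (dn k z Vz)).
  rewrite mx0 bilinear_mx0 add0r -!bracket_bilinear along_frame// !along_dual//.
  over.
rewrite big_split /=.
set B1 := bracket_of c (delta_mx 0 s) (n j z); set B2 := bracket_of c (delta_mx 0 s) (n k z).
set w := bracket_of c (n j z) (n k z).
have e1 : \sum_l (bracket_of c (- B1) (n k z) 0 l + bracket_of c (n j z) (- B2) 0 l) * P z l i =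
   ((bracket_of c (- B1) (n k z) + bracket_of c (n j z) (- B2)) *m P z) 0 i.
  by rewrite [RHS]mxE; apply: eq_bigr => l _; rewrite [in RHS]mxE.
have e2 : \sum_l w 0 l * (\sum_u c s l u * P z u i) = (bracket_of c (delta_mx 0 s) w *m P z) 0 i.
  rewrite [w in RHS]row_sum_delta bracket_sumr mulmx_suml summxE.
  apply: eq_bigr => u _; rewrite bracketZr -scalemxAl [RHS]mxE; congr (_ * _).
  by rewrite mxE; apply: eq_bigr => l _; rewrite bracket_delta.
rewrite e1 e2.
have -> : bracket_of c (- B1) (n k z) + bracket_of c (n j z) (- B2) =
   - bracket_of c (delta_mx 0 s) w.
  have J := structure_constants_jacobi hG (adapted_cim adV Vz) (delta_mx 0 s) (n j z) (n k z).
  have sk p q := bracket_skew p q Vz.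
  rewrite -[- B1]scaleN1r bracketZl scaleN1r (sk (n j z)) -[- B2]scaleN1r bracketZl scaleN1r opprK.
  rewrite (sk (delta_mx 0 s) w) opprK.
  move: J; rewrite -/B1 -/w (sk (n k z) (delta_mx 0 s)) -/B2 -[- B2]scaleN1r bracketZl scaleN1r.
  move=> J; apply/eqP; rewrite -subr_eq0 -oppr_eq0 !opprD !opprK; apply/eqP.
  by rewrite addrAC.
by rewrite mulNmx [X in X + _]mxE addNr.
Qed.

End Invariance.

(** * Elements of SO(3) fixing the fourth axis *)

Section SignChanges.
Variable R : realType.
Implicit Types (u v z : 'rV[R]_5) (O : 'M[R]_5).

Definition sign_row (s2 s3 s5 : R) : 'rV[R]_5 :=
  \row_(j < 5) nth 0 [:: 1; s2; s3; 1; s5] j.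

Definition sign_mx s2 s3 s5 : 'M[R]_5 := diag_mx (sign_row s2 s3 s5).

Lemma sign_mxE s2 s3 s5 u j : (u *m sign_mx s2 s3 s5) 0 j = sign_row s2 s3 s5 0 j * u 0 j.
Proof. by rewrite /sign_mx mul_mx_diag mxE mulrC. Qed.

Lemma sign_mx_tr s2 s3 s5 : (sign_mx s2 s3 s5)^T = sign_mx s2 s3 s5.
Proof. exact: tr_diag_mx. Qed.

Section Signs.
Variables s2 s3 s5 : R.
Hypotheses (h3 : s3 ^+ 2 = 1) (h5 : s5 ^+ 2 = 1) (h2 : s2 = s3 * s5).

Lemma sign_mx_SO3 : in_SO3 (sign_mx s2 s3 s5).
Proof.
split=> [|z]; rewrite sign_mx_tr.
  apply/row_matrixP => i; apply/rowP => j; rewrite row_mul sign_mxE !mxE h2.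
  by elim/ord5_ind: i; elim/ord5_ind: j; rewrite /= ?mulr0n ?mulr1n; ring: h3 h5.
rewrite /ups0_form -[Num.sqrt 3]/(@sq3 R) !sign_mxE !mxE /= h2.
move: (z 0 o1) (z 0 o2) (z 0 o3) (z 0 o4) (z 0 o5) => z1 z2 z3 z4 z5.
by field: h3 h5.
Qed.

(** The sign of epsilon depends on the orientation of theta^2. *)
Lemma sign_std_bracket rho w del :
  intertwines (sign_mx s2 s3 s5) (std_bracket rho 0 w del)
    (std_bracket rho 0 (s2 * w) del).
Proof.
move=> u v; apply/rowP => i; rewrite sign_mxE.
have [e1 e2 e3 e4 e5] := std_bracketE rho 0 w del u v.
have [f1 f2 f3 f4 f5] := std_bracketE rho 0 (s2 * w) del
  (u *m sign_mx s2 s3 s5) (v *m sign_mx s2 s3 s5).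
elim/ord5_ind: i; rewrite ?(e1, e2, e3, e4, e5) ?(f1, f2, f3, f4, f5) /minor2 !sign_mxE !mxE /= h2;
  move: (u 0 o1) (u 0 o2) (u 0 o3) (u 0 o4) (u 0 o5) => u1 u2 u3 u4 u5;
  move: (v 0 o1) (v 0 o2) (v 0 o3) (v 0 o4) (v 0 o5) => v1 v2 v3 v4 v5; by field: h3 h5.
Qed.

End Signs.

Lemma in_SO3_trilinear O u v w : in_SO3 O ->
  trilinear ups0 (u *m O^T) (v *m O^T) (w *m O^T) = trilinear ups0 u v w.
Proof.
move=> [_ h]; rewrite !(trilinear_polar _ _ _ (@ups0_sym R)) !cubic_form_ups0.
by rewrite -!mulmxDl !h.
Qed.

(** The endomorphism Upsilon_v attached to v = e_4 has eigenvalues 1, -1, 0 and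
    sqrt 3 / 2, - sqrt 3 / 2, all simple; an element of SO(3) fixing e_4 commutes
    with it, hence is diagonal up to the plane e_1, e_4, where it is trivial. *)
Lemma SO3_fixing_o4 O : in_SO3 O -> row o4 O = delta_mx 0 o4 ->
  exists s2 s3 s5, [/\ s3 ^+ 2 = 1, s5 ^+ 2 = 1, s2 = s3 * s5 & O = sign_mx s2 s3 s5].
Proof.
move=> SO O4; have [OO up] := SO; have OO' := rot_orthogonal OO.
have O4' : delta_mx 0 o4 *m O^T = delta_mx 0 o4 :> 'rV[R]_5.
  by rewrite -[X in X *m _]O4 rowE -mulmxA OO mulmx1.
have r4 (j : 'I_5) : O o4 j = (j == o4)%:R.
  by move/rowP: O4 => /(_ j); rewrite !mxE eqxx.
have c4 (i : 'I_5) : O i o4 = (i == o4)%:R.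
  by move/rowP: O4' => /(_ i); rewrite -rowE !mxE eqxx.
have de (A : 'M[R]_5) (i l : 'I_5) : ((delta_mx 0 i : 'rV[R]_5) *m A) 0 l = A i l.
  by rewrite -rowE mxE.
have lam (u : 'rV[R]_5) (j : 'I_5) :
    trilinear ups0 (delta_mx 0 o4) u (delta_mx 0 j) = \sum_l u 0 l * ups_coef 3 l j.
  rewrite (trilinear_swap12 _ _ _ (@ups0_sym R)) trilinear_deltal.
  apply: eq_bigr => l _; congr (_ * _); rewrite ups0E.
  by case: (ups_coef_sym R l o4 j).
have E (i j : 'I_5) :
    \sum_l O l i * ups_coef 3 l j = \sum_l O j l * ups_coef 3 l i :> R.
  have := in_SO3_trilinear (delta_mx 0 o4) (delta_mx 0 i) (delta_mx 0 j *m O) SO.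
  rewrite O4' -mulmxA OO mulmx1 lam (trilinear_swap23 _ _ _ (@ups0_sym R)) lam => h.
  transitivity (\sum_l ((delta_mx 0 i : 'rV[R]_5) *m O^T) 0 l * ups_coef 3 l j).
    by apply: eq_bigr => l _; rewrite de mxE.
  by rewrite h; apply: eq_bigr => l _; rewrite de.
have s0 := sqrt3_gt0 R.
have Z (x : R) : sq3 * x = 0 -> x = 0.
  by move=> /eqP; rewrite mulf_eq0 (gt_eqF s0) => /eqP.
have [c14 c24] : O o1 o4 = 0 /\ O o2 o4 = 0 by rewrite !c4.
have [c34 c54] : O o3 o4 = 0 /\ O o5 o4 = 0 by rewrite !c4.
have [r41 r42] : O o4 o1 = 0 /\ O o4 o2 = 0 by rewrite !r4.
have [r43 r45] : O o4 o3 = 0 /\ O o4 o5 = 0 by rewrite !r4.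
have r44 : O o4 o4 = 1 by rewrite r4.
have e (i j : 'I_5) : O o1 i * ups_coef 3 o1 j + O o2 i * ups_coef 3 o2 j + O o3 i * ups_coef 3 o3 j
   + O o4 i * ups_coef 3 o4 j + O o5 i * ups_coef 3 o5 j =
   O j o1 * ups_coef 3 o1 i + O j o2 * ups_coef 3 o2 i + O j o3 * ups_coef 3 o3 i
   + O j o4 * ups_coef 3 o4 i + O j o5 * ups_coef 3 o5 i.
  by move: (E i j); rewrite !sum5.
have x12 : O o1 o2 = 0 by have := e o2 o4; rewrite /= => ?; lra.
have x13 : O o1 o3 = 0 by have := e o3 o4; rewrite /= r43 => ?; lra.
have x15 : O o1 o5 = 0 by have := e o5 o4; rewrite /= r45 => ?; lra.
have x11 : O o1 o1 = 1 by have := e o1 o4; rewrite /= r44 => ?; lra.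
have x21 : O o2 o1 = 0 by have := e o4 o2; rewrite /= => ?; lra.
have x32 : O o3 o2 = 0 by apply: Z; have := e o2 o3; rewrite /= => ?; lra.
have x52 : O o5 o2 = 0 by apply: Z; have := e o2 o5; rewrite /= => ?; lra.
have x31 : O o3 o1 = 0 by apply: Z; have := e o1 o3; rewrite /= c34 => ?; lra.
have x51 : O o5 o1 = 0 by apply: Z; have := e o1 o5; rewrite /= c54 => ?; lra.
have x23 : O o2 o3 = 0 by apply: Z; have := e o3 o2; rewrite /= => ?; lra.
have x25 : O o2 o5 = 0 by apply: Z; have := e o5 o2; rewrite /= => ?; lra.
have x53 : O o5 o3 = 0 by apply: Z; have := e o3 o5; rewrite /= => ?; lra.
have x35 : O o3 o5 = 0 by apply: Z; have := e o5 o3; rewrite /= => ?; lra.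
have unitrow (i : 'I_5) : O i o1 ^+ 2 + O i o2 ^+ 2 + O i o3 ^+ 2 + O i o4 ^+ 2 + O i o5 ^+ 2 = 1.
  have /matrixP/(_ i i) := OO; rewrite !mxE eqxx mulr1n => <-.
  by rewrite sum5 !mxE !expr2.
have h3 : O o3 o3 ^+ 2 = 1 by have := unitrow o3; rewrite x31 x32 c34 x35 => ?; lra.
have h5 : O o5 o5 ^+ 2 = 1 by have := unitrow o5; rewrite x51 x52 x53 c54 => ?; lra.
have := in_SO3_trilinear (delta_mx 0 o2) (delta_mx 0 o3) (delta_mx 0 o5) SO.
have dE (i : 'I_5) : (delta_mx 0 i : 'rV[R]_5) *m O^T = \sum_j O j i *: delta_mx 0 j.
  by rewrite [LHS]row_sum_delta; apply: eq_bigr => j _; rewrite de mxE.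
rewrite !dE !sum5 x12 x32 x52 r42 x13 x23 x53 r43 x15 x25 x35 r45.
rewrite !scale0r !add0r !addr0 trilinearZl (trilinear_swap12 _ _ _ (@ups0_sym R)) trilinearZl.
rewrite (trilinear_swap12 _ _ _ (@ups0_sym R)) (trilinear_swap23 _ _ _ (@ups0_sym R)).
rewrite (trilinear_swap12 _ _ _ (@ups0_sym R)) trilinearZl.
rewrite (trilinear_swap12 _ _ _ (@ups0_sym R)) (trilinear_swap23 _ _ _ (@ups0_sym R)).
rewrite trilinear_delta ups0E /= => h.
exists (O o2 o2), (O o3 o3), (O o5 o5); split=> //.
  have p1 : O o2 o2 * (O o3 o3 * O o5 o5) = 1.
    apply: (mulIf (lt0r_neq0 s0)); move: h.
    by move: (O o2 o2) (O o3 o3) (O o5 o5) => *; lra.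
  rewrite -[LHS]mulr1 -h3 -[X in _ * X]mulr1 -h5.
  by move: p1; move: (O o2 o2) (O o3 o3) (O o5 o5) => x y z p1; ring: p1.
apply/matrixP => i j; rewrite /sign_mx mxE mxE.
elim/ord5_ind: i; elim/ord5_ind: j; rewrite /= ?mulr0n ?mulr1n //.
Qed.

End SignChanges.

(** * From one point to the whole manifold *)

Section Homogeneity.
Variables (R : realType) (M : manifold R) (S : so3_structure M).
Variables (c : 'I_5 -> 'I_5 -> 'I_5 -> R).
Variables (X : 'I_5 -> chart M -> 'rV[R]_5 -> 'rV[R]_5).
Hypothesis hG : transitive_symmetry_algebra S c X.
Variables (rho w del : R).
Hypothesis rho_gt0 : 0 < rho.
Implicit Types (a b : chart M) (x y u v : 'rV[R]_5) (Th O : 'M[R]_5).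

Let rho2 : 2 * rho != 0. Proof. by rewrite mulf_neq0 ?lt0r_neq0. Qed.

Definition std_at a x Th : Prop :=
  [/\ adapted_at S a x Th, Th \in unitmx &
      intertwines (symmetry_frame X a x Th) c (std_bracket rho 0 w del)].

Lemma adapted_at_gauge a x Th O : in_SO3 O -> adapted_at S a x Th ->
  adapted_at S a x (O *m Th).
Proof.
move=> [OO up] [gE cE]; split=> [|v].
  by rewrite gE trmx_mul -mulmxA (mulmxA O^T) (rot_orthogonal OO) mul1mx.
by rewrite cE trmx_mul mulmxA up.
Qed.

Lemma symmetry_frame_gauge a x Th O :
  symmetry_frame X a x (O *m Th) = symmetry_frame X a x Th *m O^T.
Proof. by rewrite /symmetry_frame trmx_mul mulmxA. Qed.

Lemma adapted_change a x Th Th' : adapted_at S a x Th -> adapted_at S a x Th' ->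
  Th' \in unitmx -> exists2 O, in_SO3 O & Th = O *m Th'.
Proof.
move=> [gE cE] [gE' cE'] u'; exists (Th *m invmx Th'); last by rewrite mulmxKV.
have I : invmx Th'^T *m (Th^T *m Th) *m invmx Th' = 1%:M.
  by rewrite -gE gE' mulmxA mulVmx ?unitmx_tr// mul1mx mulmxV.
have OO : (Th *m invmx Th')^T *m (Th *m invmx Th') = 1%:M.
  by rewrite -I trmx_mul trmx_inv !mulmxA.
split; first exact: mulmx1C.
by move=> z; rewrite trmx_mul mulmxA -cE cE' trmx_inv mulmxKV ?unitmx_tr.
Qed.

Lemma trad_std : trad (std_bracket rho 0 w del) o4 = 2 * rho /\
  forall j : 'I_5, j != o4 -> trad (std_bracket rho 0 w del) j = 0.
Proof.
split=> [|j]; first by rewrite /trad sum5 /std_bracket /=; field.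
by elim/ord5_ind: j => // _; rewrite /trad sum5 /std_bracket /=; field.
Qed.

Lemma trad_std_frame P : P \in unitmx -> intertwines P c (std_bracket rho 0 w del) ->
  forall s, trad c s = 2 * rho * P s o4.
Proof.
move=> uP iP s; have [t4 t0] := trad_std.
rewrite (trad_intertwines uP iP) (bigD1 o4)//= t4 big1 ?addr0 1?mulrC// => j j4.
by rewrite t0 ?mulr0.
Qed.

(** Among the basis vectors of the standard algebra, only e_4 has an ad of
    nonzero trace, 2 rho. *)
Lemma std_trace_form a x Th : cim a x -> std_at a x Th ->
  trace_form c X a x = (2 * rho) *: row o4 Th.
Proof.
move=> ax [_ uT iP]; apply/eqP; rewrite -subr_eq0; apply/eqP; apply: (sym_span hG ax) => s.
rewrite pairC -scaleNr pairDr pairZr !(pairC (X s a x)) (trace_formE hG s ax).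
rewrite (trad_std_frame (symmetry_frame_unit hG ax uT) iP s).
have -> : pair (row o4 Th) (X s a x) = symmetry_frame X a x Th s o4.
  rewrite /symmetry_frame mxE; apply: eq_bigr => m _.
  by rewrite !mxE mulrC.
by rewrite mulNr subrr.
Qed.

Lemma std_trace_field a x Th : cim a x -> std_at a x Th ->
  trace_field S c X a x *m Th^T = (2 * rho) *: delta_mx 0 o4.
Proof.
move=> ax sT; have [[gE _] uT _] := sT.
rewrite /trace_field (std_trace_form ax sT) gE -scalemxAl.
have uTT : Th^T \in unitmx by rewrite unitmx_tr.
have -> : invmx (Th^T *m Th) = invmx Th *m invmx Th^T.
  have uTp : Th^T *m Th \in unitmx by rewrite unitmx_mul uTT.
  apply: (can_inj (mulKmx uTp)); rewrite mulmxV// !mulmxA.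
  by rewrite -(mulmxA Th^T) mulmxV// mulmx1 mulmxV.
by rewrite -scalemxAl rowE !mulmxA mulmxK// mulmxKV.
Qed.

Lemma std_trace_invariants a x Th : cim a x -> std_at a x Th ->
  trace_norm S c X a x = (2 * rho) ^+ 2 /\ trace_cubic S c X a x = 0.
Proof.
move=> ax sT; have [aT _ _] := sT; split.
  rewrite /trace_norm (adapted_bilinear _ _ aT) (std_trace_field ax sT).
  rewrite bilinearE mulmx1 linearZ /= -scalemxAl -scalemxAr trmx_delta mul_delta_mx.
  by rewrite !mxE /= mulr1 expr2.
rewrite /trace_cubic; have [_ ->] := aT; rewrite (std_trace_field ax sT).
by rewrite /ups0_form !mxE /=; ring.
Qed.

(** A coframe with the canonical fourth covector and a standard one have the
    same fourth covector, so that they differ by a sign matrix. *)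
Lemma canonical_std a x Th Th' : cim a x -> adapted_at S a x Th -> std_at a x Th' ->
  (forall s, trad c s = 2 * rho * symmetry_frame X a x Th s o4) ->
  exists s2 s3 s5, [/\ s3 ^+ 2 = 1, s5 ^+ 2 = 1, s2 = s3 * s5 &
    intertwines (symmetry_frame X a x Th) c (std_bracket rho 0 (s2 * w) del)].
Proof.
move=> ax aT [aT' uT' iP] tE.
have [ O SO OE] := adapted_change aT aT' uT'.
have uP := symmetry_frame_unit hG ax uT'.
have O4 : row o4 O = delta_mx 0 o4.
  apply: trmx_inj; rewrite tr_row trmx_delta.
  apply: (can_inj (mulKmx uP)); rewrite [in LHS]colE mulmxA -symmetry_frame_gauge -OE -!colE.
  apply/colP => s; rewrite [LHS]mxE [RHS]mxE; apply: (mulfI rho2).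
  by rewrite -tE (trad_std_frame uP iP).
have [s2 [s3 [s5 [h3 h5 h2 SE]]]] := SO3_fixing_o4 SO O4.
exists s2, s3, s5; split=> //.
rewrite OE symmetry_frame_gauge SE sign_mx_tr.
exact: intertwines_trans iP (sign_std_bracket h3 h5 h2 rho w del).
Qed.

Lemma std_at_flip a x Th s2 s3 s5 : s3 ^+ 2 = 1 -> s5 ^+ 2 = 1 -> s2 = s3 * s5 ->
  adapted_at S a x Th -> Th \in unitmx ->
  intertwines (symmetry_frame X a x Th) c (std_bracket rho 0 (s2 * w) del) ->
  std_at a x (sign_mx s2 s3 s5 *m Th).
Proof.
move=> h3 h5 h2 aT uT iP; have SO := sign_mx_SO3 h3 h5 h2; have [OO _] := SO.
have h22 : s2 * (s2 * w) = w by rewrite h2; ring: h3 h5.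
split; first exact: adapted_at_gauge.
  by rewrite unitmx_mul uT andbT; have [] := mulmx1_unit OO.
rewrite symmetry_frame_gauge sign_mx_tr -[in X in intertwines _ _ X]h22.
exact: intertwines_trans iP (sign_std_bracket h3 h5 h2 rho (s2 * w) del).
Qed.

Definition std_coframe a x r (th : 'I_5 -> 'rV[R]_5 -> 'rV[R]_5) : Prop :=
  [/\ adapted_on S a (ball x r) th,
      forall s i y, ball x r y -> lie_form (X s a) (th i) y = 0 &
      forall y, ball x r y -> std_at a y (coframe_mx th y)].

Lemma lie_formZ k (Z f : 'rV[R]_5 -> 'rV[R]_5) x : row_has_partials f x ->
  lie_form Z (fun y => k *: f y) x = k *: lie_form Z f x.
Proof.
move=> df; apply/rowP => m; rewrite !mxE mulr_sumr; apply: eq_bigr => r _.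
have -> : partial r (fun y => (k *: f y) 0 m) x = k * partial r (fun y => f y 0 m) x.
  rewrite /partial (_ : (fun y => (k *: f y) 0 m) = k \*: (fun y => f y 0 m)); last first.
    by apply/funext => y; rewrite mxE.
  by rewrite deriveZ//; exact: df.
by rewrite mxE mulrDr !mulrA (mulrC (Z x 0 r)).
Qed.

Lemma sign_coframe a V th s2 s3 s5 :
  s3 ^+ 2 = 1 -> s5 ^+ 2 = 1 -> s2 = s3 * s5 -> adapted_on S a V th ->
  (forall s i y, V y -> lie_form (X s a) (th i) y = 0) ->
  exists th', [/\ forall y, coframe_mx th' y = sign_mx s2 s3 s5 *m coframe_mx th y,
    adapted_on S a V th' & forall s i y, V y -> lie_form (X s a) (th' i) y = 0].
Proof.
move=> h3 h5 h2 adV L; have SO := sign_mx_SO3 h3 h5 h2; have [OO _] := SO.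
exists (fun i y => sign_row s2 s3 s5 0 i *: th i y).
have E y : coframe_mx (fun i y => sign_row s2 s3 s5 0 i *: th i y) y =
    sign_mx s2 s3 s5 *m coframe_mx th y.
  by apply/row_matrixP => i; rewrite rowK /sign_mx mul_diag_mx; apply/rowP => j; rewrite !mxE.
split=> // [|s i y Vy]; last first.
  by rewrite lie_formZ ?L ?scaler0//; exact: (adapted_partials adV).
have [oV sV [sth uth] at_] := adV; split; [exact: oV|exact: sV| |].
  split=> [i|y Vy]; last first.
    by rewrite E unitmx_mul uth// andbT; have [] := mulmx1_unit OO.
  by apply: (smooth_rowZ oV); [exact: smooth_cst|exact: sth].
move=> y Vy; rewrite E; exact: adapted_at_gauge SO (at_ y Vy).
Qed.

(** If the invariants of the trace form do not have the standard values at x,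
    they do not near x, and no point near x has a standard frame. Otherwise
    the canonical coframe exists near x, with constant brackets: they are
    standard everywhere as soon as they are at one point. *)
Lemma local_dichotomy a x : cim a x -> exists r,
  [/\ 0 < r, ball x r `<=` cim a &
    (forall y, ball x r y -> ~ exists Th, std_at a y Th) \/
    exists th, std_coframe a x r th].
Proof.
move=> ax.
have [[nx cx]|nx] := pselect (trace_norm S c X a x = (2 * rho) ^+ 2 /\
    trace_cubic S c X a x = 0); last first.
  have [r r0 [sr E]] := trace_invariants_locally_constant hG ax.
  exists r; split=> //; left=> y By [Th sT]; apply: nx.
  by have [<- <-] := E y By; exact: (std_trace_invariants (sr y By) sT).
have [r [th [r0 adV tE]]] := canonical_coframe hG rho_gt0 ax nx cx.
have sr : ball x r `<=` cim a by move=> y; exact: (adapted_cim adV).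
exists r; split=> //.
have [[y [By [Th sT]]]|no] := pselect (exists y, ball x r y /\ exists Th, std_at a y Th);
  last by left=> y By sT; apply: no; exists y.
right.
have tE' s z : ball x r z -> trad c s = 2 * rho * symmetry_frame X a z (coframe_mx th z) s o4.
  by move=> Bz; rewrite symmetry_frameE; exact: tE.
have [C iC] := frame_brackets_constant hG adV rho_gt0 (fun z s => tE z s) r0 erefl.
have ty s := tE' s y By.
have [s2 [s3 [s5 [h3 h5 h2 iy]]]] := canonical_std (sr y By) (adapted_on_at adV By) sT ty.
have CE := intertwines_inj (frame_unit hG adV By) (iC y By) iy.
have L s i z (Bz : ball x r z) := lie_form_invariant hG adV rho_gt0 (fun z s => tE z s) s i Bz.
have [th' [E adV' L']] := sign_coframe h3 h5 h2 adV L.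
exists th'; split=> // z Bz; rewrite E.
apply: std_at_flip h3 h5 h2 (adapted_on_at adV Bz) (adapted_unit adV Bz) _.
exact: intertwines_eqr CE (iC z Bz).
Qed.

(** Tensoriality: a coframe is pulled back by the Jacobian matrix of the change
    of charts, and the components theta^i(X_s) do not change. *)
Lemma std_at_chart a b x Th : overlap a b x -> std_at b (transition a b x) Th ->
  exists Th', std_at a x Th'.
Proof.
move=> abx [[gE cE] uT iP]; set J := Defs.jacobian a b x.
have ax : cim a x by case: abx => p [pa _] <-; exists p.
have gT : metric S a x = (Th *m J)^T *m (Th *m J).
  by rewrite (metric_tensor S abx) gE trmx_mul !mulmxA.
exists (Th *m J); split; last 2 first.
- have := metric_unit S ax; rewrite gT unitmx_mul.
  by case/andP.
- have -> : symmetry_frame X a x (Th *m J) = symmetry_frame X b (transition a b x) Th.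
    rewrite /symmetry_frame trmx_mul mulmxA; congr (_ *m _).
    by apply/row_matrixP => s; rewrite row_mul !rowK (field_vector hG s abx).
  exact: iP.
split=> // v; rewrite trmx_mul mulmxA -cE.
rewrite -[LHS]/(trilinear (ups S a x) v v v).
rewrite -[RHS]/(trilinear (ups S b (transition a b x)) _ _ _) trilinear_change.
apply: eq_bigr => i _; apply: eq_bigr => j _; apply: eq_bigr => k _.
congr (_ * _ * _ * _); rewrite (ups_tensor S i j k abx).
apply: eq_bigr => p _; apply: eq_bigr => q _; apply: eq_bigr => r _.
by rewrite !mxE.
Qed.

Definition std_point (p : M) : Prop :=
  exists a Th, cdom a p /\ std_at a (chart_coord a p) Th.

Lemma std_point_chart p b : std_point p -> cdom b p ->
  exists Th, std_at b (chart_coord b p) Th.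
Proof.
move=> [a [Th [pa sT]]] pb; apply: (std_at_chart (b := a) (Th := Th)); first by exists p.
by rewrite /transition coordK.
Qed.

Lemma std_point_coframe p b : std_point p -> cdom b p ->
  exists r th, 0 < r /\ std_coframe b (chart_coord b p) r th.
Proof.
move=> sp pb; have bx : cim b (chart_coord b p) by exists p.
have [r [r0 _ [no|[th H]]]] := local_dichotomy bx; last by exists r, th.
by exfalso; apply: (no _ _ (std_point_chart sp pb)); exact: ballxx.
Qed.

Lemma std_point_near p : nbhs p std_point \/ @nbhs (pts M) (pts M) p (~` std_point).
Proof.
have [b pb] := cdom_cover p; have bx : cim b (chart_coord b p) by exists p.
have [r [r0 _ H]] := local_dichotomy bx.
have nb : nbhs p (cdom b) by apply: open_nbhs_nbhs; split=> //; exact: cdom_open.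
have nB : nbhs p (chart_coord b @^-1` ball (chart_coord b p) r).
  have nB : nbhs (chart_coord b p) (ball (chart_coord b p) r) by exact: nbhsx_ballx.
  exact: (Defs.coord_continuous pb nB).
case: H => [no|[th [_ _ H]]]; [right|left]; apply: filterS2 nb nB => q qb qB.
  by move=> sq; apply: (no _ qB); exact: std_point_chart.
by exists b, (coframe_mx th (chart_coord b q)); split=> //; exact: H.
Qed.

(** By the local dichotomy the set of points with a standard frame is open and
    closed. *)
Lemma std_point_everywhere p q : std_point p -> std_point q.
Proof.
move=> sp.
have op : open std_point.
  rewrite openE => x sx; have [//|nx] := std_point_near x.
  by exfalso; exact: (nbhs_singleton nx).
have cl : open (~` std_point).
  rewrite openE => x sx; have [nx|//] := std_point_near x.
  by exfalso; apply: sx; exact: (nbhs_singleton nx).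
have E : std_point = [set: pts M].
  apply: (@mfd_connected _ M); first by exists p.
  - by exists std_point; rewrite // setTI.
  - by exists std_point; rewrite ?setTI// -[std_point]setCK; exact: open_closedC.
by have : [set: pts M] q by []; rewrite -E.
Qed.

End Homogeneity.

(** * The differential system *)

Section StructureEquations.
Variables (R : realType) (M : manifold R) (S : so3_structure M).
Variables (c : 'I_5 -> 'I_5 -> 'I_5 -> R).
Variables (X : 'I_5 -> chart M -> 'rV[R]_5 -> 'rV[R]_5).
Hypothesis hG : transitive_symmetry_algebra S c X.
Implicit Types (a : chart M) (x y u v : 'rV[R]_5).

Lemma bilinear_mxZ k (F : 'M[R]_5) u v : bilinear (k *: F) u v = k * bilinear F u v.
Proof. by rewrite !bilinearE -scalemxAr -scalemxAl mxE. Qed.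

Lemma bilinear_mxN (F : 'M[R]_5) u v : bilinear (- F) u v = - bilinear F u v.
Proof. by rewrite -scaleN1r bilinear_mxZ mulN1r. Qed.

Lemma sym_span2 a x (F F' : 'M[R]_5) : cim a x ->
  (forall s t, bilinear F (X s a x) (X t a x) = bilinear F' (X s a x) (X t a x)) ->
  F = F'.
Proof.
move=> ax E; have uA := sym_mx_unit hG ax; have uAT : (sym_mx X a x)^T \in unitmx.
  by rewrite unitmx_tr.
have B (G : 'M[R]_5) s t :
    (sym_mx X a x *m G *m (sym_mx X a x)^T) s t = bilinear G (X s a x) (X t a x).
  rewrite bilinearE [LHS]mxE [RHS]mxE; apply: eq_bigr => j _.
  by congr (_ * _); rewrite !mxE //; apply: eq_bigr => k _; rewrite mxE.
apply: (can_inj (mulKmx uA)); apply: (can_inj (mulmxK uAT)).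
by apply/matrixP => s t; rewrite !B.
Qed.

(** For an invariant coframe, Cartan's formula reduces to
    d theta (X_s, X_t) = theta [X_s, X_t]. *)
Lemma frame_ext_d a V th C y s t i : adapted_on S a V th -> V y ->
  (forall s i, lie_form (X s a) (th i) y = 0) ->
  intertwines (symmetry_frame X a y (coframe_mx th y)) c C ->
  bilinear (ext_d (th i) y) (X s a y) (X t a y) =
  bracket_of C (X s a y *m (coframe_mx th y)^T) (X t a y *m (coframe_mx th y)^T) 0 i.
Proof.
move=> adV Vy L iP; rewrite (structure_equation hG adV s t i Vy) !L !pair0l subrr add0r.
have rP r : X r a y *m (coframe_mx th y)^T =
    delta_mx 0 r *m symmetry_frame X a y (coframe_mx th y).
  by apply/rowP => j; rewrite -rowE [RHS]mxE symmetry_frameE.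
rewrite !rP -iP mxE; apply: eq_bigr => u _.
by rewrite bracket_delta symmetry_frameE coords_pair.
Qed.

Lemma std_diff_system a V th rho eps del : adapted_on S a V th ->
  (forall s i y, V y -> lie_form (X s a) (th i) y = 0) ->
  (forall y, V y -> intertwines (symmetry_frame X a y (coframe_mx th y)) c
     (std_bracket rho 0 (rho * eps) del)) ->
  diff_system rho 0 eps del V th.
Proof.
move=> adV L iP y Vy; have ay := adapted_cim adV Vy.
have E s t i := frame_ext_d s t i adV Vy (fun s i => L s i y Vy) (iP y Vy).
have W s t i j : bilinear (wedge (th i y) (th j y)) (X s a y) (X t a y) =
    minor2 (X s a y *m (coframe_mx th y)^T) (X t a y *m (coframe_mx th y)^T) i j.
  by rewrite bilinear_wedge /minor2 !coords_pair; ring.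
have br s t := std_bracketE rho 0 (rho * eps) del
  (X s a y *m (coframe_mx th y)^T) (X t a y *m (coframe_mx th y)^T).
by split; apply: (sym_span2 ay) => s t; rewrite E !(bilinear_mxD, bilinear_mxN, bilinear_mxZ) !W;
  have [e1 e2 e3 e4 e5] := br s t; rewrite ?(e1, e2, e3, e4, e5) ?cos0 ?sin0
    -?[Num.sqrt 3]/(@sq3 R); move: (minor2 _ _) => m; field.
Qed.

End StructureEquations.

(** * The Lie algebras of G_0 and G_1 *)

Lemma ord2_ind (P : 'I_2 -> Prop) : P ord0 -> P ord_max -> forall i, P i.
Proof.
move=> p0 p1 [[|[|//]] p]; first by rewrite (_ : Ordinal p = ord0)//; apply: val_inj.
by rewrite (_ : Ordinal p = ord_max)//; apply: val_inj.
Qed.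

Section LieAlgebras.
Variable R : realType.
Implicit Types (c : 'I_5 -> 'I_5 -> 'I_5 -> R) (u v : 'rV[R]_5).

Lemma lie_isomorphic_intro (W : lmodType R) c P C (L : set W)
    (brW : W -> W -> W) (f : 'rV[R]_5 -> W) :
  P \in unitmx -> intertwines P c C ->
  linear f -> injective f -> range f = L ->
  (forall u v, f (bracket_of C u v) = brW (f u) (f v)) ->
  lie_isomorphic (bracket_of c) L brW.
Proof.
move=> uP iP lf If Rf Bf; pose g u := f (u *m P).
have lg : linear g by move=> k u v; rewrite /g mulmxDl -scalemxAl lf.
pose G : {linear 'rV[R]_5 -> W} := HB.pack g (GRing.isLinear.Build _ _ _ _ g lg).
exists G; split.
- by move=> u v /If/(can_inj (mulmxK uP)).
- rewrite -Rf; apply/seteqP; split=> _ [u _ <-]; first by exists (u *m P).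
  by exists (u *m invmx P); rewrite //= /g mulmxKV.
- by move=> u v; rewrite /= /g iP Bf.
Qed.

Section Delta1.
Variables rho eps : R.
Hypotheses (rho_gt0 : 0 < rho) (eps2 : eps ^+ 2 = 1).

Let rho0 : rho != 0. Proof. exact: lt0r_neq0. Qed.

(** With v_j the basis dual to alpha^j: rho v_1 = e_4, v_3 = e_2 + (epsilon
    / sqrt 3) e_1, v_4 = e_3 + epsilon e_5, while v_2 is proportional to
    e_3 - epsilon e_5 and v_5 to e_1. *)
Definition G1_coords u : 'rV[R]_5 :=
  \row_(j < 5) nth 0 [:: rho * u 0 o4; rho * (eps * u 0 o3 - u 0 o5); u 0 o2;
    2^-1 * (u 0 o3 + eps * u 0 o5); 2^-1 * (u 0 o2 - sq3 * eps * u 0 o1)] j.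

Definition G1_point v : 'rV[R]_5 :=
  \row_(j < 5) nth 0 [:: eps * sq3 / 3 * (v 0 o3 - 2 * v 0 o5); v 0 o3;
    v 0 o4 + eps / (2 * rho) * v 0 o2; v 0 o1 / rho;
    eps * v 0 o4 - v 0 o2 / (2 * rho)] j.

Lemma G1_pointK : cancel G1_point G1_coords.
Proof.
move=> v; apply/rowP => j; rewrite mxE !mxE; have s3 := sqrt3_sq R.
by elim/ord5_ind: j; rewrite /=; field: eps2 s3; rewrite ?rho0.
Qed.

Lemma G1_coordsK : cancel G1_coords G1_point.
Proof.
move=> v; apply/rowP => j; rewrite mxE !mxE; have s3 := sqrt3_sq R.
by elim/ord5_ind: j; rewrite /=; field: eps2 s3; rewrite ?rho0.
Qed.

Lemma G1_coords_bracket u v :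
  G1_coords (bracket_of (std_bracket rho 0 (rho * eps) 1) u v) =
  G1_bracket (G1_coords u) (G1_coords v).
Proof.
have [e1 e2 e3 e4 e5] := std_bracketE rho 0 (rho * eps) 1 u v; have s3 := sqrt3_sq R.
rewrite /G1_coords e1 e2 e3 e4 e5 /minor2; apply/rowP => j; rewrite /G1_bracket !mxE.
move: (u 0 o1) (u 0 o2) (u 0 o3) (u 0 o4) (u 0 o5) => u1 u2 u3 u4 u5.
move: (v 0 o1) (v 0 o2) (v 0 o3) (v 0 o4) (v 0 o5) => v1 v2 v3 v4 v5.
by elim/ord5_ind: j; rewrite /=; field: eps2 s3.
Qed.

Lemma lie_isomorphic_G1 c P : P \in unitmx ->
  intertwines P c (std_bracket rho 0 (rho * eps) 1) ->
  lie_isomorphic (bracket_of c) [set: 'rV[R]_5] G1_bracket.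
Proof.
move=> uP iP; apply: (lie_isomorphic_intro (f := G1_coords) uP iP).
- move=> k u v; apply/rowP => j; rewrite !mxE.
  by elim/ord5_ind: j; rewrite /=; field.
- exact: can_inj G1_coordsK.
- by apply/seteqP; split=> // v _; exists (G1_point v) => //; rewrite G1_pointK.
- exact: G1_coords_bracket.
Qed.

End Delta1.

Section Delta0.
Variables rho eps : R.
Hypotheses (rho_gt0 : 0 < rho) (eps2 : eps ^+ 2 = 1).

Let rho0 : rho != 0. Proof. exact: lt0r_neq0. Qed.

(** The matrix of the vector product with (x, y, z). *)
Definition cross_mx (x y z : R) : 'M[R]_3 := \matrix_(i, j)
  match val i, val j with
  | 0, 1 => - z | 0, 2 => y | 1, 0 => z | 1, 2 => - x | 2, 0 => - y | 2, 1 => x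
  | _, _ => 0
  end.

Definition affine_mx (a b : R) : 'M[R]_2 := \matrix_(i, j)
  match val i, val j with 0, 0 => a | 0, 1 => b | _, _ => 0 end.

(** Here e_1, e_3, e_5 span so(3), and aff(1) is spanned by e_4, which commutes
    with them, and by e_2 + (epsilon / sqrt 3) e_1; the term in e_2 of the first
    coordinate is the price of this correction. *)
Definition G0_coords u : ('M[R]_3 * 'M[R]_2)%type :=
  (cross_mx (sq3 * rho * eps * u 0 o1 - rho * u 0 o2) (2 * rho * u 0 o5) (2 * rho * u 0 o3),
   affine_mx (2 * rho * u 0 o4) (u 0 o2)).

Lemma cross_mx_bracket x y z x' y' z' :
  cross_mx x y z *m cross_mx x' y' z' - cross_mx x' y' z' *m cross_mx x y z =
  cross_mx (y * z' - z * y') (z * x' - x * z') (x * y' - y * x').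
Proof.
apply/matrixP => i j; rewrite !mxE !sum3 !mxE.
by elim/ord3_ind: i; elim/ord3_ind: j; rewrite /=; ring.
Qed.

Lemma affine_mx_bracket a b a' b' :
  affine_mx a b *m affine_mx a' b' - affine_mx a' b' *m affine_mx a b =
  affine_mx 0 (a * b' - a' * b).
Proof.
apply/matrixP => i j; rewrite !mxE !big_ord_recr !big_ord0 /= !mxE /=.
by case: i => [[|[|//]] ?]; case: j => [[|[|//]] ?]; rewrite /=; ring.
Qed.

Lemma G0_coords_bracket u v :
  G0_coords (bracket_of (std_bracket rho 0 (rho * eps) 0) u v) =
  G0_bracket (G0_coords u) (G0_coords v).
Proof.
have [e1 e2 e3 e4 e5] := std_bracketE rho 0 (rho * eps) 0 u v; have s3 := sqrt3_sq R.
rewrite /G0_bracket /= cross_mx_bracket affine_mx_bracket /G0_coords e1 e2 e3 e4 e5 /minor2.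
move: (u 0 o1) (u 0 o2) (u 0 o3) (u 0 o4) (u 0 o5) => u1 u2 u3 u4 u5.
move: (v 0 o1) (v 0 o2) (v 0 o3) (v 0 o4) (v 0 o5) => v1 v2 v3 v4 v5.
by congr (cross_mx _ _ _, affine_mx _ _); field: eps2 s3.
Qed.

Lemma G0_coords_range : range G0_coords = G0_algebra.
Proof.
apply/seteqP; split=> [_ [u _ <-]|[A B] [/= skA B0]].
  split=> /=.
    apply/matrixP => i j; rewrite !mxE.
    by elim/ord3_ind: i; elim/ord3_ind: j; rewrite /= ?oppr0 ?opprK.
  by apply/rowP => j; rewrite !mxE.
pose b := B ord0 ord_max.
exists (\row_(j < 5) nth 0 [:: eps * sq3 / (3 * rho) * (A q3 q2 + rho * b); b;
   A q2 q1 / (2 * rho); B ord0 ord0 / (2 * rho); A q1 q3 / (2 * rho)] j) => //.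
have s3 := sqrt3_sq R.
have sk (i j : 'I_3) : A i j = - A j i by move/matrixP: skA => /(_ j i); rewrite !mxE.
have d (i : 'I_3) : A i i = 0 by have := sk i i => ?; lra.
have B1 (j : 'I_2) : B ord_max j = 0 by move/rowP: B0 => /(_ j); rewrite !mxE.
congr (_, _); apply/matrixP => i j; rewrite mxE.
  rewrite !mxE /=; have := (sk q1 q2, sk q3 q1, sk q2 q3) => -[[a12 a31] a23].
  elim/ord3_ind: i; elim/ord3_ind: j; rewrite /= ?d ?a12 ?a31 ?a23 //;
    field: eps2 s3; exact: rho0.
move: i j; apply: ord2_ind; apply: ord2_ind; rewrite /= ?mxE /= ?B1 //.
by field; exact: rho0.
Qed.

Lemma lie_isomorphic_G0 c P : P \in unitmx ->
  intertwines P c (std_bracket rho 0 (rho * eps) 0) ->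
  lie_isomorphic (bracket_of c) (@G0_algebra R) G0_bracket.
Proof.
move=> uP iP; apply: (lie_isomorphic_intro (f := G0_coords) uP iP).
- move=> k u v; rewrite /G0_coords !mxE; congr (_, _); apply/matrixP => i j; rewrite !mxE.
    by elim/ord3_ind: i; elim/ord3_ind: j; rewrite /=; ring.
  by case: i => [[|[|//]] ?]; case: j => [[|[|//]] ?]; rewrite /=; ring.
- move=> u v [] /matrixP E /matrixP F.
  have r2 : 2 * rho != 0 by rewrite mulf_neq0.
  have f4 : u 0 o4 = v 0 o4 by apply: (mulfI r2); have := F ord0 ord0; rewrite !mxE.
  have f2 : u 0 o2 = v 0 o2 by have := F ord0 ord_max; rewrite !mxE.
  have f5 : u 0 o5 = v 0 o5 by apply: (mulfI r2); have := E q1 q3; rewrite !mxE.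
  have f3 : u 0 o3 = v 0 o3 by apply: (mulfI r2); have := E q2 q1; rewrite !mxE.
  have f1 : u 0 o1 = v 0 o1.
    have := E q3 q2; rewrite !mxE /= f2 => /addIr; apply: mulfI.
    rewrite !mulf_neq0 ?(lt0r_neq0 (sqrt3_gt0 R))//.
    by apply: contra_eq_neq eps2 => ->; rewrite expr0n eq_sym oner_neq0.
  by apply/rowP; elim/ord5_ind.
- exact: G0_coords_range.
- exact: G0_coords_bracket.
Qed.

End Delta0.

End LieAlgebras.

(** * Connection, torsion and curvature in frame components *)

Section FrameComponents.
Variable R : realType.
Variables (V : set 'rV[R]_5) (th : 'I_5 -> 'rV[R]_5 -> 'rV[R]_5).
Hypotheses (oV : open V) (cof : coframe_on V th).
Implicit Types (x y u v : 'rV[R]_5).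

Let T x := coframe_mx th x.
Let uT x : V x -> T x \in unitmx. Proof. by case: cof => _; exact. Qed.

Lemma frame_compD x (A B : 'M[R]_5) :
  frame_comp th x (A + B) = frame_comp th x A + frame_comp th x B.
Proof. by rewrite /frame_comp mulmxDr mulmxDl. Qed.

Lemma frame_compZ x k (A : 'M[R]_5) : frame_comp th x (k *: A) = k *: frame_comp th x A.
Proof. by rewrite /frame_comp -scalemxAr -scalemxAl. Qed.

Lemma frame_comp_sum x (F : 'I_5 -> 'M[R]_5) :
  frame_comp th x (\sum_i F i) = \sum_i frame_comp th x (F i).
Proof. by rewrite !sum5 !frame_compD. Qed.

Lemma frame_comp_wedge x u v j k : V x ->
  frame_comp th x (wedge (u *m T x) (v *m T x)) j k = u 0 j * v 0 k - u 0 k * v 0 j.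
Proof.
move=> Vx; have E (p q : 'rV[R]_5) : wedge p q = p^T *m q - q^T *m p.
  by apply/matrixP => m n; rewrite !mxE !big_ord1 !mxE [q 0 m * _]mulrC.
have -> : frame_comp th x (wedge (u *m T x) (v *m T x)) = wedge u v.
  rewrite !E !trmx_mul /frame_comp.
  rewrite !mulmxA -(mulmxA _ u^T) -(mulmxA _ v^T).
  rewrite -!(mulmxA (T x)^T) -mulmxBr trmx_inv !mulmxA mulVmx ?unitmx_tr ?uT// mul1mx.
  by rewrite -mulmxBl mulmxK ?uT.
by rewrite mxE.
Qed.

Lemma coframe_delta x i : th i x = delta_mx 0 i *m T x.
Proof. by rewrite -rowE rowK. Qed.

Lemma partialE m (f : 'rV[R]_5 -> R) x : partial m f x = along (delta_mx 0 m) f x.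
Proof.
rewrite /along (bigD1 m)//= mxE !eqxx mul1r big1 ?addr0// => i im.
by rewrite mxE (negbTE im) andbF mul0r.
Qed.

(** The equality of the forms is needed on all of V, as ext_d differentiates. *)
Lemma ext_d_comb (w : 'rV[R]_5 -> 'rV[R]_5) u x : V x ->
  (forall y, V y -> w y = u *m T y) -> ext_d w x = \sum_p u 0 p *: ext_d (th p) x.
Proof.
move=> Vx wE; have [sth _] := cof.
have P m n : partial m (fun y => w y 0 n) x = \sum_p u 0 p * partial m (fun y => th p y 0 n) x.
  rewrite partialE (along_ext (g := fun y => \sum_p u 0 p * th p y 0 n) _ oV Vx); last first.
    by move=> y Vy; rewrite wE// mxE; apply: eq_bigr => p _; rewrite mxE.
  have d p := smooth_has_partials (sth p n) Vx.
  rewrite along_sum => [|p]; last exact: has_partialsM (@has_partials_cst R _ x) (d p).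
  apply: eq_bigr => p _; rewrite (alongM _ (@has_partials_cst R _ x) (d p)).
  by rewrite along_cst mul0r add0r -partialE.
apply/matrixP => m n; rewrite mxE !P summxE -sumrB; apply: eq_bigr => p _.
by rewrite !mxE mulrBr.
Qed.

(** The connection with Gamma = \sum_s E_s (\sum_p G_sp th^p). *)
Definition conn_coef (G : 'I_3 -> 'I_5 -> R) (i j p : 'I_5) : R :=
  E_coef 0 i j * G q1 p + E_coef 1 i j * G q2 p + E_coef 2 i j * G q3 p.

Lemma conn_form_coef (ga : 'I_3 -> 'rV[R]_5 -> 'rV[R]_5) G i j x :
  (forall s, ga s x = (\row_p G s p) *m T x) ->
  conn_form ga i j x = (\row_p conn_coef G i j p) *m T x.
Proof.
move=> gaE; rewrite /conn_form sum3 !EmxE !gaE !scalemxAl -!mulmxDl; congr (_ *m _).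
by apply/rowP => p; rewrite !mxE.
Qed.

Lemma torsion_coef (ga : 'I_3 -> 'rV[R]_5 -> 'rV[R]_5) G x i j k : V x ->
  (forall s, ga s x = (\row_p G s p) *m T x) ->
  torsion th ga x i j k =
  frame_comp th x (ext_d (th i) x) j k + conn_coef G i k j - conn_coef G i j k.
Proof.
move=> Vx gaE; rewrite /torsion frame_compD frame_comp_sum mxE -addrA summxE; congr (_ + _).
transitivity (\sum_l (conn_coef G i l j * (k == l)%:R - conn_coef G i l k * (j == l)%:R)).
  apply: eq_bigr => l _; rewrite (conn_form_coef _ _ gaE) coframe_delta frame_comp_wedge//.
  by rewrite !mxE.
have D (F : 'I_5 -> R) (m : 'I_5) : \sum_l F l * (m == l)%:R = F m.
  rewrite (bigD1 m)//= eqxx mulr1 big1 ?addr0// => l lm.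
  by rewrite eq_sym (negbTE lm) mulr0.
by rewrite big_split /= sumrN !D.
Qed.

Lemma curvature_coef (ga : 'I_3 -> 'rV[R]_5 -> 'rV[R]_5) G x i j k l : V x ->
  (forall s y, V y -> ga s y = (\row_p G s p) *m T y) ->
  curvature th ga x i j k l =
  \sum_p conn_coef G i j p * frame_comp th x (ext_d (th p) x) k l
  + \sum_m (conn_coef G i m k * conn_coef G m j l - conn_coef G i m l * conn_coef G m j k).
Proof.
move=> Vx gaE; rewrite /curvature frame_compD mxE; congr (_ + _).
  rewrite (ext_d_comb (u := \row_p conn_coef G i j p) Vx); last first.
    by move=> y Vy; exact: (conn_form_coef _ _ (fun s => gaE s y Vy)).
  rewrite frame_comp_sum summxE; apply: eq_bigr => p _.
  by rewrite frame_compZ !mxE.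
rewrite frame_comp_sum summxE; apply: eq_bigr => m _.
by rewrite !(conn_form_coef _ _ (fun s => gaE s x Vx)) frame_comp_wedge// !mxE.
Qed.

(** As E_s is skew, the hypothesis says that the tensor is totally skew; on
    indices with i = j it already kills all coefficients but G_31. *)
Lemma conn_coef_skew_eq0 (G : 'I_3 -> 'I_5 -> R) :
  (forall i j k, conn_coef G i k j + conn_coef G j k i = 0) ->
  forall s p, G s p = 0.
Proof.
move=> H; have s0 := sqrt3_gt0 R.
have Z (z : R) : sq3 * z = 0 -> z = 0.
  by move=> /eqP; rewrite mulf_eq0 (gt_eqF s0) => /eqP.
have d i k : conn_coef G i k i = 0 by have := H i i k => ?; lra.
have h (i k : 'I_5) : E_coef 0 i k * G q1 i + E_coef 1 i k * G q2 i + E_coef 2 i k * G q3 i = 0 :> R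
  := d i k.
have a1 : G q1 o1 = 0 by apply: Z; have := h o1 o5; rewrite /= => ?; lra.
have a5 : G q1 o5 = 0 by apply: Z; have := h o5 o1; rewrite /= => ?; lra.
have a2 : G q1 o2 = 0 by have := h o2 o3; rewrite /= => ?; lra.
have a3 : G q1 o3 = 0 by have := h o3 o2; rewrite /= => ?; lra.
have a4 : G q1 o4 = 0 by have := h o4 o5; rewrite /= => ?; lra.
have b1 : G q2 o1 = 0 by apply: Z; have := h o1 o3; rewrite /= => ?; lra.
have b3 : G q2 o3 = 0 by apply: Z; have := h o3 o1; rewrite /= => ?; lra.
have b2 : G q2 o2 = 0 by have := h o2 o5; rewrite /= => ?; lra.
have b5 : G q2 o5 = 0 by have := h o5 o2; rewrite /= => ?; lra.
have b4 : G q2 o4 = 0 by have := h o4 o3; rewrite /= => ?; lra.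
have c2 : G q3 o2 = 0 by have := h o2 o4; rewrite /= => ?; lra.
have c4 : G q3 o4 = 0 by have := h o4 o2; rewrite /= => ?; lra.
have c3 : G q3 o3 = 0 by have := h o3 o5; rewrite /= => ?; lra.
have c5 : G q3 o5 = 0 by have := h o5 o3; rewrite /= => ?; lra.
have c1 : G q3 o1 = 0.
  by have := H o2 o1 o4; rewrite /conn_coef /= => ?; lra.
by elim/ord3_ind; elim/ord5_ind.
Qed.

End FrameComponents.

(** * The characteristic connection of the differential system *)

Section Curvature.
Variable R : realType.
Variables (rho phi eps del : R).
Hypothesis pars : parameters rho phi eps del.
Variables (V : set 'rV[R]_5) (th : 'I_5 -> 'rV[R]_5 -> 'rV[R]_5).
Hypotheses (oV : open V) (cof : coframe_on V th).
Hypothesis dth : diff_system rho phi eps del V th.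
Implicit Types (x y u v : 'rV[R]_5).

Let x0 := rho * cos phi.
Let y0 := rho * sin phi.
Let w0 := rho * eps.

Lemma frame_comp_ext_d x (i j k : 'I_5) : V x ->
  frame_comp th x (ext_d (th i) x) j k = std_bracket x0 y0 w0 del j k i.
Proof.
move=> Vx; have [e1 e2 e3 e4 e5] := dth Vx.
pose e (j k p q : 'I_5) : R := (val j == val p)%:R * (val k == val q)%:R -
  (val k == val p)%:R * (val j == val q)%:R.
have W p q : frame_comp th x (wedge (th p x) (th q x)) j k = e j k p q.
  by rewrite !coframe_delta (frame_comp_wedge cof)// !mxE.
have L k' (A : 'M[R]_5) : frame_comp th x (k' *: A) j k = k' * frame_comp th x A j k.
  by rewrite frame_compZ mxE.
have D (A B : 'M[R]_5) : frame_comp th x (A + B) j k =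
    frame_comp th x A j k + frame_comp th x B j k by rewrite frame_compD mxE.
have N (A : 'M[R]_5) : frame_comp th x (- A) j k = - frame_comp th x A j k.
  by rewrite -scaleN1r L mulN1r.
elim/ord5_ind: i; rewrite ?(e1, e2, e3, e4, e5) !(D, N, L, W) -?[Num.sqrt 3]/(@sq3 R) /std_bracket
  /x0 /y0 /w0; move: sq3 (cos phi) (sin phi) => s3 cs sn; clear W L D N; rewrite /e;
  elim/ord5_ind: j; elim/ord5_ind: k; rewrite /=; by field.
Qed.

(** gamma^1 = - delta rho epsilon theta^3, gamma^2 = delta rho epsilon theta^5
    and gamma^3 = (rho epsilon / sqrt 3) theta^1 + rho cos phi theta^2
    + rho sin phi theta^4. *)
Definition canonical_conn (s : 'I_3) (p : 'I_5) : R :=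
  match val s, val p with
  | 0, 2 => - (del * w0) | 1, 4 => del * w0
  | 2, 0 => sq3 / 3 * w0 | 2, 1 => x0 | 2, 3 => y0
  | _, _ => 0
  end.

Definition std_torsion (G : 'I_3 -> 'I_5 -> R) (i j k : 'I_5) : R :=
  std_bracket x0 y0 w0 del j k i + conn_coef G i k j - conn_coef G i j k.

Lemma canonical_torsion_skew i j k :
  std_torsion canonical_conn i j k = - std_torsion canonical_conn j i k.
Proof.
have s3 := sqrt3_sq R.
rewrite /std_torsion /std_bracket /conn_coef /canonical_conn; move: x0 y0 w0 => x1 y1 w1.
elim/ord5_ind: i; elim/ord5_ind: j; elim/ord5_ind: k; rewrite /=; by field: s3.
Qed.

Lemma canonical_connection : characteristic_connection V th
  (fun s y => (\row_p canonical_conn s p) *m coframe_mx th y).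
Proof.
have [sth _] := cof; split=> [s m|x i j k Vx].
  apply: (smooth_ext oV (f := fun y => \sum_p canonical_conn s p * th p y 0 m)) => [y _|].
    by rewrite mxE; apply: eq_bigr => p _; rewrite !mxE.
  apply: (@smooth_sum _ _ _ _ _ oV) => p; apply: (smoothM oV); first exact: smooth_cst.
  exact: sth.
have E (l m n : 'I_5) :
    torsion th (fun s y => (\row_p canonical_conn s p) *m coframe_mx th y) x l m n =
    std_torsion canonical_conn l m n.
  by rewrite (torsion_coef cof (G := canonical_conn) _ _ _ Vx)// frame_comp_ext_d.
by rewrite !E canonical_torsion_skew.
Qed.

(** The difference of the connection coefficients of two connections with skew
    torsion is totally skew, hence zero; in particular the coefficients are
    constant. *)
Lemma characteristic_connection_unique ga : characteristic_connection V th ga ->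
  forall s x, V x -> ga s x = (\row_p canonical_conn s p) *m coframe_mx th x.
Proof.
move=> [_ ch] s x Vx; have uT : coframe_mx th x \in unitmx by case: cof => _; exact.
pose G (s : 'I_3) p := (ga s x *m invmx (coframe_mx th x)) 0 p.
have gaE t : ga t x = (\row_p G t p) *m coframe_mx th x.
  rewrite (_ : \row_p G t p = ga t x *m invmx (coframe_mx th x)) ?mulmxKV//.
  by apply/rowP => p; rewrite mxE.
have D : forall t p, G t p - canonical_conn t p = 0.
  apply: (@conn_coef_skew_eq0 _ (fun t p => G t p - canonical_conn t p)) => i j k.
  have C l m n : conn_coef (fun t p => G t p - canonical_conn t p) l m n =
      conn_coef G l m n - conn_coef canonical_conn l m n.
    by rewrite /conn_coef; ring.
  have TE l m n : torsion th ga x l m n = std_torsion G l m n.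
    by rewrite (torsion_coef cof (G := G) _ _ _ Vx)// frame_comp_ext_d.
  have := ch x i j k Vx; rewrite !TE /std_torsion.
  have := canonical_torsion_skew i j k; rewrite /std_torsion !C.
  have sk (H : 'I_3 -> 'I_5 -> R) (l m n : 'I_5) : conn_coef H l m n = - conn_coef H m l n.
    by rewrite /conn_coef; elim/ord5_ind: l; elim/ord5_ind: m; rewrite /=; ring.
  rewrite (sk G j i) (sk canonical_conn j i).
  move: (conn_coef _ _ _ _) (conn_coef _ _ _ _) => *; lra.
rewrite gaE; congr (_ *m _); apply/rowP => p; rewrite !mxE.
by apply/eqP; rewrite -subr_eq0 D.
Qed.

(** The curvature is \sum_s E_s F_s with F_s = d gamma^s plus the quadratic term,
    for which [E_1, E_2] = E_3 and cyclically. *)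
Definition so3_curvature (s : 'I_3) (k l : 'I_5) : R :=
  \sum_p canonical_conn s p * std_bracket x0 y0 w0 del k l p +
  match val s with
  | 0 => canonical_conn q2 k * canonical_conn q3 l - canonical_conn q2 l * canonical_conn q3 k
  | 1 => canonical_conn q3 k * canonical_conn q1 l - canonical_conn q3 l * canonical_conn q1 k
  | _ => canonical_conn q1 k * canonical_conn q2 l - canonical_conn q1 l * canonical_conn q2 k
  end.

Lemma conn_coef_commutator (G : 'I_3 -> 'I_5 -> R) (i j k l : 'I_5) :
  \sum_m (conn_coef G i m k * conn_coef G m j l - conn_coef G i m l * conn_coef G m j k) =
  E_coef 0 i j * (G q2 k * G q3 l - G q2 l * G q3 k)
  + E_coef 1 i j * (G q3 k * G q1 l - G q3 l * G q1 k)
  + E_coef 2 i j * (G q1 k * G q2 l - G q1 l * G q2 k).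
Proof.
have s3 := sqrt3_sq R; rewrite sum5 /conn_coef.
move: (G q1 k) (G q2 k) (G q3 k) (G q1 l) (G q2 l) (G q3 l) => a b c a' b' c'.
elim/ord5_ind: i; elim/ord5_ind: j; rewrite /=; ring: s3.
Qed.

Lemma curvature_so3 ga x i j k l : characteristic_connection V th ga -> V x ->
  curvature th ga x i j k l = E_coef 0 i j * so3_curvature q1 k l
    + E_coef 1 i j * so3_curvature q2 k l + E_coef 2 i j * so3_curvature q3 k l.
Proof.
move=> ch Vx.
rewrite (curvature_coef oV cof (G := canonical_conn) i j k l Vx); last first.
  by move=> s y Vy; exact: characteristic_connection_unique.
rewrite conn_coef_commutator /so3_curvature /conn_coef.
move: (E_coef 0 i j) (E_coef 1 i j) (E_coef 2 i j) => a b c.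
under eq_bigr => p _ do rewrite frame_comp_ext_d// !mulrDl -!mulrA.
rewrite !big_split /= -!mulr_sumr.
by move: canonical_conn => G; ring.
Qed.

(** The forms F_s divided by rho^2; rho and epsilon enter only through
    (rho epsilon)^2 = rho^2, and phi through cos^2 + sin^2. *)
Definition curvature_coefs (s k l : nat) : R :=
  match s, k, l with
  | 0, 0, 4 => - (del * sq3 / 3) | 0, 4, 0 => del * sq3 / 3
  | 0, 1, 2 | 0, 3, 4 => - del | 0, 2, 1 | 0, 4, 3 => del
  | 1, 0, 2 => - (del * sq3 / 3) | 1, 2, 0 => del * sq3 / 3
  | 1, 1, 4 | 1, 2, 3 => - del | 1, 4, 1 | 1, 3, 2 => del
  | 2, 1, 3 => - (8 / 3) | 2, 3, 1 => 8 / 3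
  | 2, 2, 4 => del - 4 / 3 | 2, 4, 2 => 4 / 3 - del
  | _, _, _ => 0
  end.

Lemma so3_curvatureE (s : 'I_3) (k l : 'I_5) :
  so3_curvature s k l = rho ^+ 2 * curvature_coefs s k l.
Proof.
have s3 := sqrt3_sq R.
have [_ _ e2' d2'] := pars.
have e2 : eps ^+ 2 = 1 by case: e2' => ->; rewrite ?expr1n ?sqrrN ?expr1n.
have d2 : del ^+ 2 = del by case: d2' => ->; rewrite ?expr1n ?expr0n.
have cs : sin phi ^+ 2 = 1 - cos phi ^+ 2 by rewrite -(cos2Dsin2 phi); ring.
rewrite /so3_curvature sum5 /std_bracket /canonical_conn /x0 /y0 /w0.
move: (cos phi) (sin phi) cs => c n cs.
elim/ord3_ind: s; elim/ord5_ind: k; elim/ord5_ind: l; rewrite /=; by field: s3 e2 d2 cs.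
Qed.

End Curvature.

(** * The components of the curvature *)

Section AlternatingSums.
Variables (R : comPzRingType).

(** A permutation is determined by its value at 0 and a permutation of the
    remaining indices. *)
Lemma sum_lift_perm n (F : 'S_n.+1 -> R) :
  \sum_s F s = \sum_i \sum_(s : 'S_n) F (lift_perm ord0 i s).
Proof.
pose h (p : 'I_n.+1 * 'S_n) := lift_perm ord0 p.1 p.2.
have injh : injective h.
  move=> [i s] [j t]; rewrite /h /= => /permP E; have ij : i = j.
    by have := E ord0; rewrite !lift_perm_id.
  rewrite ij in E *; congr (_, _); apply/permP => k.
  by have := E (lift ord0 k); rewrite !lift_perm_lift => /lift_inj.
have bijh : bijective h.
  by apply: inj_card_bij injh _; rewrite card_prod !card_Sn card_ord factS.
by rewrite (reindex h) ?pair_big//=; exact: onW_bij.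
Qed.

Lemma alternating_sum4 (F : nat -> nat -> nat -> nat -> R) :
  \sum_(s : 'S_4) (-1) ^+ s * F (s (inord 0)) (s (inord 1)) (s (inord 2)) (s (inord 3)) =
  F 0 1 2 3 - F 0 1 3 2 + F 0 2 3 1 - F 0 2 1 3 + F 0 3 1 2 - F 0 3 2 1
  - F 1 0 2 3 + F 1 0 3 2 - F 1 2 3 0 + F 1 2 0 3 - F 1 3 0 2 + F 1 3 2 0
  + F 2 0 1 3 - F 2 0 3 1 + F 2 1 3 0 - F 2 1 0 3 + F 2 3 0 1 - F 2 3 1 0
  - F 3 0 1 2 + F 3 0 2 1 - F 3 1 2 0 + F 3 1 0 2 - F 3 2 0 1 + F 3 2 1 0.
Proof.
have -> : inord 0 = ord0 :> 'I_4 by apply: val_inj; rewrite /= inordK.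
have -> : inord 1 = lift ord0 ord0 :> 'I_4 by apply: val_inj; rewrite /= inordK.
have -> : inord 2 = lift ord0 (lift ord0 ord0) :> 'I_4 by apply: val_inj; rewrite /= inordK.
have -> : inord 3 = lift ord0 (lift ord0 (lift ord0 ord0)) :> 'I_4.
  by apply: val_inj; rewrite /= inordK.
rewrite sum_lift_perm; under eq_bigr => i _ do rewrite sum_lift_perm.
under eq_bigr => i _ do under eq_bigr => j _ do rewrite sum_lift_perm.
under eq_bigr => i _ do under eq_bigr => j _ do under eq_bigr => k _ do rewrite sum_lift_perm.
under eq_bigr => i _ do under eq_bigr => j _ do under eq_bigr => k _ do
  under eq_bigr => l _ do under eq_bigr => s _ do
  rewrite !odd_lift_perm !lift_perm_lift !lift_perm_id.
have S0 (G : 'S_0 -> R) : \sum_s G s = G 1%g.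
  have s1 (s : 'S_0) : s = 1%g by apply/permP; case.
  by apply: big_pred1 => s; rewrite (s1 s) /= eqxx.
under eq_bigr => i _ do under eq_bigr => j _ do under eq_bigr => k _ do
  under eq_bigr => l _ do rewrite S0 odd_perm1.
rewrite !big_ord_recl !big_ord0 /= /bump /=.
rewrite !(add0n, addn0, add1n) expr0 expr1; ring.
Qed.

End AlternatingSums.

Section CurvatureType.
Variables (R : realType) (rho del : R).
Hypotheses (rho_gt0 : 0 < rho) (del01 : del = 0 \/ del = 1).
Variable K : 'I_5 -> 'I_5 -> 'I_5 -> 'I_5 -> R.

Let Kt (i j k l : nat) : R := rho ^+ 2 *
  (E_coef 0 i j * curvature_coefs del 0 k l + E_coef 1 i j * curvature_coefs del 1 k l
   + E_coef 2 i j * curvature_coefs del 2 k l).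

Hypothesis KE : forall i j k l, K i j k l = Kt i j k l.

Lemma curv_ricciE : curv_ricci K = (rho ^+ 2) *:
  diag_mx (\row_(j < 5) nth 0 [:: - (2 * del); - (16 / 3) - 2 * del; - (4 / 3) - 2 * del;
    - (16 / 3) - 2 * del; - (4 / 3) - 2 * del] j).
Proof.
have s3 := sqrt3_sq R.
apply/matrixP => j l; rewrite !mxE sum5 !KE /Kt.
elim/ord5_ind: j; elim/ord5_ind: l; rewrite /= ?mulr0n ?mulr1n; by field: s3.
Qed.

Lemma curv_ricci_tr : \tr (curv_ricci K) = - (rho ^+ 2 * (40 / 3 + 10 * del)).
Proof.
rewrite curv_ricciE linearZ /= mxtrace_diag sum5 !mxE /=; by field.
Qed.

(** The diagonal of the trace-free Ricci tensor is proportional to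
    (-1, 1, -1/2, 1, -1/2), which is Upsilon at e_1. *)
Lemma curv_sym0E : curv_sym0 K = cubic_mx ups0 (- (8 / 3 * rho ^+ 2) *: delta_mx 0 o1).
Proof.
apply/matrixP => i j; rewrite /curv_sym0 curv_ricci_tr curv_ricciE !mxE sum5 !ups0E !mxE.
elim/ord5_ind: i; elim/ord5_ind: j; rewrite /= ?mulr0n ?mulr1n; by field.
Qed.

Lemma curvature_components : curvature_type_1_5_5 K.
Proof.
have r0 := lt0r_neq0 rho_gt0; have s3 := sqrt3_sq R.
have r2 : rho ^+ 2 != 0 by rewrite expf_neq0.
split.
- rewrite /curv_skew curv_ricciE [(_ *: _)^T]linearZ /= tr_diag_mx subrr scaler0 //.
- by exists (- (8 / 3 * rho ^+ 2) *: delta_mx 0 o1); rewrite curv_sym0E.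
- rewrite curv_ricci_tr oppr_eq0 mulf_neq0//.
  by case: del01 => ->; rewrite lt0r_neq0//; lra.
- rewrite curv_sym0E; apply/eqP => /matrixP/(_ o1 o1).
  rewrite !mxE sum5 !ups0E !mxE /= => /eqP.
  rewrite !(mul0r, mulr0, addr0, mulr1) mulN1r opprK mulf_eq0 (negbTE r2) orbF.
  by apply/negP; rewrite lt0r_neq0//; lra.
exists (fun i => lift ord0 i); rewrite /curv_Lambda4.
under eq_bigr => s _ do rewrite KE !lift0.
rewrite (alternating_sum4 (fun a b c d => Kt a.+1 b.+1 c.+1 d.+1)) /Kt /=.
rewrite (_ : 24^-1 * _ = rho ^+ 2 * (8 / 9 - del)); last by field: s3.
rewrite mulf_neq0//; case: del01 => ->; last by rewrite ltr0_neq0//; lra.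
by rewrite lt0r_neq0//; lra.
Qed.

End CurvatureType.

(** * The theorem *)

Section StandardPoint.
Variables (R : realType) (M : manifold R) (S : so3_structure M).
Variables (c : 'I_5 -> 'I_5 -> 'I_5 -> R).
Variables (X : 'I_5 -> chart M -> 'rV[R]_5 -> 'rV[R]_5).
Hypothesis hG : transitive_symmetry_algebra S c X.

(** The torsion is nonzero somewhere, and a standard frame is found there. *)
Lemma exists_std_point : torsion_nonzero S -> torsion_pure_Lambda2_3 S ->
  exists p rho eps del, [/\ 0 < rho, eps = 1 \/ eps = -1, del = 0 \/ del = 1 &
    std_point S c X rho (rho * eps) del p].
Proof.
move=> [a [V [th [ga [x [adV ch Vx T0]]]]]] pure.
have [A [B [G [t0 [t1 [t2 [TE iP]]]]]]] :=
  symmetry_brackets hG adV ch Vx (pure _ _ _ _ _ adV ch Vx).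
have ax := adapted_cim adV Vx; have uT := adapted_unit adV Vx.
have tn0 : ~ [/\ t0 = 0, t1 = 0 & t2 = 0].
  move=> [z0 z1 z2]; have [i [j [k /negP]]] := T0; apply; apply/eqP.
  rewrite TE z0 z1 z2; elim/ord5_ind: i; elim/ord5_ind: j; elim/ord5_ind: k;
    by rewrite /= ?oppr0 ?mulr0 ?oppr0.
have [Q [rho [eps [del [SQ rho0 e d iQ]]]]] :=
  standard_frame (symmetry_frame_unit hG ax uT) (structure_constants_jacobi hG ax) iP tn0.
have [p pa px] := ax.
exists p, rho, eps, del; split=> //; exists a, (Q *m coframe_mx th x).
split=> //; rewrite px; split.
- exact: adapted_at_gauge SQ (adapted_on_at adV Vx).
- by rewrite unitmx_mul uT andbT; have [OO _] := SQ; have [] := mulmx1_unit OO.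
- by rewrite symmetry_frame_gauge.
Qed.

End StandardPoint.

Theorem theorem6p7 (R : realType) (M : manifold R) (S : so3_structure M)
    (c : 'I_5 -> 'I_5 -> 'I_5 -> R)
    (X : 'I_5 -> chart M -> 'rV[R]_5 -> 'rV[R]_5)
    (hNI : nearly_integrable S)
    (hG : transitive_symmetry_algebra S c X)
    (hT0 : torsion_nonzero S)
    (hT3 : torsion_pure_Lambda2_3 S) :
  (exists rho phi eps del : R,
    [/\ parameters rho phi eps del,
        (forall p : M, exists (a : chart M) (V : set 'rV[R]_5)
             (th : 'I_5 -> 'rV[R]_5 -> 'rV[R]_5),
           [/\ cdom a p, V (chart_coord a p), adapted_on S a V th,
               (forall (s i : 'I_5) (x : 'rV[R]_5), V x ->
                  lie_form (X s a) (th i) x = 0) &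
               diff_system rho phi eps del V th]),
        (del = 0 ->
           lie_isomorphic (bracket_of c) G0_algebra G0_bracket) &
        (del = 1 ->
           lie_isomorphic (bracket_of c) [set: 'rV[R]_5] G1_bracket)]) /\
  (forall (rho phi eps del : R), parameters rho phi eps del ->
   forall (V : set 'rV[R]_5) (th : 'I_5 -> 'rV[R]_5 -> 'rV[R]_5),
     open V -> coframe_on V th -> diff_system rho phi eps del V th ->
     (exists ga : 'I_3 -> 'rV[R]_5 -> 'rV[R]_5,
        characteristic_connection V th ga) /\
     (forall (ga : 'I_3 -> 'rV[R]_5 -> 'rV[R]_5) (x : 'rV[R]_5),
        characteristic_connection V th ga -> V x ->
        curvature_type_1_5_5 (curvature th ga x))).
Proof.
split; last first.
  move=> rho phi eps del pars V th oV cof ds; split.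
    by eexists; exact: (canonical_connection oV cof ds).
  move=> ga x ch Vx; have [rho0 _ _ d] := pars.
  apply: (curvature_components rho0 d) => i j k l.
  by rewrite (curvature_so3 oV cof ds _ _ _ _ ch Vx) !(so3_curvatureE pars) /=; ring.
have [p0 [rho [eps [del [rho0 e d sp0]]]]] := exists_std_point hG hT0 hT3.
have e2 : eps ^+ 2 = 1 by case: e => ->; rewrite ?sqrrN expr1n.
exists rho, 0, eps, del.
have [a0 [Th [pa0 [_ uT iP]]]] := sp0.
have ax0 : cim a0 (chart_coord a0 p0) by exists p0.
have uP := symmetry_frame_unit hG ax0 uT.
split.
- by split=> //; rewrite lexx /= mulr_gt0// pi_gt0.
- move=> p; have sp := std_point_everywhere hG rho0 p sp0.
  have [a pa] := cdom_cover p.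
  have [r [th [r0 [adV L sV]]]] := std_point_coframe hG rho0 sp pa.
  exists a, (ball (chart_coord a p) r), th; split=> //; first exact: ballxx.
  by apply: (std_diff_system hG adV L) => y By; have [] := sV y By.
- by move=> d0; rewrite d0 in iP; exact: (lie_isomorphic_G0 rho0 e2 uP iP).
- by move=> d1; rewrite d1 in iP; exact: (lie_isomorphic_G1 rho0 e2 uP iP).
Qed.
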